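(* Let $n\ge 2$ be an integer, let $\alpha\in[0,1)$, and let $\{\mathcal{E}_0,H_0,\mathcal{E}_1,H_1\}$ be admissible boundary data (with parameters $n,\alpha$). (a) Whenever the Riemann--Hilbert problem (RH) associated with the data has a solution (for every $(x,y)\in D$), there exists a $C^n$-solution of the Goursat problem for the Ernst--Maxwell equations in $D$ with data $\{\mathcal{E}_0,H_0,\mathcal{E}_1,H_1\}$. (b) For fixed $\delta\in(0,1)$, there always exists a $C^n$-solution of the Goursat problem for the Ernst--Maxwell equations in the smaller triangle $D_\delta=D\cap\{(x,y):x+y<1-\delta\}$ with data $\{\mathcal{E}_0|_{[0,1-\delta)},H_0|_{[0,1-\delta)},\mathcal{E}_1|_{[0,1-\delta)},H_1|_{[0,1-\delta)}\}$ whenever the $L^1([0,1-\delta))$-norms of $A_0$, $B_1$, $H_{0x}/\sqrt{f_0}$ and $H_{1y}/\sqrt{f_1}$ are sufficiently small (i.e. smaller than some constant $c_\delta>0$ depending only on $\delta$).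
   Context: **Domain and equations.** $D=\{(x,y)\in\mathbb{R}^2: x\ge 0,\ y\ge 0,\ x+y<1\}$. The Ernst--Maxwell equations for complex-valued $\mathcal{E}(x,y)$, $H(x,y)$ are $$(\mathrm{Re}\,\mathcal{E}-H\bar H)\Big(\mathcal{E}_{xy}-\frac{\mathcal{E}_x+\mathcal{E}_y}{2(1-x-y)}\Big)=\mathcal{E}_x\mathcal{E}_y-\bar H(\mathcal{E}_xH_y+\mathcal{E}_yH_x),$$ $$(\mathrm{Re}\,\mathcal{E}-H\bar H)\Big(H_{xy}-\frac{H_x+H_y}{2(1-x-y)}\Big)=\tfrac12(\mathcal{E}_xH_y+\mathcal{E}_yH_x)-2\bar H H_xH_y.$$ **Admissible boundary data** (parameters: integer $n\ge2$, $\alpha\in[0,1)$): complex-valued functions $\mathcal{E}_0(x),H_0(x)$, $x\in[0,1)$, and $\mathcal{E}_1(y),H_1(y)$, $y\in[0,1)$, with: $\mathcal{E}_0,H_0,\mathcal{E}_1,H_1\in C([0,1))\cap C^n((0,1))$; $x^\alpha\mathcal{E}_{0x},x^\alpha H_{0x},y^\alpha\mathcal{E}_{1y},y^\alpha H_{1y}\in C([0,1))$ (i.e. they extend continuously to $0$); $\mathcal{E}_0(0)=\mathcal{E}_1(0)=1$; $H_0(0)=H_1(0)=0$; $f_0:=\mathrm{Re}\,\mathcal{E}_0-|H_0|^2>0$ and $f_1:=\mathrm{Re}\,\mathcal{E}_1-|H_1|^2>0$ on $[0,1)$. **$C^n$-solution.** A $C^n$-solution of the Goursat problem in $D$ with data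 $\{\mathcal{E}_0,H_0,\mathcal{E}_1,H_1\}$ is a pair of complex-valued functions $\{\mathcal{E},H\}$ such that: $\mathcal{E},H\in C(D)\cap C^n(\mathrm{int}\,D)$; $\mathcal{E},H$ satisfy the Ernst--Maxwell equations in $\mathrm{int}\,D$; for some $\beta\in[0,1)$, $x^\beta\mathcal{E}_x,x^\beta H_x,y^\beta\mathcal{E}_y,y^\beta H_y,x^\beta y^\beta\mathcal{E}_{xy},x^\beta y^\beta H_{xy}\in C(D)$ (extend continuously to $D$); $\mathcal{E}(x,0)=\mathcal{E}_0(x)$, $H(x,0)=H_0(x)$ for $x\in[0,1)$; $\mathcal{E}(0,y)=\mathcal{E}_1(y)$, $H(0,y)=H_1(y)$ for $y\in[0,1)$; $\mathrm{Re}\,\mathcal{E}-|H|^2>0$ on $D$. A $C^n$-solution in $D_\delta$ is defined in the same way with $D$ replaced by $D_\delta$ and $[0,1)$ by $[0,1-\delta)$. **Riemann surface.** $\hat{\mathbb{C}}=\mathbb{C}\cup\{\infty\}$. For $(x,y)\in D$, $\mathcal{S}_{(x,y)}$ is the Riemann surface of pairs $(\lambda,k)\in\hat{\mathbb{C}}^2$ with $\lambda^2=\frac{k-(1-y)}{k-x}$. For $k\in\hat{\mathbb{C}}\setminus[x,1-y]$ let $k^\pm=(\lambda(x,y,k^\pm),k)\in\mathcal{S}_{(x,y)}$, where $\lambda(x,y,k^+)=\sqrt{\frac{k-(1-y)}{k-x}}$ has positive real part and $\lambda(x,y,k^-)=-\lambda(x,y,k^+)$ (so $\lambda=\pm1$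 at $\infty^\pm$). The branch points are $x=(\infty,x)$ and $1-y=(0,1-y)$. The map $F_{(x,y)}:\mathcal{S}_{(x,y)}\to\hat{\mathbb{C}}$, $(\lambda,k)\mapsto z=\frac{1+\lambda}{1-\lambda}$, is a biholomorphism. Put $\Sigma_0=[0^+,x]\cup[x,0^-]$, $\Sigma_1=[1^-,1-y]\cup[1-y,1^+]$ in $\mathcal{S}_{(x,y)}$ (lifts to both sheets of $[0,x]$ and $[1-y,1]$). **Eigenfunctions.** Let $A_0=\frac{1}{2f_0}(\mathcal{E}_{0x}-2\overline{H_0}H_{0x})$, $B_1=\frac{1}{2f_1}(\mathcal{E}_{1y}-2\overline{H_1}H_{1y})$, $$\mathsf{U}_0(x,k^\pm)=\begin{pmatrix}\overline{A_0}&\lambda\overline{A_0}&\frac{i}{\sqrt{f_0}}H_{0x}\\ \lambda A_0&A_0&-\frac{i\lambda}{\sqrt{f_0}}H_{0x}\\ \frac{i}{\sqrt{f_0}}\overline{H_{0x}}&\frac{i\lambda}{\sqrt{f_0}}\overline{H_{0x}}&\frac12(A_0+\overline{A_0})\end{pmatrix},\quad \lambda=\lambda(x,0,k^\pm),$$ $$\mathsf{V}_1(y,k^\pm)=\begin{pmatrix}\overline{B_1}&\frac1\lambda\overline{B_1}&\frac{i}{\sqrt{f_1}}H_{1y}\\ \frac1\lambda B_1&B_1&-\frac{i}{\lambda\sqrt{f_1}}H_{1y}\\ \frac{i}{\sqrt{f_1}}\overline{H_{1y}}&\frac{i}{\lambda\sqrt{f_1}}\overline{H_{1y}}&\frac12(B_1+\overline{B_1})\end{pmatrix},\quad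 \lambda=\lambda(0,y,k^\pm).$$ For $k\in\hat{\mathbb{C}}\setminus[0,1]$, $\Phi_0,\Phi_1$ are the unique solutions of $\Phi_0(x,k^\pm)=I+\int_0^x\mathsf{U}_0(x',k^\pm)\Phi_0(x',k^\pm)dx'$ and $\Phi_1(y,k^\pm)=I+\int_0^y\mathsf{V}_1(y',k^\pm)\Phi_1(y',k^\pm)dy'$. They extend to analytic functions $\Phi_0(x,P)$, $\Phi_1(y,P)$ of $P\in\mathcal{S}_{(x,y)}\setminus(\Sigma_0\cup\Sigma_1)$. **Riemann--Hilbert problem (RH).** For $(x,y)\in D$ let $\Gamma=\Gamma_0\cup\Gamma_1\subset\mathbb{C}$, where $\Gamma_0,\Gamma_1$ are disjoint clockwise oriented simple closed loops, $\Gamma_j$ encircling $F_{(x,y)}(\Sigma_j)$ at positive distance, neither encircling nor intersecting $0$, such that $\mathbb{C}\setminus\Gamma$ has components $\Omega_0\ni-1$ (inside $\Gamma_0$), $\Omega_1\ni1$ (inside $\Gamma_1$) and $\Omega_\infty\ni0$ (exterior). Let $v(x,y,z)=\Phi_0(x,F_{(x,y)}^{-1}(z))$ for $z\in\Gamma_0$ and $v(x,y,z)=\Phi_1(y,F_{(x,y)}^{-1}(z))$ for $z\in\Gamma_1$. (RH): find a $3\times3$-matrix-valued $m(x,y,\cdot)$ analytic on $\mathbb{C}\setminus\Gamma$, with continuous boundary values $m_+$ (from the left of $\Gamma$) and $m_-$ (from the right), such that $m_+=m_-v$ on $\Gamma$ and $m(x,y,z)=I+O(z^{-1})$ as $z\to\infty$.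 Solutions of (RH) are unique. *)

(* Defs.v *)
From Stdlib Require Import Reals.
From Coquelicot Require Import Coquelicot.
Open Scope C_scope.

(* Derivative of a complex-valued function of a real variable; junk value where
   the function is not differentiable. *)
Definition RCderive (u : R -> C) (x : R) : C :=
  (Derive (fun t => Re (u t)) x, Derive (fun t => Im (u t)) x).

Definition RCdiff (u : R -> C) (x : R) : Prop :=
  @ex_derive R_AbsRing C_R_NormedModule u x.

Definition pdx (u : R -> R -> C) (x y : R) : C := RCderive (fun t => u t y) x.
Definition pdy (u : R -> R -> C) (x y : R) : C := RCderive (fun t => u x t) y.
Definition pdxy (u : R -> R -> C) : R -> R -> C := pdy (pdx u).

Definition cont_on1 (I : R -> Prop) (u : R -> C) : Prop :=
  @continuous_on R_UniformSpace C_UniformSpace I u.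

Definition cont_on2 (W : R -> R -> Prop) (u : R -> R -> C) : Prop :=
  @continuous_on (prod_UniformSpace R_UniformSpace R_UniformSpace) C_UniformSpace
    (fun p => W (fst p) (snd p)) (fun p => u (fst p) (snd p)).

(* The classes C^n(I) and C^n(W), for I and W open. *)
Fixpoint Cn1 (n : nat) (I : R -> Prop) (u : R -> C) : Prop :=
  cont_on1 I u /\
  match n with
  | O => True
  | S k => (forall x, I x -> RCdiff u x) /\ Cn1 k I (RCderive u)
  end.

Fixpoint Cn2 (n : nat) (W : R -> R -> Prop) (u : R -> R -> C) : Prop :=
  cont_on2 W u /\
  match n with
  | O => True
  | S k =>
      (forall x y, W x y ->
         RCdiff (fun t => u t y) x /\ RCdiff (fun t => u x t) y) /\
      Cn2 k W (pdx u) /\ Cn2 k W (pdy u)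
  end.

Definition Ico (a : R) (x : R) : Prop := 0 <= x < a.
Definition Ioo (a : R) (x : R) : Prop := 0 < x < a.

Definition bdry_f (E H : R -> C) (x : R) : R := (Re (E x) - Cmod (H x) ^ 2)%R.

(* [x ^ alpha * u'] is only meaningful for [x > 0]; it has to extend
   continuously to [0]. *)
Definition weighted_ext1 (alpha : R) (u : R -> C) : Prop :=
  exists g : R -> C, cont_on1 (Ico 1) g /\
    forall x, Ioo 1 x -> g x = Rpower x alpha * RCderive u x.

Definition admissible_half (n : nat) (alpha : R) (E H : R -> C) : Prop :=
  cont_on1 (Ico 1) E /\ cont_on1 (Ico 1) H /\
  Cn1 n (Ioo 1) E /\ Cn1 n (Ioo 1) H /\
  weighted_ext1 alpha E /\ weighted_ext1 alpha H /\
  E 0%R = 1 /\ H 0%R = 0 /\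
  (forall x, Ico 1 x -> (0 < bdry_f E H x)%R).

Definition admissible_data (n : nat) (alpha : R) (E0 H0 E1 H1 : R -> C) : Prop :=
  admissible_half n alpha E0 H0 /\ admissible_half n alpha E1 H1.

(* [tri 1] is the domain D, [tri (1 - delta)] is D_delta. *)
Definition tri (a x y : R) : Prop := 0 <= x /\ 0 <= y /\ x + y < a.
Definition tri_int (a x y : R) : Prop := 0 < x /\ 0 < y /\ x + y < a.

Definition ernst_maxwell_at (E H : R -> R -> C) (x y : R) : Prop :=
  let f := RtoC (Re (E x y)) - H x y * Cconj (H x y) in
  let Ex := pdx E x y in let Ey := pdy E x y in
  let Hx := pdx H x y in let Hy := pdy H x y in
  f * (pdxy E x y - (Ex + Ey) / (2 * (1 - x - y)))
    = Ex * Ey - Cconj (H x y) * (Ex * Hy + Ey * Hx) /\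
  f * (pdxy H x y - (Hx + Hy) / (2 * (1 - x - y)))
    = / 2 * (Ex * Hy + Ey * Hx) - 2 * Cconj (H x y) * Hx * Hy.

Definition weighted_ext2 (a : R) (w : R -> R -> R) (u : R -> R -> C) : Prop :=
  exists g : R -> R -> C, cont_on2 (tri a) g /\
    forall x y, tri_int a x y -> g x y = w x y * u x y.

Definition Cn_solution (n : nat) (a : R) (E0 H0 E1 H1 : R -> C)
    (E H : R -> R -> C) : Prop :=
  cont_on2 (tri a) E /\ cont_on2 (tri a) H /\
  Cn2 n (tri_int a) E /\ Cn2 n (tri_int a) H /\
  (forall x y, tri_int a x y -> ernst_maxwell_at E H x y) /\
  (exists beta : R, 0 <= beta < 1 /\
     let wx := fun x _ : R => Rpower x beta in
     let wy := fun _ y : R => Rpower y beta in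
     let wxy := fun x y : R => (Rpower x beta * Rpower y beta)%R in
     weighted_ext2 a wx (pdx E) /\ weighted_ext2 a wx (pdx H) /\
     weighted_ext2 a wy (pdy E) /\ weighted_ext2 a wy (pdy H) /\
     weighted_ext2 a wxy (pdxy E) /\ weighted_ext2 a wxy (pdxy H)) /\
  (forall x, Ico a x -> E x 0%R = E0 x /\ H x 0%R = H0 x) /\
  (forall y, Ico a y -> E 0%R y = E1 y /\ H 0%R y = H1 y) /\
  (forall x y, tri a x y -> (0 < Re (E x y) - Cmod (H x y) ^ 2)%R).

Inductive Chat : Type := Fin (z : C) | Inf.

(* [P = (lambda, k)] satisfies [lambda^2 = (k - (1 - y)) / (k - x)]. *)
Definition on_surface (x y : R) (P : Chat * Chat) : Prop :=
  match P with
  | (Fin l, Fin k) => k <> x /\ l ^ 2 = (k - (1 - y)) / (k - x)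
  | (Fin l, Inf) => l ^ 2 = 1
  | (Inf, Fin k) => k = x
  | (Inf, Inf) => False
  end.

(* The biholomorphism z = (1 + lambda) / (1 - lambda) onto the sphere. *)
Definition Fmap (P : Chat * Chat) : Chat :=
  match fst P with
  | Fin l => if Ceq_dec l 1 then Inf else Fin ((1 + l) / (1 - l))
  | Inf => Fin (-1)
  end.

(* Principal square root: positive real part off the negative half-axis. *)
Definition Csqrt (z : C) : C :=
  (sqrt ((Cmod z + Re z) / 2),
   ((if Rlt_dec (Im z) 0 then -1 else 1) * sqrt ((Cmod z - Re z) / 2))%R).

(* The sheets are labelled by [true] for + and [false] for -; only used
   for [k] outside the cut [x, 1 - y]. *)
Definition lam (x y : R) (k : Chat) (s : bool) : C :=
  let r := match k with
           | Fin k => Csqrt ((k - (1 - y)) / (k - x))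
           | Inf => 1
           end in
  if s then r else - r.

Definition sheet_point (x y : R) (k : Chat) (s : bool) : Chat * Chat :=
  (Fin (lam x y k s), k).

Definition lies_over (a b : R) (P : Chat * Chat) : Prop :=
  exists t : R, a <= t <= b /\ snd P = Fin t.

Definition Sigma0 (x y : R) (P : Chat * Chat) : Prop :=
  on_surface x y P /\ lies_over 0 x P.
Definition Sigma1 (x y : R) (P : Chat * Chat) : Prop :=
  on_surface x y P /\ lies_over (1 - y) 1 P.

Definition mat3 : Type := @matrix C 3 3.
Definition I3 : mat3 := @Mone C_Ring 3.
Definition mul3 (M N : mat3) : mat3 := @Mmult C_Ring 3 3 3 M N.
Definition entry (M : mat3) (i j : nat) : C := coeff_mat (RtoC 0) M i j.

(* A_0 for the data (E_0, H_0), and B_1 for the data (E_1, H_1). *)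
Definition Acoef (E H : R -> C) (x : R) : C :=
  (RCderive E x - 2 * Cconj (H x) * RCderive H x) / (2 * bdry_f E H x).

(* H_{0x} / sqrt f_0 and H_{1y} / sqrt f_1. *)
Definition Hcoef (E H : R -> C) (x : R) : C :=
  RCderive H x / sqrt (bdry_f E H x).

(* U_0 is obtained with [l = lambda], V_1 with [l = 1 / lambda]. *)
Definition lax (E H : R -> C) (l : C) (x : R) : mat3 :=
  let A := Acoef E H x in
  let h := Hcoef E H x in
  [ [ Cconj A,      l * Cconj A,        Ci * h ],
    [ l * A,        A,                  - (Ci * l * h) ],
    [ Ci * Cconj h, Ci * l * Cconj h,   / 2 * (A + Cconj A) ] ].

Definition U0 (E0 H0 : R -> C) (k : Chat) (s : bool) (x : R) : mat3 :=
  lax E0 H0 (lam x 0 k s) x.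
Definition V1 (E1 H1 : R -> C) (k : Chat) (s : bool) (y : R) : mat3 :=
  lax E1 H1 (/ lam 0 y k s) y.

(* phi(x) = I + int_0^x W phi on [0, 1), the integral being improper at 0
   because of the weight x^alpha in the boundary data. *)
Definition volterra (W phi : R -> mat3) : Prop :=
  phi 0%R = I3 /\
  forall x, Ioo 1 x -> forall i j, (i < 3)%nat -> (j < 3)%nat ->
    @is_RInt_gen C_R_NormedModule
      (fun t => entry (mul3 (W t) (phi t)) i j) (at_right 0) (at_point x)
      (entry (phi x) i j - entry I3 i j).

Definition holo_at (f : C -> C) (z : C) : Prop :=
  @ex_derive C_AbsRing C_NormedModule f z.

Definition Chat_inv (z : Chat) : Chat :=
  match z with
  | Fin z => if Ceq_dec z 0 then Inf else Fin (/ z)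
  | Inf => Fin 0
  end.

(* Analyticity on an open subset [W] of the Riemann sphere; 1/w is the chart at
   infinity. *)
Definition sphere_analytic (W : Chat -> Prop) (Phi : Chat -> mat3) : Prop :=
  forall i j, (i < 3)%nat -> (j < 3)%nat ->
    (forall z, W (Fin z) -> holo_at (fun w => entry (Phi (Fin w)) i j) z) /\
    (W Inf -> holo_at (fun w => entry (Phi (Chat_inv (Fin w))) i j) 0).

Definition off_Sigma (x y : R) (z : Chat) : Prop :=
  forall P, Sigma0 x y P \/ Sigma1 x y P -> Fmap P <> z.

(* [k] lies outside the real segment [0, 1]. *)
Definition off_unit (k : Chat) : Prop :=
  forall t : R, 0 <= t <= 1 -> k <> Fin t.

(* [Phi z] is Phi_0(x, P) with z = F(P): the function on the surface is read in the
   global coordinate F.  It is given by the Volterra equation at the points k^+-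
   with k outside [0, 1], and by analytic continuation elsewhere off
   Sigma_0 and Sigma_1. *)
Definition is_Phi0 (E0 H0 : R -> C) (x y : R) (Phi : Chat -> mat3) : Prop :=
  sphere_analytic (off_Sigma x y) Phi /\
  forall k s, off_unit k ->
    exists phi, volterra (U0 E0 H0 k s) phi /\
      Phi (Fmap (sheet_point x y k s)) = phi x.

Definition is_Phi1 (E1 H1 : R -> C) (x y : R) (Phi : Chat -> mat3) : Prop :=
  sphere_analytic (off_Sigma x y) Phi /\
  forall k s, off_unit k ->
    exists phi, volterra (V1 E1 H1 k s) phi /\
      Phi (Fmap (sheet_point x y k s)) = phi y.

(* Piecewise C^1 regular simple closed curves parametrized by [0, 1]. *)
Definition simple_loop (g : R -> C) : Prop :=
  cont_on1 (fun t => 0 <= t <= 1) g /\ g 0%R = g 1%R /\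
  (forall s t, Ico 1 s -> Ico 1 t -> g s = g t -> s = t) /\
  exists (N : nat) (b : nat -> R),
    b O = 0%R /\ b N = 1%R /\
    forall i, (i < N)%nat -> b i < b (S i) /\
      exists d : R -> C,
        cont_on1 (fun t => b i <= t <= b (S i)) d /\
        (forall t, b i <= t <= b (S i) -> d t <> 0) /\
        (forall t, b i < t < b (S i) ->
           @is_derive R_AbsRing C_R_NormedModule g t (d t)).

Definition on_loop (g : R -> C) (z : C) : Prop :=
  exists t : R, 0 <= t <= 1 /\ g t = z.

(* The winding number of [g] about [w] is [N]; the finitely many corners of [g],
   where [RCderive] is junk, do not affect the integral. *)
Definition winding (g : R -> C) (w : C) (N : R) : Prop :=
  @is_RInt C_R_NormedModule (fun t => RCderive g t / (g t - w)) 0 1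
    (2 * PI * Ci * N).

(* Interior and exterior of a clockwise simple closed curve. *)
Definition inside (g : R -> C) (w : C) : Prop :=
  ~ on_loop g w /\ winding g w (-1).
Definition outside (g : R -> C) (w : C) : Prop :=
  ~ on_loop g w /\ winding g w 0.

Definition encircles_at_distance (g : R -> C) (S : Chat * Chat -> Prop) : Prop :=
  exists d : R, 0 < d /\
    forall P z, S P -> Fmap P = Fin z ->
      inside g z /\ forall w, on_loop g w -> d <= Cmod (w - z).

(* Each loop lies in the exterior of the other one, so the complement of their
   union has the three components [inside g0] (which contains -1 = F(x)),
   [inside g1] (which contains 1 = F(1 - y)) and [Omega_inf] (which contains 0). *)
Definition Omega_inf (g0 g1 : R -> C) (z : C) : Prop :=
  outside g0 z /\ outside g1 z.

Definition admissible_contour (x y : R) (g0 g1 : R -> C) : Prop :=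
  simple_loop g0 /\ simple_loop g1 /\
  (forall z, on_loop g1 z -> outside g0 z) /\
  (forall z, on_loop g0 z -> outside g1 z) /\
  encircles_at_distance g0 (Sigma0 x y) /\
  encircles_at_distance g1 (Sigma1 x y) /\
  Omega_inf g0 g1 0.

Definition boundary_value (W G : C -> Prop) (m b : C -> mat3) : Prop :=
  forall i j, (i < 3)%nat -> (j < 3)%nat ->
    @continuous_on C_UniformSpace C_UniformSpace G (fun z => entry (b z) i j) /\
    forall z, G z ->
      @filterlim C C (fun w => entry (m w) i j)
        (within W (@locally C_UniformSpace z))
        (@locally C_UniformSpace (entry (b z) i j)).

(* As the loops are clockwise, [Omega_inf] lies to the left of both. *)
Definition RH_solution (g0 g1 : R -> C) (Phi0 Phi1 : Chat -> mat3)
    (m : C -> mat3) : Prop :=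
  (forall z, ~ on_loop g0 z -> ~ on_loop g1 z ->
     forall i j, (i < 3)%nat -> (j < 3)%nat ->
       holo_at (fun w => entry (m w) i j) z) /\
  (exists mp mm : C -> mat3,
     boundary_value (Omega_inf g0 g1) (on_loop g0) m mp /\
     boundary_value (Omega_inf g0 g1) (on_loop g1) m mp /\
     boundary_value (inside g0) (on_loop g0) m mm /\
     boundary_value (inside g1) (on_loop g1) m mm /\
     (forall z, on_loop g0 z -> mp z = mul3 (mm z) (Phi0 (Fin z))) /\
     (forall z, on_loop g1 z -> mp z = mul3 (mm z) (Phi1 (Fin z)))) /\
  (exists M r : R, 0 < r /\ forall z, r < Cmod z ->
     forall i j, (i < 3)%nat -> (j < 3)%nat ->
       Cmod (entry (m z) i j - entry I3 i j) <= M / Cmod z).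

(* The extended eigenfunctions are unique off Sigma_0 and Sigma_1, so the
   quantifier over them only names the jump matrix. *)
Definition RH_solvable (E0 H0 E1 H1 : R -> C) (x y : R) : Prop :=
  exists g0 g1 : R -> C, admissible_contour x y g0 g1 /\
    forall Phi0 Phi1 : Chat -> mat3,
      is_Phi0 E0 H0 x y Phi0 -> is_Phi1 E1 H1 x y Phi1 ->
      exists m : C -> mat3, RH_solution g0 g1 Phi0 Phi1 m.

(* The L^1([0, a)) norm of [u] is less than [c].  The boundary data make [u]
   continuous on the open interval, with an integrable singularity at 0. *)
Definition L1_norm_lt (a c : R) (u : R -> C) : Prop :=
  exists N : R,
    @is_RInt_gen R_NormedModule (fun x => Cmod (u x)) (at_right 0) (at_left a) N
    /\ N < c.

(* Main.v *)
(** The system is the equation of a wave map from the triangle into the complex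
    hyperbolic plane, and such a map, with one time and one space dimension,
    always exists globally.  In the unitary frame
      A = (E_x - 2 conj(H) H_x) / (2f),  h = H_x / sqrt f   (f = Re E - |H|^2),
    and B, k likewise with y, the pairs p = (A, h), q = (B, k) satisfy the closed
    semilinear system
      p_y = Omega(q) p + (p + q) / (2 (1 - x - y)),
      q_x = Omega(p) q + (p + q) / (2 (1 - x - y)),
    where Omega is linear with skew-Hermitian values.  So Omega drops out of the
    equations for |p|^2 and |q|^2, which gives a Gronwall bound away from
    x + y = 1; with it Picard iteration for a truncated system produces (p, q) on
    the whole triangle.  Then f, H and E are recovered, in this order, by explicit
    integrals in y.  The substitution x = X^m, y = Y^m with m large makes the
    boundary data C^1 up to the corner.  Differentiability in x of p follows from
    that of the solution of a linear ODE in y with respect to its parameter x. *)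

Require Import Defs.
From Stdlib Require Import Reals Lra Lia ClassicalEpsilon.
From Coquelicot Require Import Coquelicot.
Open Scope R_scope.

(** * Joint continuity and integrals with variable bound *)

(** The system for (p, q) closes because the frame is invariant under a group acting simply
    transitively: the dilations E -> t^2 E, H -> t H and the translations H -> H + c, E -> E + 2
    conj(c) H + |c|^2 + i b. So f, H and E do not occur in it and can be recovered afterwards. The
    recovery integrates in y only; that the result also has the right x-derivatives is a closedness
    condition, and it holds because p_y - Omega(q) p = q_x - Omega(p) q, both sides being (p + q) /
    (2 (1 - x - y)). Truncating the quadratic term makes the system globally Lipschitz but threatens
    the skewness argument. The cut is therefore made in each component, and |p|^2 / 2 is replaced by
    a convex function whose gradient is the cut-off vector. The resulting bound does not depend on
    the cut-off level, which is then raised until the cut is inactive. Frame components have one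
    derivative fewer than E and H; the recovery restores it. *)

Notation cont2 := continuity_2d_pt.

(** Functions are extended to negative arguments by freezing them at 0. Continuity up to the axes
    then becomes ordinary two-sided continuity. *)
Definition pospart (x : R) : R := Rmax x 0.

Lemma pos_ge0 x : 0 <= pospart x.
Proof. apply Rmax_r. Qed.

Lemma pos_ge x : x <= pospart x.
Proof. apply Rmax_l. Qed.

Lemma pos_id x : 0 <= x -> pospart x = x.
Proof. apply Rmax_left. Qed.

Lemma pos_neg x : x <= 0 -> pospart x = 0.
Proof. apply Rmax_right. Qed.

Lemma pos_pos x : pospart (pospart x) = pospart x.
Proof. apply pos_id, pos_ge0. Qed.

Lemma pos_le x y : x <= y -> pospart x <= pospart y.
Proof. intros H; unfold pospart; apply Rle_max_compat_r; exact H. Qed.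

Lemma pos_lip x y : Rabs (pospart x - pospart y) <= Rabs (x - y).
Proof.
unfold pospart, Rmax; destruct (Rle_dec x 0), (Rle_dec y 0);
  unfold Rabs; repeat destruct Rcase_abs; lra.
Qed.

(** Precomposition with it extends a function continuous on an interval or a rectangle to a globally
    continuous and bounded one. *)
Definition clamp (a b x : R) : R := Rmax a (Rmin b x).

Lemma clamp_id a b x : a <= x <= b -> clamp a b x = x.
Proof. intros H; unfold clamp. rewrite Rmin_right, Rmax_right; lra. Qed.

Lemma clamp_in a b x : a <= b -> a <= clamp a b x <= b.
Proof.
intros H; unfold clamp, Rmax, Rmin.
repeat destruct Rle_dec; lra.
Qed.

Lemma clamp_lip a b x y : Rabs (clamp a b x - clamp a b y) <= Rabs (x - y).
Proof.
unfold clamp, Rmax, Rmin; repeat destruct Rle_dec;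
  unfold Rabs; repeat destruct Rcase_abs; lra.
Qed.

Lemma lip_continuous (f : R -> R) (K : R) :
  (forall x y, Rabs (f x - f y) <= K * Rabs (x - y)) ->
  forall x, continuous f x.
Proof.
intros Hf x. apply continuity_pt_filterlim. intros eps Heps.
assert (0 < Rabs K + 1) by (pose proof (Rabs_pos K); lra).
exists (eps / (Rabs K + 1)). split.
- apply Rdiv_lt_0_compat; lra.
- intros y [_ Hy]. simpl in *. unfold R_dist in *.
  apply Rle_lt_trans with (1 := Hf y x).
  apply Rle_lt_trans with ((Rabs K + 1) * Rabs (y - x)).
  + apply Rmult_le_compat_r. apply Rabs_pos. pose proof (Rle_abs K); lra.
  + apply Rmult_lt_reg_r with (/ (Rabs K + 1)).
    apply Rinv_0_lt_compat; lra.
    replace ((Rabs K + 1) * Rabs (y - x) * / (Rabs K + 1)) with (Rabs (y - x))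
      by (field; lra). exact Hy.
Qed.

Lemma continuous_pos x : continuous pospart x.
Proof. apply lip_continuous with 1. intros; rewrite Rmult_1_l; apply pos_lip. Qed.

Lemma continuous_clamp a b x : continuous (clamp a b) x.
Proof. apply lip_continuous with 1. intros; rewrite Rmult_1_l; apply clamp_lip. Qed.

Lemma cont2_comp (f u v : R -> R -> R) x y :
  cont2 f (u x y) (v x y) -> cont2 u x y -> cont2 v x y ->
  cont2 (fun x y => f (u x y) (v x y)) x y.
Proof.
intros Hf Hu Hv eps.
destruct (Hf eps) as [d Hd]. destruct (Hu d) as [d1 H1]. destruct (Hv d) as [d2 H2].
assert (Hm : 0 < Rmin d1 d2) by (apply Rmin_pos; apply cond_pos).
exists (mkposreal _ Hm). simpl. intros u' v' Hu' Hv'.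
apply Hd; [apply H1 | apply H2];
  (eapply Rlt_le_trans; [eassumption | first [apply Rmin_l | apply Rmin_r]]).
Qed.

Lemma cont2_swap (f : R -> R -> R) x y :
  cont2 f x y -> cont2 (fun u v => f v u) y x.
Proof.
intros H eps; destruct (H eps) as [d Hd]; exists d; intros; apply Hd; assumption.
Qed.

Lemma cont2_slice_y (f : R -> R -> R) x y : cont2 f x y -> continuous (f x) y.
Proof.
intros H. apply continuity_pt_filterlim. intros eps Heps.
destruct (H (mkposreal _ Heps)) as [d Hd]. exists d. split. apply cond_pos.
intros z [_ Hz]. apply Hd. rewrite Rminus_eq_0, Rabs_R0; apply cond_pos. exact Hz.
Qed.

Lemma cont2_slice_x (f : R -> R -> R) x y :
  cont2 f x y -> continuous (fun t => f t y) x.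
Proof. intros H. apply (cont2_slice_y (fun u v => f v u)). apply cont2_swap, H. Qed.

Lemma cont2_comp1 (f : R -> R) (u : R -> R -> R) x y :
  continuous f (u x y) -> cont2 u x y -> cont2 (fun x y => f (u x y)) x y.
Proof.
intros Hf Hu. apply continuity_1d_2d_pt_comp; auto.
apply continuity_pt_filterlim; exact Hf.
Qed.

Lemma cont2_fst (f : R -> R) x y : continuous f x -> cont2 (fun u _ => f u) x y.
Proof.
intros H; apply (cont2_comp1 f (fun u _ => u)); auto using continuity_2d_pt_id1.
Qed.

Lemma cont2_snd (f : R -> R) x y : continuous f y -> cont2 (fun _ v => f v) x y.
Proof.
intros H; apply (cont2_comp1 f (fun _ v => v)); auto using continuity_2d_pt_id2.
Qed.

(** Compactness yields, near each point, a gauge centre whose radius is at least a fixed e. A gauge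
    below 1 / (|f| + 1) turns this lower bound on the radius into an upper bound on |f|. *)
Lemma bounded_2d (f : R -> R -> R) a b c d :
  (forall x y, a <= x <= b -> c <= y <= d -> cont2 f x y) ->
  exists B, 0 <= B /\
    forall x y, a <= x <= b -> c <= y <= d -> Rabs (f x y) <= B.
Proof.
intros Hf.
assert (Hd : forall u v, exists dl : posreal,
  (a <= u <= b -> c <= v <= d ->
   forall x y, Rabs (x - u) < dl -> Rabs (y - v) < dl ->
     Rabs (f x y - f u v) < 1) /\ dl <= / (Rabs (f u v) + 1)).
{ intros u v.
  assert (Hp : 0 < / (Rabs (f u v) + 1)).
  { apply Rinv_0_lt_compat. pose proof (Rabs_pos (f u v)); lra. }
  destruct (classic (a <= u <= b /\ c <= v <= d)) as [[H1 H2]|H].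
  - destruct (Hf u v H1 H2 (mkposreal 1 Rlt_0_1)) as [e He].
    assert (Hm : 0 < Rmin e (/ (Rabs (f u v) + 1)))
      by (apply Rmin_pos; auto; apply cond_pos).
    exists (mkposreal _ Hm). split; simpl. 2: apply Rmin_r.
    intros _ _ x y Hx Hy. apply He;
    (eapply Rlt_le_trans; [eassumption | apply Rmin_l]).
  - exists (mkposreal _ Hp). split; simpl; [intros; tauto | lra]. }
pose (dl := fun u v => proj1_sig (constructive_indefinite_description _ (Hd u v))).
assert (Hdl : forall u v, (a <= u <= b -> c <= v <= d ->
   forall x y, Rabs (x - u) < dl u v -> Rabs (y - v) < dl u v ->
     Rabs (f x y - f u v) < 1) /\ dl u v <= / (Rabs (f u v) + 1)).
{ intros u v; unfold dl; destruct constructive_indefinite_description; assumption. }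
destruct (compactness_value_2d a b c d dl) as [e He].
exists (/ e + 1). split.
{ pose proof (Rinv_0_lt_compat e (cond_pos e)); lra. }
intros x y Hx Hy. apply NNPP; intros Hn. apply (He x y Hx Hy).
intros (u & v & Hu & Hv & H1 & H2 & H3). apply Hn.
destruct (Hdl u v) as [H4 H5].
specialize (H4 Hu Hv x y H1 H2).
assert (H6 : Rabs (f u v) + 1 <= / e).
{ rewrite <- (Rinv_inv (Rabs (f u v) + 1)). apply Rinv_le_contravar.
  apply cond_pos. lra. }
replace (f x y) with ((f x y - f u v) + f u v) by ring.
eapply Rle_trans. apply Rabs_triang. lra.
Qed.

Definition open2 (V : R -> R -> Prop) : Prop :=
  forall x y, V x y -> locally_2d V x y.

(** Closure downwards in the second variable, as integration in y from the axis requires. With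
    [pospart] a point of negative ordinate still brings its projection to the axis into V. *)
Definition low (V : R -> R -> Prop) : Prop :=
  forall x y t, V x y -> t <= pospart y -> V x t.

(** A neighbourhood of the top point (x, [pospart] y) suffices: [low] fills in everything below it,
    so no compactness of the segment is needed. *)
Lemma open_low_box V x y : open2 V -> low V -> V x y ->
  exists e, 0 < e /\ forall x' t, x - e <= x' <= x + e -> t <= pospart y + e -> V x' t.
Proof.
intros Ho Hl HV.
destruct (Ho x (pospart y)) as [e He]. apply (Hl x y); auto; lra.
exists (e / 2). pose proof (cond_pos e). split. lra.
intros x' t Hx Ht. apply (Hl x' (pospart y + e / 2)).
- apply He; rewrite Rabs_lt_between'; lra.
- rewrite pos_id. lra. pose proof (pos_ge0 y); lra.
Qed.

Lemma ex_RInt_cont (f : R -> R) a b :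
  a <= b -> (forall t, a <= t <= b -> continuous f t) -> ex_RInt f a b.
Proof.
intros Hab H. apply (ex_RInt_continuous (V:=R_CompleteNormedModule)). rewrite Rmin_left, Rmax_right by lra. exact H.
Qed.

Lemma abs_RInt_bound (f : R -> R) a b M :
  a <= b -> ex_RInt f a b -> (forall t, a <= t <= b -> Rabs (f t) <= M) ->
  Rabs (RInt f a b) <= M * (b - a).
Proof.
intros. rewrite Rmult_comm. apply abs_RInt_le_const; auto.
Qed.

Lemma abs_RInt_bound' (f : R -> R) a b M :
  ex_RInt f a b -> (forall t, Rmin a b <= t <= Rmax a b -> Rabs (f t) <= M) ->
  Rabs (RInt f a b) <= M * Rabs (b - a).
Proof.
intros Hi H. destruct (Rle_dec a b) as [Hab|Hab].
- rewrite (Rabs_pos_eq (b - a)) by lra. apply abs_RInt_bound; auto.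
  rewrite Rmin_left, Rmax_right in H; auto; lra.
- rewrite <- opp_RInt_swap by (apply ex_RInt_swap; exact Hi).
  change opp with Ropp. rewrite Rabs_Ropp, (Rabs_left (b - a)) by lra.
  replace (- (b - a)) with (a - b) by ring. apply abs_RInt_bound. lra.
  apply ex_RInt_swap; exact Hi. rewrite Rmin_right, Rmax_left in H; auto; lra.
Qed.

Lemma cont2_RInt (V : R -> R -> Prop) (g : R -> R -> R) :
  open2 V -> low V -> (forall x y, V x y -> cont2 g x y) ->
  forall x y, V x y -> cont2 (fun x y => RInt (g x) 0 (pospart y)) x y.
Proof.
intros Ho Hl Hg x y HV eps.
destruct (open_low_box V x y Ho Hl HV) as (e & He & Hbox).
set (b := pospart y) in *. assert (Hb : 0 <= b) by apply pos_ge0.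
assert (Hgc : forall x' t, x - e <= x' <= x + e -> 0 <= t <= b + e -> cont2 g x' t).
{ intros x' t Hx Ht. apply Hg, Hbox; lra. }
destruct (bounded_2d g _ _ _ _ Hgc) as (B & HB0 & HB).
assert (Heta : 0 < eps / 2 / (b + 1)).
{ pose proof (cond_pos eps). apply Rdiv_lt_0_compat; lra. }
destruct (uniform_continuity_2d g _ _ _ _ Hgc (mkposreal _ Heta)) as [d Hd].
simpl in Hd.
assert (HB1 : 0 < eps / 2 / (B + 1)).
{ pose proof (cond_pos eps). apply Rdiv_lt_0_compat; lra. }
assert (Hm : 0 < Rmin (Rmin e d) (eps / 2 / (B + 1))).
{ repeat apply Rmin_pos; auto. apply cond_pos. }
exists (mkposreal _ Hm). simpl. intros x' y' Hx' Hy'.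
assert (Hxe : Rabs (x' - x) < e).
{ eapply Rlt_le_trans. exact Hx'. eapply Rle_trans; apply Rmin_l. }
assert (Hxd : Rabs (x' - x) < d).
{ eapply Rlt_le_trans. exact Hx'. eapply Rle_trans. apply Rmin_l. apply Rmin_r. }
assert (Hye : Rabs (y' - y) < e).
{ eapply Rlt_le_trans. exact Hy'. eapply Rle_trans; apply Rmin_l. }
assert (Hyb : Rabs (y' - y) < eps / 2 / (B + 1)).
{ eapply Rlt_le_trans. exact Hy'. apply Rmin_r. }
assert (Hpy := pos_lip y' y). fold b in Hpy.
assert (Hx2 : x - e <= x' <= x + e) by (apply Rabs_lt_between' in Hxe; lra).
assert (Hpb : 0 <= pospart y' <= b + e).
{ split. apply pos_ge0.
  assert (Rabs (pospart y' - b) < e) by lra. apply Rabs_lt_between' in H; lra. }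
assert (Hi : forall u c c', x - e <= u <= x + e -> 0 <= c <= b + e -> 0 <= c' <= b + e ->
  ex_RInt (g u) c c').
{ intros u c c' Hu Hc Hc'. apply (ex_RInt_continuous (V:=R_CompleteNormedModule)). intros z Hz.
  apply cont2_slice_y, Hgc; auto.
  unfold Rmin, Rmax in Hz; destruct Rle_dec; lra. }
(* The increment splits into the change of the integrand, small by uniform continuity, and the
   change of the upper bound, small by boundedness. *)
replace (RInt (g x') 0 (pospart y') - RInt (g x) 0 b)
  with (RInt (fun t => g x' t - g x t) 0 b + RInt (g x') b (pospart y')).
2: { rewrite (RInt_minus (V:=R_CompleteNormedModule)) by (apply Hi; lra).
     rewrite <- (RInt_Chasles (g x') 0 b (pospart y')) by (apply Hi; lra).
     unfold minus, plus, opp; simpl. ring. }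
eapply Rle_lt_trans. apply Rabs_triang.
assert (H1 : Rabs (RInt (fun t => g x' t - g x t) 0 b) <= eps / 2 / (b + 1) * (b - 0)).
{ apply abs_RInt_bound; auto.
  - apply (ex_RInt_minus (V:=R_CompleteNormedModule)); apply Hi; lra.
  - intros t Ht. apply Rlt_le, Hd; try lra.
    rewrite Rminus_eq_0, Rabs_R0; apply cond_pos. }
assert (H2 : Rabs (RInt (g x') b (pospart y')) <= B * Rabs (pospart y' - b)).
{ apply abs_RInt_bound'.
  - apply Hi; lra.
  - intros t Ht. apply HB; auto. unfold Rmin, Rmax in Ht; destruct Rle_dec; lra. }
assert (H3 : eps / 2 / (b + 1) * (b - 0) <= eps / 2).
{ replace (eps / 2) with (eps / 2 / (b + 1) * (b + 1)) at 2 by (field; lra).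
  apply Rmult_le_compat_l; lra. }
assert (H4 : B * Rabs (pospart y' - b) < eps / 2).
{ apply Rle_lt_trans with ((B + 1) * Rabs (pospart y' - b)).
  - apply Rmult_le_compat_r. apply Rabs_pos. lra.
  - replace (eps / 2) with ((B + 1) * (eps / 2 / (B + 1))) by (field; lra).
    apply Rmult_lt_compat_l; lra. }
lra.
Qed.

Lemma is_derive_eq (f : R -> R) (x l l' : R) :
  is_derive f x l -> l = l' -> is_derive f x l'.
Proof. intros H <-; exact H. Qed.

Lemma is_derive_plus_R (f g : R -> R) x l m : is_derive f x l -> is_derive g x m ->
  is_derive (fun t => f t + g t) x (l + m).
Proof. intros; apply (is_derive_plus (V:=R_NormedModule)); assumption. Qed.

Lemma is_derive_const_R (c x : R) : is_derive (fun _ : R => c) x 0.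
Proof. apply @is_derive_const. Qed.

Lemma is_derive_mult_R (f g : R -> R) x l m : is_derive f x l -> is_derive g x m ->
  is_derive (fun t => f t * g t) x (l * g x + f x * m).
Proof. intros H1 H2. apply @is_derive_mult; auto. intros; apply Rmult_comm. Qed.

(* [g] is only required to be the derivative inside the interval. *)
Lemma ftc_open (f g : R -> R) b :
  0 <= b -> (forall t, 0 <= t <= b -> continuous f t) ->
  (forall t, 0 <= t <= b -> continuous g t) ->
  (forall t, 0 < t < b -> is_derive f t (g t)) ->
  f b = f 0 + RInt g 0 b.
Proof.
intros Hb Hf Hg Hd.
pose (g' := fun t => g (clamp 0 b t)).
assert (Hg' : forall t, continuous g' t).
{ intros t. apply (continuous_comp (clamp 0 b) g).
  apply continuous_clamp. apply Hg, clamp_in, Hb. }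
assert (HI : forall t, is_derive (RInt g' 0) t (g' t)).
{ intros t. apply (is_derive_RInt g' (RInt g' 0) 0 t).
  - exists (mkposreal 1 Rlt_0_1). intros z _.
    apply (RInt_correct (V:=R_CompleteNormedModule)), (ex_RInt_continuous (V:=R_CompleteNormedModule)). intros; apply Hg'.
  - apply Hg'. }
rewrite (RInt_ext g g').
2: { intros t Ht. rewrite Rmin_left, Rmax_right in Ht by lra.
     unfold g'. rewrite clamp_id; auto; lra. }
destruct (MVT_gen (fun t => f t - RInt g' 0 t) 0 b (fun _ => 0)) as (c & _ & Hc).
- intros t Ht. rewrite Rmin_left, Rmax_right in Ht by lra.
  apply (is_derive_eq _ _ (g t - g' t)). 2: unfold g'; rewrite clamp_id; lra.
  apply (is_derive_minus f (RInt g' 0)). apply Hd; lra. apply HI.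
- intros t Ht. rewrite Rmin_left, Rmax_right in Ht by lra.
  apply continuity_pt_filterlim. apply (continuous_minus f (RInt g' 0)). apply Hf; lra.
  apply (ex_derive_continuous (RInt g' 0)). eexists; apply HI.
- rewrite RInt_point in Hc. unfold zero in Hc; simpl in Hc. lra.
Qed.

(** * Goursat systems with Lipschitz nonlinearity *)

(** The flag merges the unknowns integrated in y and those integrated in x into one family, so that
    a single fixed-point argument covers both. *)
Definition intd (b : bool) (g : R -> R -> R) (x y : R) : R :=
  if b then RInt (fun t => g x t) 0 (pospart y) else RInt (fun t => g t y) 0 (pospart x).

Definition ex_intd (b : bool) (g : R -> R -> R) (x y : R) : Prop :=
  if b then ex_RInt (fun t => g x t) 0 (pospart y)
  else ex_RInt (fun t => g t y) 0 (pospart x).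

Definition seg (b : bool) (x y : R) (P : R -> R -> Prop) : Prop :=
  if b then forall t, 0 <= t <= pospart y -> P x t
  else forall t, 0 <= t <= pospart x -> P t y.

(** Bielecki's weight: integration in either direction gains a factor 1 / l, so Volterra operators
    contract for large l without smallness of the domain. *)
Definition wt (l x y : R) : R := exp (l * (pospart x + pospart y)).

Lemma wt_ge1 l x y : 0 <= l -> 1 <= wt l x y.
Proof.
intros Hl; unfold wt. rewrite <- exp_0.
assert (H : 0 <= l * (pospart x + pospart y)).
{ apply Rmult_le_pos; auto. pose proof (pos_ge0 x); pose proof (pos_ge0 y); lra. }
destruct H as [H|H]. left; apply exp_increasing; exact H. rewrite <- H; lra.
Qed.

Lemma wt_pos l x y : 0 < wt l x y.
Proof. apply exp_pos. Qed.

Lemma RInt_exp_bound (G : R -> R) l c b S :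
  0 < l -> 0 <= b -> 0 <= S -> ex_RInt G 0 b ->
  (forall t, 0 <= t <= b -> Rabs (G t) <= S * exp (l * (c + t))) ->
  Rabs (RInt G 0 b) <= S / l * exp (l * (c + b)).
Proof.
intros Hl Hb HS Hi HG.
assert (HI : is_RInt (fun t => S * exp (l * (c + t))) 0 b
  (S / l * exp (l * (c + b)) - S / l * exp (l * (c + 0)))).
{ apply (is_RInt_derive (fun t => S / l * exp (l * (c + t)))).
  - intros t _. auto_derive; auto. field; lra.
  - intros t _. apply (ex_derive_continuous (fun t => S * exp (l * (c + t)))).
    auto_derive; auto. }
assert (H := norm_RInt_le G (fun t => S * exp (l * (c + t))) 0 b _ _ Hb HG
  (RInt_correct _ _ _ Hi) HI).
change norm with Rabs in H.
eapply Rle_trans. exact H.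
assert (0 <= S / l * exp (l * (c + 0))).
{ apply Rmult_le_pos. apply Rdiv_le_0_compat; lra. left; apply exp_pos. }
lra.
Qed.

Lemma intd_bound b g x y l S : 0 < l -> 0 <= S -> ex_intd b g x y ->
  seg b x y (fun u v => Rabs (g u v) <= S * wt l u v) ->
  Rabs (intd b g x y) <= S / l * wt l x y.
Proof.
intros Hl HS Hex Hg. unfold intd, seg, ex_intd, wt in *. destruct b.
- apply (RInt_exp_bound (g x)); auto using pos_ge0.
  intros t Ht. replace (pospart x + t) with (pospart x + pospart t) by (rewrite (pos_id t); lra).
  apply Hg; lra.
- rewrite (Rplus_comm (pospart x)).
  apply (RInt_exp_bound (fun t => g t y)); auto using pos_ge0.
  intros t Ht. replace (pospart y + t) with (pospart t + pospart y) by (rewrite (pos_id t); lra).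
  apply Hg; lra.
Qed.

Lemma intd_minus b g h x y : ex_intd b g x y -> ex_intd b h x y ->
  ex_intd b (fun u v => g u v - h u v) x y /\
  intd b (fun u v => g u v - h u v) x y = intd b g x y - intd b h x y.
Proof.
unfold ex_intd, intd; destruct b; intros H1 H2; split.
1, 3: apply (ex_RInt_minus (V:=R_CompleteNormedModule)); assumption.
all: apply (RInt_minus (V:=R_CompleteNormedModule)); assumption.
Qed.

Lemma ex_intd_cont b g x y : seg b x y (fun u v => cont2 g u v) -> ex_intd b g x y.
Proof.
unfold seg, ex_intd; destruct b; intros H; apply ex_RInt_cont; try apply pos_ge0;
  intros t Ht.
- apply cont2_slice_y, H, Ht.
- apply (cont2_slice_x g), H, Ht.
Qed.

Lemma open2_True : open2 (fun _ _ => True).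
Proof. intros x y _. exists (mkposreal 1 Rlt_0_1); auto. Qed.

Lemma low_True : low (fun _ _ => True).
Proof. intros x y t _ _. exact I. Qed.

Lemma cont2_intd b g : (forall x y, cont2 g x y) ->
  forall x y, cont2 (intd b g) x y.
Proof.
intros Hg x y. unfold intd; destruct b.
- apply (cont2_RInt (fun _ _ => True) g); auto using open2_True, low_True.
- apply (cont2_swap (fun y x => RInt (fun t => g t y) 0 (pospart x))).
  apply (cont2_RInt (fun _ _ => True) (fun u v => g v u)); auto using open2_True, low_True.
  intros; apply cont2_swap, Hg.
Qed.

(* Bootstrap form of Gronwall's inequality: a bound that improves itself by a
   factor 1/2 holds with the additive constant alone. *)
Lemma halving (T : Type) (D : T -> Prop) (w phi : T -> R) (C B : R) :
  0 <= C -> 0 <= B -> (forall p, 0 <= phi p) -> (forall p, D p -> w p <= B * phi p) ->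
  (forall S, 0 <= S -> (forall p, D p -> w p <= S * phi p) ->
     forall p, D p -> w p <= (C + S / 2) * phi p) ->
  forall p, D p -> w p <= 2 * C * phi p.
Proof.
intros HC HB Hphi H0 Hstep.
(* The map S |-> C + S / 2 has the fixed point 2 C, and iteration shrinks the initial excess B by
   1/2 each time. *)
assert (Hn : forall n p, D p -> w p <= (2 * C + B * (/ 2) ^ n) * phi p).
{ induction n as [|n IH]; intros p Hp.
  - simpl. eapply Rle_trans. apply H0, Hp. apply Rmult_le_compat_r; auto. lra.
  - eapply Rle_trans. apply (Hstep (2 * C + B * (/ 2) ^ n)); auto.
    + assert (0 <= (/ 2) ^ n) by (apply pow_le; lra). nra.
    + apply Req_le. simpl. field. }
intros p Hp. destruct (Rle_dec (w p) (2 * C * phi p)) as [|Hc]; auto. exfalso.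
assert (Hd : 0 < w p - 2 * C * phi p) by lra.
assert (HBp : 0 <= B * phi p) by (apply Rmult_le_pos; auto).
destruct (pow_lt_1_zero (/ 2)) with (y := (w p - 2 * C * phi p) / (B * phi p + 1))
  as [n Hn'].
- rewrite Rabs_pos_eq; lra.
- apply Rdiv_lt_0_compat; lra.
- specialize (Hn' n (le_n n)). specialize (Hn n p Hp).
  assert (Hpn : 0 <= (/ 2) ^ n) by (apply pow_le; lra).
  rewrite Rabs_pos_eq in Hn' by exact Hpn.
  apply (Rmult_lt_compat_r (B * phi p + 1)) in Hn'; [|lra].
  replace ((w p - 2 * C * phi p) / (B * phi p + 1) * (B * phi p + 1))
    with (w p - 2 * C * phi p) in Hn' by (field; lra).
  nra.
Qed.

(** With the weight of exponent 2 L the difference of two solutions improves its own bound by 1/2,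
    so [halving] applies with additive constant 0. The Lipschitz bound is asked only along the two
    given solutions, which admits quadratic nonlinearities once both are bounded. *)
Lemma goursat_unique (I : Type) (dir : I -> bool) (D : R -> R -> Prop)
    (F U V GU GV : I -> R -> R -> R) (L B : R) :
  0 < L -> 0 <= B ->
  (forall i x y, D x y -> seg (dir i) x y D) ->
  (forall i x y, D x y -> U i x y = F i x y + intd (dir i) (GU i) x y) ->
  (forall i x y, D x y -> V i x y = F i x y + intd (dir i) (GV i) x y) ->
  (forall i x y, D x y -> ex_intd (dir i) (GU i) x y) ->
  (forall i x y, D x y -> ex_intd (dir i) (GV i) x y) ->
  (forall d x y, 0 <= d -> D x y -> (forall j, Rabs (U j x y - V j x y) <= d) ->
     forall i, Rabs (GU i x y - GV i x y) <= L * d) ->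
  (forall i x y, D x y -> Rabs (U i x y - V i x y) <= B) ->
  forall i x y, D x y -> U i x y = V i x y.
Proof.
intros HL HB HD HU HV HeU HeV HLip Hb.
assert (H : forall p : I * (R * R), D (fst (snd p)) (snd (snd p)) ->
  Rabs (U (fst p) (fst (snd p)) (snd (snd p)) - V (fst p) (fst (snd p)) (snd (snd p)))
   <= 2 * 0 * wt (2 * L) (fst (snd p)) (snd (snd p))).
{ apply (halving _ (fun p => D (fst (snd p)) (snd (snd p)))
    (fun p => Rabs (U (fst p) (fst (snd p)) (snd (snd p)) -
                    V (fst p) (fst (snd p)) (snd (snd p))))
    (fun p => wt (2 * L) (fst (snd p)) (snd (snd p))) 0 B); try lra.
  - intros; left; apply wt_pos.
  - intros [i [x y]] Hp; simpl in *.
    eapply Rle_trans. apply Hb, Hp.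
    assert (H := wt_ge1 (2 * L) x y). nra.
  - intros S HS HwS [i [x y]] Hp; simpl in *.
    rewrite HU, HV by exact Hp.
    destruct (intd_minus (dir i) (GU i) (GV i) x y) as [He Hm]; auto.
    replace (F i x y + intd (dir i) (GU i) x y - (F i x y + intd (dir i) (GV i) x y))
      with (intd (dir i) (fun u v => GU i u v - GV i u v) x y) by (rewrite Hm; ring).
    replace (0 + S / 2) with (L * S / (2 * L)) by (field; lra).
    apply intd_bound; auto. lra. nra.
    assert (Hs := HD i x y Hp).
    assert (Hall : forall u v, D u v ->
      Rabs (GU i u v - GV i u v) <= L * S * wt (2 * L) u v).
    { intros u v Huv. rewrite Rmult_assoc. apply HLip; auto.
      - apply Rmult_le_pos; auto; left; apply wt_pos.
      - intros j. exact (HwS (j, (u, v)) Huv). }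
    unfold seg in *; destruct (dir i); intros t Ht; apply Hall, Hs, Ht. }
intros i x y Hp. specialize (H (i, (x, y)) Hp). simpl in H.
rewrite Rmult_0_r, Rmult_0_l in H.
assert (H' := Rabs_pos (U i x y - V i x y)).
destruct (Req_dec (U i x y - V i x y) 0) as [|Hn]. lra.
apply Rabs_no_R0 in Hn; lra.
Qed.

(** * Picard iteration in the weighted supremum norm *)

Section Picard.

Variables (I : Type) (dir : I -> bool) (F0 : I -> R -> R -> R)
  (N : I -> R -> R -> (I -> R) -> R) (L B : R).
Hypothesis HL : 0 < L.
Hypothesis HB : 0 <= B.
Hypothesis HF0 : forall i x y, cont2 (F0 i) x y.
(** The index type carries no topology and need not be finite, so continuity of N is expressed
    through its effect on families of continuous functions. *)
Hypothesis HNc : forall U : I -> R -> R -> R, (forall j x y, cont2 (U j) x y) ->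
  forall i x y, cont2 (fun x y => N i x y (fun j => U j x y)) x y.
Hypothesis HNL : forall d x y (u v : I -> R), 0 <= d ->
  (forall j, Rabs (u j - v j) <= d) ->
  forall i, Rabs (N i x y u - N i x y v) <= L * d.
Hypothesis HNB : forall i x y, Rabs (N i x y (fun j => F0 j x y)) <= B.

Definition pic_step (U : I -> R -> R -> R) (i : I) (x y : R) : R :=
  F0 i x y + intd (dir i) (fun x y => N i x y (fun j => U j x y)) x y.

Fixpoint pic (n : nat) : I -> R -> R -> R :=
  match n with O => F0 | S n => pic_step (pic n) end.

Lemma pic_cont n i x y : cont2 (pic n i) x y.
Proof.
revert i x y; induction n as [|n IH]; intros i x y; simpl; auto.
unfold pic_step. apply continuity_2d_pt_plus. apply HF0.
apply cont2_intd. intros; apply HNc; auto.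
Qed.

(** Contraction by 1/2: the Lipschitz constant L is divided by the exponent 2 L of the weight. *)
Lemma pic_step_diff U V S :
  (forall j x y, cont2 (U j) x y) -> (forall j x y, cont2 (V j) x y) -> 0 <= S ->
  (forall j x y, Rabs (U j x y - V j x y) <= S * wt (2 * L) x y) ->
  forall i x y, Rabs (pic_step U i x y - pic_step V i x y) <= S / 2 * wt (2 * L) x y.
Proof.
intros HU HV HS H i x y. unfold pic_step.
destruct (intd_minus (dir i) (fun x y => N i x y (fun j => U j x y))
   (fun x y => N i x y (fun j => V j x y)) x y) as [He Hm].
1, 2: apply ex_intd_cont; unfold seg; destruct (dir i); intros; apply HNc; auto.
replace (F0 i x y + intd (dir i) (fun x y => N i x y (fun j => U j x y)) x y -
  (F0 i x y + intd (dir i) (fun x y => N i x y (fun j => V j x y)) x y))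
  with (intd (dir i) (fun u v => N i u v (fun j => U j u v) - N i u v (fun j => V j u v)) x y)
  by (rewrite Hm; ring).
replace (S / 2) with (L * S / (2 * L)) by (field; lra).
apply intd_bound; auto. lra. nra.
assert (Hall : forall u v, Rabs (N i u v (fun j => U j u v) - N i u v (fun j => V j u v))
  <= L * S * wt (2 * L) u v).
{ intros u v. rewrite Rmult_assoc. apply HNL; auto.
  apply Rmult_le_pos; auto; left; apply wt_pos. }
unfold seg; destruct (dir i); auto.
Qed.

(** Weighted size of the first increment: N is at most B along F0, and integration gains 1 / (2
    L). *)
Let B' := B / (2 * L).

Lemma B'_ge0 : 0 <= B'.
Proof. apply Rdiv_le_0_compat; lra. Qed.

Lemma pic_succ n i x y :
  Rabs (pic (S n) i x y - pic n i x y) <= B' * (/ 2) ^ n * wt (2 * L) x y.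
Proof.
assert (HB' := B'_ge0).
revert i x y; induction n as [|n IH]; intros i x y.
- simpl. unfold pic_step.
  match goal with |- Rabs ?e <= _ => replace e with
   (intd (dir i) (fun x y => N i x y (fun j => F0 j x y)) x y) by ring end.
  rewrite Rmult_1_r.
  apply intd_bound; auto. lra.
  + apply ex_intd_cont; unfold seg; destruct (dir i); intros; apply HNc; auto.
  + assert (Hall : forall u v, Rabs (N i u v (fun j => F0 j u v)) <= B * wt (2 * L) u v).
    { intros u v. eapply Rle_trans. apply HNB. assert (H := wt_ge1 (2 * L) u v). nra. }
    unfold seg; destruct (dir i); auto.
- replace (B' * (/ 2) ^ S n) with (B' * (/ 2) ^ n / 2) by (simpl; field).
  apply (pic_step_diff (pic (S n)) (pic n)); auto using pic_cont.
  apply Rmult_le_pos; auto. apply pow_le; lra.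
Qed.

(** Keeping the exact partial sum of the geometric series, rather than a bound for its tail, makes
    the induction on k close. *)
Lemma pic_add n k i x y :
  Rabs (pic (k + n) i x y - pic n i x y)
    <= B' * (2 * (/ 2) ^ n - 2 * (/ 2) ^ (k + n)) * wt (2 * L) x y.
Proof.
induction k as [|k IH].
- simpl. rewrite Rminus_eq_0, Rabs_R0.
  replace (2 * (/ 2) ^ n - 2 * (/ 2) ^ n) with 0 by ring. lra.
- replace (pic (S k + n) i x y - pic n i x y) with
   ((pic (S (k + n)) i x y - pic (k + n) i x y) + (pic (k + n) i x y - pic n i x y))
   by (simpl; ring).
  eapply Rle_trans. apply Rabs_triang.
  eapply Rle_trans. apply Rplus_le_compat. apply pic_succ. apply IH.
  apply Req_le. simpl. field.
Qed.

Lemma pic_dist n m i x y : (n <= m)%nat ->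
  Rabs (pic m i x y - pic n i x y) <= 2 * B' * (/ 2) ^ n * wt (2 * L) x y.
Proof.
intros Hnm. replace m with ((m - n) + n)%nat by lia.
eapply Rle_trans. apply pic_add.
apply Rmult_le_compat_r. left; apply wt_pos.
assert (H := B'_ge0). assert (0 <= (/ 2) ^ (m - n + n)) by (apply pow_le; lra). nra.
Qed.

Lemma half_pow_small c e : 0 <= c -> 0 < e -> exists n, c * (/ 2) ^ n < e.
Proof.
intros Hc He.
destruct (pow_lt_1_zero (/ 2)) with (y := e / (c + 1)) as [n Hn].
- rewrite Rabs_pos_eq; lra.
- apply Rdiv_lt_0_compat; lra.
- exists n. specialize (Hn n (le_n n)).
  assert (Hp : 0 <= (/ 2) ^ n) by (apply pow_le; lra).
  rewrite Rabs_pos_eq in Hn by exact Hp.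
  apply (Rmult_lt_compat_r (c + 1)) in Hn; [|lra].
  replace (e / (c + 1) * (c + 1)) with e in Hn by (field; lra). nra.
Qed.

Definition pic_lim (i : I) (x y : R) : R := real (Lim_seq (fun n => pic n i x y)).

Lemma pic_lim_correct i x y :
  is_lim_seq (fun n => pic n i x y) (pic_lim i x y).
Proof.
apply Lim_seq_correct'. apply ex_lim_seq_cauchy_corr. intros e.
assert (Hc : 0 <= 4 * B' * wt (2 * L) x y).
{ assert (H := B'_ge0). assert (H' := wt_pos (2 * L) x y). nra. }
destruct (half_pow_small _ e Hc (cond_pos e)) as [n0 Hn0].
exists n0. intros n m Hn Hm.
replace (pic n i x y - pic m i x y)
  with ((pic n i x y - pic n0 i x y) - (pic m i x y - pic n0 i x y)) by ring.
eapply Rle_lt_trans. apply Rabs_triang. rewrite Rabs_Ropp.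
assert (H1 := pic_dist n0 n i x y Hn). assert (H2 := pic_dist n0 m i x y Hm). lra.
Qed.

Lemma pic_lim_dist n i x y :
  Rabs (pic_lim i x y - pic n i x y) <= 2 * B' * (/ 2) ^ n * wt (2 * L) x y.
Proof.
apply (is_lim_seq_le_loc (fun m => Rabs (pic m i x y - pic n i x y))
  (fun _ => 2 * B' * (/ 2) ^ n * wt (2 * L) x y)
  (Finite (Rabs (pic_lim i x y - pic n i x y)))
  (Finite (2 * B' * (/ 2) ^ n * wt (2 * L) x y))).
- exists n. intros m Hm. apply pic_dist, Hm.
- apply (is_lim_seq_abs _ (Finite (pic_lim i x y - pic n i x y))).
  apply is_lim_seq_minus'. apply pic_lim_correct. apply is_lim_seq_const.
- apply is_lim_seq_const.
Qed.

(** The weight is bounded by W for u <= x + 1, v <= y + 1, so convergence is uniform there and three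
    errors of e / 3 suffice. *)
Lemma pic_lim_cont i x y : cont2 (pic_lim i) x y.
Proof.
intros e.
pose (W := wt (2 * L) (x + 1) (y + 1)).
assert (HW : forall u v, u <= x + 1 -> v <= y + 1 -> wt (2 * L) u v <= W).
{ intros u v Hu Hv. unfold W, wt.
  apply pos_le in Hu; apply pos_le in Hv.
  assert (H : 2 * L * (pospart u + pospart v) <= 2 * L * (pospart (x + 1) + pospart (y + 1))) by nra.
  destruct H as [H|H]. left; apply exp_increasing, H. rewrite H; lra. }
assert (HW0 : 0 < W) by apply wt_pos.
assert (HB' := B'_ge0).
assert (Hc : 0 <= 2 * B' * W) by nra.
assert (He3 : 0 < e / 3) by (pose proof (cond_pos e); lra).
destruct (half_pow_small _ _ Hc He3) as [n Hn].
destruct (pic_cont n i x y (mkposreal _ He3)) as [d Hd]. simpl in Hd.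
assert (Hm : 0 < Rmin d 1) by (apply Rmin_pos; [apply cond_pos | lra]).
exists (mkposreal _ Hm). simpl. intros u v Hu Hv.
assert (H1 : Rabs (pic n i u v - pic n i x y) < e / 3).
{ apply Hd; (eapply Rlt_le_trans; [eassumption | apply Rmin_l]). }
assert (Hb : forall u v, u <= x + 1 -> v <= y + 1 ->
  Rabs (pic_lim i u v - pic n i u v) < e / 3).
{ intros u' v' Hu' Hv'. eapply Rle_lt_trans. apply pic_lim_dist.
  eapply Rle_lt_trans. 2: exact Hn.
  replace (2 * B' * W * (/ 2) ^ n) with (2 * B' * (/ 2) ^ n * W) by ring.
  apply Rmult_le_compat_l; auto.
  apply Rmult_le_pos. lra. apply pow_le; lra. }
assert (Hu1 : u <= x + 1).
{ assert (Rabs (u - x) < 1) by (eapply Rlt_le_trans; [exact Hu | apply Rmin_r]).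
  apply Rabs_lt_between' in H; lra. }
assert (Hv1 : v <= y + 1).
{ assert (Rabs (v - y) < 1) by (eapply Rlt_le_trans; [exact Hv | apply Rmin_r]).
  apply Rabs_lt_between' in H; lra. }
replace (pic_lim i u v - pic_lim i x y) with
  ((pic_lim i u v - pic n i u v) + (pic n i u v - pic n i x y)
   - (pic_lim i x y - pic n i x y)) by ring.
eapply Rle_lt_trans. apply Rabs_triang. rewrite Rabs_Ropp.
assert (H2 := Rabs_triang (pic_lim i u v - pic n i u v) (pic n i u v - pic n i x y)).
assert (H3 := Hb u v Hu1 Hv1). assert (H4 := Hb x y ltac:(lra) ltac:(lra)). lra.
Qed.

Lemma picard : exists U : I -> R -> R -> R,
  (forall i x y, cont2 (U i) x y) /\
  forall i x y, U i x y =
    F0 i x y + intd (dir i) (fun x y => N i x y (fun j => U j x y)) x y.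
Proof.
exists pic_lim. split. exact pic_lim_cont.
intros i x y. fold (pic_step pic_lim i x y).
assert (HB' := B'_ge0).
(* The shifted sequence tends to [pic_lim], and by contraction also to its image under [pic_step];
   the two limits coincide. *)
assert (H : is_lim_seq (fun n => pic (S n) i x y) (pic_step pic_lim i x y)).
{ apply is_lim_seq_spec. intros e.
  assert (Hc : 0 <= 2 * B' * wt (2 * L) x y).
  { assert (H' := wt_pos (2 * L) x y). nra. }
  destruct (half_pow_small _ e Hc (cond_pos e)) as [n0 Hn0].
  exists n0. intros n Hn. simpl pic.
  eapply Rle_lt_trans.
  apply (pic_step_diff (pic n) pic_lim (2 * B' * (/ 2) ^ n)); auto using pic_cont, pic_lim_cont.
  - apply Rmult_le_pos. lra. apply pow_le; lra.
  - intros. rewrite Rabs_minus_sym. apply pic_lim_dist.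
  - eapply Rle_lt_trans. 2: exact Hn0.
    replace (2 * B' * wt (2 * L) x y * (/ 2) ^ n0)
      with (2 * B' * (/ 2) ^ n0 * wt (2 * L) x y) by ring.
    apply Rmult_le_compat_r. left; apply wt_pos.
    assert (H0 : 0 <= 2 * B' * (/ 2) ^ n).
    { apply Rmult_le_pos. lra. apply pow_le; lra. }
    assert ((/ 2) ^ n <= (/ 2) ^ n0).
    { rewrite !pow_inv. apply Rinv_le_contravar. apply pow_lt; lra.
      apply Rle_pow; lra || lia. }
    nra. }
assert (H1 := proj1 (is_lim_seq_incr_1 _ _) (pic_lim_correct i x y)).
apply is_lim_seq_unique in H. apply is_lim_seq_unique in H1.
unfold pic_lim at 1. assert (Hr := eq_trans (eq_sym H1) H).
injection Hr as Hr. exact Hr.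
Qed.

End Picard.

(** * The frame system *)

(** The same labels index the frame components (Re A, Im A, Re h, Im h) and the unknowns (Re E, Im
    E, Re H, Im H). From here on [I3] no longer denotes the identity matrix. *)
Inductive idx : Type := I0 | I1 | I2 | I3.

Definition sum4 (f : idx -> R) : R := f I0 + f I1 + f I2 + f I3.

(* The isotropy action of u(2) in the real coordinates
   (Re A, Im A, Re h, Im h) of a tangent vector of the complex hyperbolic plane:
   A |-> 2i Im(B) A - conj(k) h,  h |-> k A + i Im(B) h. *)
Definition Om (q p : idx -> R) (i : idx) : R :=
  match i with
  | I0 => - 2 * (q I1 * p I1) - q I2 * p I2 - q I3 * p I3
  | I1 => 2 * (q I1 * p I0) + q I3 * p I2 - q I2 * p I3
  | I2 => q I2 * p I0 - q I3 * p I1 - q I1 * p I3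
  | I3 => q I3 * p I0 + q I2 * p I1 + q I1 * p I2
  end.

Lemma Om_skew q p : sum4 (fun i => p i * Om q p i) = 0.
Proof. unfold sum4, Om; ring. Qed.

Ltac cont2_auto :=
  repeat match goal with
    | |- continuity_2d_pt (fun x y => @?f x y + @?g x y) _ _ =>
        apply (continuity_2d_pt_plus f g)
    | |- continuity_2d_pt (fun x y => @?f x y - @?g x y) _ _ =>
        apply (continuity_2d_pt_minus f g)
    | |- continuity_2d_pt (fun x y => @?f x y * @?g x y) _ _ =>
        apply (continuity_2d_pt_mult f g)
    | |- continuity_2d_pt (fun x y => - @?f x y) _ _ =>
        apply (continuity_2d_pt_opp f)
    | |- continuity_2d_pt (fun _ _ => ?c) _ _ => apply continuity_2d_pt_const
    end.

Lemma cont2_sum4 (f : idx -> R -> R -> R) x y :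
  (forall j, cont2 (f j) x y) -> cont2 (fun x y => sum4 (fun j => f j x y)) x y.
Proof. intros H; unfold sum4; cont2_auto; apply H. Qed.

Lemma cont2_Om (Q P : idx -> R -> R -> R) i x y :
  (forall j, cont2 (Q j) x y) -> (forall j, cont2 (P j) x y) ->
  cont2 (fun x y => Om (fun j => Q j x y) (fun j => P j x y) i) x y.
Proof.
intros HQ HP; destruct i; unfold Om; cont2_auto; first [apply HQ | apply HP].
Qed.

Lemma is_derive_intd_y (g : R -> R) t e :
  0 < t -> 0 < e -> (forall u, 0 <= u <= t + e -> continuous g u) ->
  is_derive (fun t => RInt g 0 (pospart t)) t (g t).
Proof.
intros Ht He Hg.
apply (is_derive_ext_loc (RInt g 0)).
- exists (mkposreal _ Ht). intros u Hu. apply Rabs_lt_between' in Hu.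
  simpl in Hu. rewrite pos_id; auto; lra.
- assert (Hm : 0 < Rmin t e) by (apply Rmin_pos; auto).
  apply (is_derive_RInt g (RInt g 0) 0 t).
  + exists (mkposreal _ Hm). intros z Hz. apply Rabs_lt_between' in Hz; simpl in Hz.
    assert (H1 := Rmin_l t e). assert (H2 := Rmin_r t e).
    apply (RInt_correct (V:=R_CompleteNormedModule)), ex_RInt_cont. lra.
    intros; apply Hg; lra.
  + apply Hg; lra.
Qed.

(** * Truncation and the energy bound *)

Definition chi (M s : R) : R := clamp (- M) M s.

Lemma chi_cases M s : 0 < M ->
  (s <= - M /\ chi M s = - M) \/ (- M <= s <= M /\ chi M s = s) \/
  (M <= s /\ chi M s = M).
Proof.
intros HM; unfold chi, clamp, Rmax, Rmin; repeat destruct Rle_dec; lra.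
Qed.

Lemma chi_bound M s : 0 < M -> Rabs (chi M s) <= M.
Proof. intros HM. apply Rabs_le, clamp_in; lra. Qed.

Lemma chi_mult_lip M a b a' b' d : 0 < M -> Rabs (a - a') <= d -> Rabs (b - b') <= d ->
  Rabs (chi M a * chi M b - chi M a' * chi M b') <= 2 * M * d.
Proof.
intros HM Ha Hb.
replace (chi M a * chi M b - chi M a' * chi M b') with
 (chi M a * (chi M b - chi M b') + (chi M a - chi M a') * chi M b') by ring.
eapply Rle_trans. apply Rabs_triang. rewrite !Rabs_mult.
assert (H1 := chi_bound M a HM). assert (H2 := chi_bound M b' HM).
assert (H3 := Rle_trans _ _ _ (clamp_lip (- M) M a a') Ha).
assert (H4 := Rle_trans _ _ _ (clamp_lip (- M) M b b') Hb).
fold (chi M a) (chi M a') in H3. fold (chi M b) (chi M b') in H4.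
assert (H5 := Rmult_le_compat _ _ _ _ (Rabs_pos _) (Rabs_pos _) H1 H4).
assert (H6 := Rmult_le_compat _ _ _ _ (Rabs_pos _) (Rabs_pos _) H3 H2). lra.
Qed.

(* The primitive of [chi M]: with the nonlinearity cut off by [chi M] in every
   component, the sum of these Huber functions plays the role of |p|^2 / 2. *)
Definition hub (M s : R) : R := s * chi M s - chi M s ^ 2 / 2.

Lemma hub_ge0 M s : 0 < M -> 0 <= hub M s.
Proof.
intros HM; unfold hub; destruct (chi_cases M s HM) as [[H ->]|[[H ->]|[H ->]]]; nra.
Qed.

Lemma hub_le M s : 0 < M -> hub M s <= s ^ 2 / 2.
Proof. intros _; unfold hub. pose proof (pow2_ge_0 (s - chi M s)); nra. Qed.

Lemma hub_chi M s : 0 < M -> Rabs (chi M s * s) <= 2 * hub M s.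
Proof.
intros HM; unfold hub; destruct (chi_cases M s HM) as [[H ->]|[[H ->]|[H ->]]];
  apply Rabs_le; split; nra.
Qed.

(** A Young inequality adapted to the truncation: it bounds the coupling terms between P and Q
    linearly in the energies, which keeps the Gronwall argument linear. *)
Lemma hub_chi2 M s t : 0 < M -> Rabs (chi M s * t) <= 2 * hub M s + 2 * hub M t.
Proof.
intros HM; unfold hub; destruct (chi_cases M s HM) as [[H ->]|[[H ->]|[H ->]]];
destruct (chi_cases M t HM) as [[H' ->]|[[H' ->]|[H' ->]]];
 apply Rabs_le; split; nra.
Qed.

(** [hub] takes the value M^2 / 2 exactly at the cut-off points and is larger beyond them. This is
    how an energy bound switches the truncation off. *)
Lemma hub_small M s : 0 < M -> hub M s <= M ^ 2 / 2 -> chi M s = s.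
Proof.
intros HM; unfold hub; destruct (chi_cases M s HM) as [[H ->]|[[H ->]|[H ->]]]; nra.
Qed.

Lemma hub_derive M s : 0 < M -> is_derive (hub M) s (chi M s).
Proof.
intros HM. apply is_derive_Reals. intros e He. exists (mkposreal _ He).
intros h Hh Hhe. simpl in Hhe.
(* Convexity gives the lower bound and the 1-Lipschitz slope [chi] the upper one; with a quadratic
   remainder, delta = e works. *)
assert (H : 0 <= hub M (s + h) - hub M s - chi M s * h <= h ^ 2).
{ unfold hub; destruct (chi_cases M s HM) as [[H ->]|[[H ->]|[H ->]]];
  destruct (chi_cases M (s + h) HM) as [[H' ->]|[[H' ->]|[H' ->]]]; split; nra. }
replace ((hub M (s + h) - hub M s) / h - chi M s) with
  ((hub M (s + h) - hub M s - chi M s * h) / h) by (field; exact Hh).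
rewrite Rabs_div by exact Hh. rewrite Rabs_pos_eq by lra.
apply Rle_lt_trans with (2 := Hhe).
apply Rmult_le_reg_r with (Rabs h). apply Rabs_pos_lt, Hh.
unfold Rdiv. rewrite Rmult_assoc, Rinv_l by (apply Rabs_no_R0, Hh).
rewrite Rmult_1_r. replace (Rabs h * Rabs h) with (h ^ 2). lra.
rewrite <- Rabs_mult, Rabs_pos_eq; nra.
Qed.

(** [gP] and [gQ] share their linear part and differ only by the exchange of the arguments of [Om].
    This is the closedness condition behind the recovery of E and H. *)
Definition gP (c1 c2 : R -> R -> R) (P Q : idx -> R -> R -> R) i x y : R :=
  Om (fun j => Q j x y) (fun j => P j x y) i + c1 x y * P i x y + c2 x y * Q i x y.
Definition gQ (c1 c2 : R -> R -> R) (P Q : idx -> R -> R -> R) i x y : R :=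
  Om (fun j => P j x y) (fun j => Q j x y) i + c1 x y * P i x y + c2 x y * Q i x y.

Definition gsol (D : R -> R -> Prop) c1 c2 (p0 q0 : idx -> R -> R) P Q : Prop :=
  forall i x y, D x y ->
    P i x y = p0 i x + RInt (fun t => gP c1 c2 P Q i x t) 0 (pospart y) /\
    Q i x y = q0 i y + RInt (fun t => gQ c1 c2 P Q i t y) 0 (pospart x).

(* The system with truncated nonlinearity; [true] labels P and [false] labels Q. *)
Definition cutN (M : R) (c1 c2 : R -> R -> R) (k : bool * idx) (x y : R)
    (u : bool * idx -> R) : R :=
  Om (fun j => chi M (u (negb (fst k), j))) (fun j => chi M (u (fst k, j))) (snd k)
  + c1 x y * u (true, snd k) + c2 x y * u (false, snd k).

(** Each row of [Om] has coefficients of total size at most 4, and each product of two truncated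
    factors varies by at most 2 M d. *)
Lemma Om_chi_lip M d (q p q' p' : idx -> R) i : 0 < M ->
  (forall j, Rabs (q j - q' j) <= d) -> (forall j, Rabs (p j - p' j) <= d) ->
  Rabs (Om (fun j => chi M (q j)) (fun j => chi M (p j)) i -
        Om (fun j => chi M (q' j)) (fun j => chi M (p' j)) i) <= 8 * M * d.
Proof.
intros HM Hq Hp.
assert (H : forall j k, Rabs (chi M (q j) * chi M (p k) - chi M (q' j) * chi M (p' k))
  <= 2 * M * d) by (intros; apply chi_mult_lip; auto).
assert (Hd : 0 <= M * d).
{ apply Rmult_le_pos. lra. eapply Rle_trans. 2: apply (Hq I0). apply Rabs_pos. }
assert (H' : forall j k, - (2 * M * d) <=
  chi M (q j) * chi M (p k) - chi M (q' j) * chi M (p' k) <= 2 * M * d).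
{ intros; apply Rabs_le_between, H. }
apply Rabs_le.
destruct i; unfold Om.
- assert (Ha := H' I1 I1). assert (Hb := H' I2 I2). assert (Hc := H' I3 I3). lra.
- assert (Ha := H' I1 I0). assert (Hb := H' I3 I2). assert (Hc := H' I2 I3). lra.
- assert (Ha := H' I2 I0). assert (Hb := H' I3 I1). assert (Hc := H' I1 I3). lra.
- assert (Ha := H' I3 I0). assert (Hb := H' I2 I1). assert (Hc := H' I1 I2). lra.
Qed.

Lemma mult_bound a b K d : Rabs a <= K -> Rabs b <= d -> Rabs (a * b) <= K * d.
Proof.
intros Ha Hb. rewrite Rabs_mult. apply Rmult_le_compat; auto; apply Rabs_pos.
Qed.

Lemma cutN_lip M c1 c2 K d k x y u v : 0 < M ->
  Rabs (c1 x y) <= K -> Rabs (c2 x y) <= K ->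
  (forall j, Rabs (u j - v j) <= d) ->
  Rabs (cutN M c1 c2 k x y u - cutN M c1 c2 k x y v) <= (8 * M + 2 * K) * d.
Proof.
intros HM H1 H2 Huv. unfold cutN.
assert (Ha := Om_chi_lip M d (fun j => u (negb (fst k), j)) (fun j => u (fst k, j))
  (fun j => v (negb (fst k), j)) (fun j => v (fst k, j)) (snd k) HM
  (fun j => Huv _) (fun j => Huv _)).
assert (Hb := mult_bound _ _ _ _ H1 (Huv (true, snd k))).
assert (Hc := mult_bound _ _ _ _ H2 (Huv (false, snd k))).
match type of Ha with Rabs ?A <= _ => match type of Hb with Rabs ?B <= _ =>
 match type of Hc with Rabs ?C <= _ =>
 match goal with |- Rabs ?e <= _ => replace e with (A + B + C) by ring end end end end.
eapply Rle_trans. apply Rabs_triang.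
eapply Rle_trans. apply Rplus_le_compat_r, Rabs_triang. lra.
Qed.

Lemma Om_chi_bound M (q p : idx -> R) i : 0 < M ->
  Rabs (Om (fun j => chi M (q j)) (fun j => chi M (p j)) i) <= 8 * M * M.
Proof.
intros HM.
assert (Hz : Om (fun _ => 0) (fun _ => 0) i = 0) by (destruct i; unfold Om; ring).
assert (Hc : forall s, Rabs s <= M -> chi M s = s).
{ intros s Hs. apply clamp_id. apply Rabs_le_between, Hs. }
(* Compare with zero arguments. Truncating beforehand brings every argument within M of 0, and the
   second truncation then changes nothing. *)
assert (H := Om_chi_lip M M (fun j => chi M (q j)) (fun j => chi M (p j))
  (fun _ => 0) (fun _ => 0) i HM).
assert (Hd : forall s, Rabs (chi M s - 0) <= M).
{ intros s. rewrite Rminus_0_r. apply chi_bound, HM. }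
specialize (H (fun j => Hd _) (fun j => Hd _)). cbv beta in H.
rewrite (Hc 0) in H by (rewrite Rabs_R0; lra). rewrite Hz, Rminus_0_r in H.
destruct i; unfold Om in *; rewrite !(Hc (chi M _)) in H by (apply chi_bound, HM); exact H.
Qed.

Definition sel (P Q : idx -> R -> R -> R) (k : bool * idx) : R -> R -> R :=
  if fst k then P (snd k) else Q (snd k).

Lemma cutN_id M c1 c2 P Q k x y :
  (forall i, chi M (P i x y) = P i x y) -> (forall i, chi M (Q i x y) = Q i x y) ->
  cutN M c1 c2 k x y (fun j => sel P Q j x y) = sel (gP c1 c2 P Q) (gQ c1 c2 P Q) k x y.
Proof.
intros HP HQ. destruct k as [[] []]; unfold cutN, sel, gP, gQ, Om; simpl;
  rewrite ?HP, ?HQ; reflexivity.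
Qed.

Lemma idx_bound (T : Type) (D : T -> Prop) (f : idx -> T -> R) :
  (forall i, exists B, 0 <= B /\ forall p, D p -> Rabs (f i p) <= B) ->
  exists B, 0 <= B /\ forall i p, D p -> Rabs (f i p) <= B.
Proof.
intros H.
destruct (H I0) as (a & Ha & Ta), (H I1) as (b & Hb & Tb),
 (H I2) as (c & Hc & Tc), (H I3) as (d & Hd & Td).
exists (a + b + c + d). split. lra.
intros [] p Hp; [apply Ta in Hp | apply Tb in Hp | apply Tc in Hp | apply Td in Hp]; lra.
Qed.

Definition clamp2 (a b c d : R) (f : R -> R -> R) (x y : R) : R :=
  f (clamp a b x) (clamp c d y).

Lemma clamp2_id a b c d f x y : a <= x <= b -> c <= y <= d -> clamp2 a b c d f x y = f x y.
Proof. intros Hx Hy. unfold clamp2. rewrite !clamp_id by assumption. reflexivity. Qed.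

Lemma clamp2_cont_bound a b c d f : a <= b -> c <= d ->
  (forall x y, a <= x <= b -> c <= y <= d -> cont2 f x y) ->
  (forall x y, cont2 (clamp2 a b c d f) x y) /\
  exists B, 0 <= B /\ forall p, True -> Rabs (clamp2 a b c d f (fst p) (snd p)) <= B.
Proof.
intros Hab Hcd Hf. split.
- intros x y. apply (cont2_comp f (fun x _ => clamp a b x) (fun _ y => clamp c d y)).
  apply Hf; apply clamp_in; assumption.
  apply cont2_fst, continuous_clamp. apply cont2_snd, continuous_clamp.
- destruct (bounded_2d f a b c d Hf) as (B & HB0 & HB).
  exists B; split; auto. intros p _; apply HB; apply clamp_in; assumption.
Qed.

(** The multiplier [chi M (u (b, j))] is the very vector on which the truncated [Om] acts, so
    [Om_skew] still removes the quadratic part. Each of the two linear terms contributes 2 K times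
    the sum of the energies. *)
Lemma cutN_energy M c1 c2 K b x y (u : bool * idx -> R) : 0 < M -> 0 <= K ->
  Rabs (c1 x y) <= K -> Rabs (c2 x y) <= K ->
  Rabs (sum4 (fun j => chi M (u (b, j)) * cutN M c1 c2 (b, j) x y u))
  <= 4 * K * (sum4 (fun j => hub M (u (true, j))) + sum4 (fun j => hub M (u (false, j)))).
Proof.
intros HM HK H1 H2.
assert (Hs := Om_skew (fun j => chi M (u (negb b, j))) (fun j => chi M (u (b, j)))).
pose (r := fun j => chi M (u (b, j)) * (c1 x y * u (true, j) + c2 x y * u (false, j))).
replace (sum4 (fun j => chi M (u (b, j)) * cutN M c1 c2 (b, j) x y u)) with (sum4 r).
2: { transitivity (sum4 r + 0). ring. rewrite <- Hs.
     unfold sum4, r, cutN; simpl fst; simpl snd. ring. }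
assert (Hr : forall j, Rabs (r j) <= 4 * K * (hub M (u (true, j)) + hub M (u (false, j)))).
{ intros j. unfold r.
  replace (chi M (u (b, j)) * (c1 x y * u (true, j) + c2 x y * u (false, j)))
    with (c1 x y * (chi M (u (b, j)) * u (true, j)) + c2 x y * (chi M (u (b, j)) * u (false, j)))
    by ring.
  eapply Rle_trans. apply Rabs_triang.
  assert (Ha := hub_ge0 M (u (true, j)) HM). assert (Hb := hub_ge0 M (u (false, j)) HM).
  assert (Hc : forall c, Rabs (chi M (u (b, j)) * u (c, j))
     <= 2 * (hub M (u (true, j)) + hub M (u (false, j)))).
  { intros c.
    assert (Hc2 := hub_chi2 M (u (b, j)) (u (c, j)) HM).
    destruct b, c; try lra.
    - assert (Hd := hub_chi M (u (true, j)) HM). lra.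
    - assert (Hd := hub_chi M (u (false, j)) HM). lra. }
  assert (Hx := mult_bound _ _ _ _ H1 (Hc true)).
  assert (Hy := mult_bound _ _ _ _ H2 (Hc false)). lra. }
unfold sum4 in *.
assert (H0 := Hr I0). assert (H3 := Hr I1). assert (H4 := Hr I2). assert (H5 := Hr I3).
apply Rabs_le_between in H0, H3, H4, H5. apply Rabs_le. lra.
Qed.

Lemma continuous_sum4 (f : idx -> R -> R) t :
  (forall j, continuous (f j) t) -> continuous (fun t => sum4 (fun j => f j t)) t.
Proof.
intros H. unfold sum4.
apply (continuous_plus (V:=R_NormedModule)). 2: apply H.
apply (continuous_plus (V:=R_NormedModule)). 2: apply H.
apply (continuous_plus (V:=R_NormedModule)); apply H.
Qed.

(** The chain rule with [hub_derive] expresses the growth of the energy along a segment as an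
    integral, and the exponential bound on the integrand gains 1 / l. *)
Lemma energy_1d M (u G : idx -> R -> R) (a : idx -> R) b l c S :
  0 < M -> 0 <= b -> 0 < l -> 0 <= S ->
  (forall j t, 0 <= t -> u j t = a j + RInt (G j) 0 (pospart t)) ->
  (forall j t, 0 <= t -> continuous (u j) t) ->
  (forall j t, 0 <= t -> continuous (G j) t) ->
  (forall t, 0 <= t <= b ->
     Rabs (sum4 (fun j => chi M (u j t) * G j t)) <= S * exp (l * (c + t))) ->
  sum4 (fun j => hub M (u j b)) <=
    sum4 (fun j => hub M (a j)) + S / l * exp (l * (c + b)).
Proof.
intros HM Hb Hl HS Hu Huc HG HB.
assert (Hint : forall t, 0 <= t <= b ->
  continuous (fun t => sum4 (fun j => chi M (u j t) * G j t)) t).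
{ intros t Ht. apply continuous_sum4. intros j.
  apply (continuous_mult (K:=R_AbsRing)). 2: apply HG; lra.
  apply (continuous_comp (u j) (chi M)). apply Huc; lra. apply continuous_clamp. }
rewrite (ftc_open (fun t => sum4 (fun j => hub M (u j t)))
   (fun t => sum4 (fun j => chi M (u j t) * G j t)) b); auto.
- apply Rplus_le_compat.
  + unfold sum4. rewrite !Hu by lra. rewrite pos_id, !RInt_point by lra.
    unfold zero; simpl. rewrite !Rplus_0_r. lra.
  + apply Rle_trans with (1 := Rle_abs _). apply RInt_exp_bound; auto.
    apply ex_RInt_cont; auto.
- intros t Ht. apply continuous_sum4. intros j.
  apply (continuous_comp (u j) (hub M)). apply Huc; lra.
  apply (ex_derive_continuous (hub M)). eexists; apply hub_derive, HM.
- intros t Ht.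
  assert (Hd : forall j, is_derive (fun t => hub M (u j t)) t (chi M (u j t) * G j t)).
  { intros j. apply (is_derive_eq _ _ (G j t * chi M (u j t))). 2: ring.
    apply (is_derive_comp (hub M) (u j)). apply hub_derive, HM.
    apply (is_derive_ext_loc (fun t => a j + RInt (G j) 0 (pospart t))).
    - assert (Ht0 : 0 < t) by lra. exists (mkposreal _ Ht0). intros s Hs.
      apply Rabs_lt_between' in Hs; simpl in Hs. symmetry; apply Hu; lra.
    - apply (is_derive_eq _ _ (0 + G j t)). 2: ring.
      apply is_derive_plus_R. apply is_derive_const_R.
      apply (is_derive_intd_y _ _ 1); try lra. intros; apply HG; lra. }
  unfold sum4. repeat apply is_derive_plus_R; apply Hd.
Qed.

Definition box (X Y x y : R) : Prop := 0 <= x <= X /\ 0 <= y <= Y.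

(** Clamping makes coefficients and data globally bounded, so [picard] solves the truncated system.
    Its energy bound is independent of M, hence for large M the truncation is inactive on the box
    and the true system is solved there. *)
Lemma goursat_box X Y c1 c2 (p0 q0 : idx -> R -> R) : 0 <= X -> 0 <= Y ->
  (forall x y, box X Y x y -> cont2 c1 x y) ->
  (forall x y, box X Y x y -> cont2 c2 x y) ->
  (forall i x, 0 <= x <= X -> continuous (p0 i) x) ->
  (forall i y, 0 <= y <= Y -> continuous (q0 i) y) ->
  exists P Q : idx -> R -> R -> R,
    (forall i x y, cont2 (P i) x y) /\ (forall i x y, cont2 (Q i) x y) /\
    gsol (box X Y) c1 c2 p0 q0 P Q.
Proof.
intros HX HY Hc1 Hc2 Hp0 Hq0.
pose (cl := clamp2 0 X 0 Y).
assert (Hcl := fun f => clamp2_cont_bound 0 X 0 Y f HX HY). fold cl in Hcl.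
destruct (Hcl c1) as [Hk1 (K1 & HK1 & HK1b)]. { intros; apply Hc1; split; auto. }
destruct (Hcl c2) as [Hk2 (K2 & HK2 & HK2b)]. { intros; apply Hc2; split; auto. }
assert (HP0 : forall i x y, 0 <= x <= X -> 0 <= y <= Y -> cont2 (fun x _ => p0 i x) x y)
  by (intros; apply cont2_fst, Hp0; auto).
assert (HQ0 : forall i x y, 0 <= x <= X -> 0 <= y <= Y -> cont2 (fun _ y => q0 i y) x y)
  by (intros; apply cont2_snd, Hq0; auto).
destruct (idx_bound (R * R) (fun _ => True) (fun i p => cl (fun x _ => p0 i x) (fst p) (snd p)))
  as (Bp & HBp & HBpb). { intros i; apply (Hcl _ (HP0 i)). }
destruct (idx_bound (R * R) (fun _ => True) (fun i p => cl (fun _ y => q0 i y) (fst p) (snd p)))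
  as (Bq & HBq & HBqb). { intros i; apply (Hcl _ (HQ0 i)). }
(* K and B0 do not involve M. The energy of the data is at most C = 4 (B0^2 / 2). The energy
   identity has rate at most 8 K S, so l = 16 K gives the factor 1/2. The bootstrap then yields 2 C
   [wt l X Y], which is below M^2 / 2 for the chosen M. *)
pose (K := K1 + K2 + 1). pose (B0 := Bp + Bq).
pose (l := 16 * K). pose (C := 2 * B0 ^ 2).
pose (M := 4 * C * wt l X Y + 1).
assert (HC : 0 <= C) by (unfold C; nra).
assert (HwXY := wt_pos l X Y).
assert (HM1 : 1 <= M) by (unfold M; nra). assert (HM : 0 < M) by lra.
assert (HK : 1 <= K) by (unfold K; lra).
assert (Hl : 0 < l) by (unfold l; lra).
assert (HK1' : forall x y, Rabs (cl c1 x y) <= K).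
{ intros x y. eapply Rle_trans. apply (HK1b (x, y) I). unfold K; lra. }
assert (HK2' : forall x y, Rabs (cl c2 x y) <= K).
{ intros x y. eapply Rle_trans. apply (HK2b (x, y) I). unfold K; lra. }
pose (F0 := fun (k : bool * idx) => if fst k then cl (fun x _ => p0 (snd k) x)
   else cl (fun _ y => q0 (snd k) y)).
assert (HF0 : forall k x y, Rabs (F0 k x y) <= B0).
{ intros [[] i] x y; unfold F0, B0; simpl.
  - specialize (HBpb i (x, y) I); simpl in HBpb; lra.
  - specialize (HBqb i (x, y) I); simpl in HBqb; lra. }
assert (HF0c : forall k x y, cont2 (F0 k) x y).
{ intros [[] i] x y; unfold F0; simpl. apply (Hcl _ (HP0 i)). apply (Hcl _ (HQ0 i)). }
assert (HNc : forall U : bool * idx -> R -> R -> R, (forall j x y, cont2 (U j) x y) ->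
  forall k x y, cont2 (fun x y => cutN M (cl c1) (cl c2) k x y (fun j => U j x y)) x y).
{ intros U HU k x y. unfold cutN.
  apply continuity_2d_pt_plus. apply continuity_2d_pt_plus.
  - apply (cont2_Om (fun j x y => chi M (U (negb (fst k), j) x y))
      (fun j x y => chi M (U (fst k, j) x y)));
    intros j; apply (cont2_comp1 (chi M)); auto; apply continuous_clamp.
  - apply continuity_2d_pt_mult; auto.
  - apply continuity_2d_pt_mult; auto. }
destruct (picard (bool * idx) fst F0 (cutN M (cl c1) (cl c2)) (8 * M + 2 * K)
   (8 * M * M + 2 * K * B0)) as (U & HUc & HUeq); auto.
{ lra. }
{ assert (0 <= B0) by (unfold B0; lra). nra. }
{ intros d x y u v Hd Huv k. apply cutN_lip; auto. }
{ intros k x y. unfold cutN.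
  assert (Hb := mult_bound _ _ _ _ (HK1' x y) (HF0 (true, snd k) x y)).
  assert (Hc := mult_bound _ _ _ _ (HK2' x y) (HF0 (false, snd k) x y)).
  assert (Hd := Om_chi_bound M (fun j => F0 (negb (fst k), j) x y)
    (fun j => F0 (fst k, j) x y) (snd k) HM).
  eapply Rle_trans. apply Rabs_triang.
  eapply Rle_trans. apply Rplus_le_compat_r, Rabs_triang. lra. }
pose (E := fun b x y => sum4 (fun j => hub M (U (b, j) x y))).
assert (HEc : forall b x y, cont2 (E b) x y).
{ intros b x y. apply (cont2_sum4 (fun j x y => hub M (U (b, j) x y))). intros j.
  apply (cont2_comp1 (hub M)); auto.
  apply (ex_derive_continuous (hub M)). eexists; apply hub_derive, HM. }
assert (HE0 : forall b x y, sum4 (fun j => hub M (F0 (b, j) x y)) <= C).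
{ intros b x y. assert (H : forall k, hub M (F0 k x y) <= B0 ^ 2 / 2).
  { intros k. eapply Rle_trans. apply hub_le, HM.
    assert (H := HF0 k x y). apply Rabs_le_between in H.
    assert (F0 k x y ^ 2 <= B0 ^ 2) by nra. lra. }
  unfold sum4, C.
  assert (H0 := H (b, I0)). assert (H1 := H (b, I1)).
  assert (H2 := H (b, I2)). assert (H3 := H (b, I3)). lra. }
(* The bounds Bt and Bf come from compactness and their size is uncontrolled; they only start the
   bootstrap, which is run for both energies together. *)
assert (HEb : forall b x y, box X Y x y -> E b x y <= 2 * C * wt l x y).
{ destruct (bounded_2d (E true) 0 X 0 Y) as (Bt & HBt & HBtb); auto.
  destruct (bounded_2d (E false) 0 X 0 Y) as (Bf & HBf & HBfb); auto.
  intros b x y Hxy.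
  apply (halving _ (fun p => box X Y (fst (snd p)) (snd (snd p)))
    (fun p => E (fst p) (fst (snd p)) (snd (snd p)))
    (fun p => wt l (fst (snd p)) (snd (snd p))) C (Bt + Bf)) with (p := (b, (x, y))); auto.
    - lra.
    - intros; left; apply wt_pos.
    - clear b x y Hxy. intros [b [x y]] [Hx Hy]; simpl in *.
      assert (Ha := Rle_trans _ _ _ (Rle_abs _) (HBtb x y Hx Hy)).
      assert (Hb := Rle_trans _ _ _ (Rle_abs _) (HBfb x y Hx Hy)).
      assert (H1 := wt_ge1 l x y). destruct b; nra.
    - clear b x y Hxy. intros S HS HES.
      assert (Hall : forall b x y, box X Y x y -> Rabs (sum4 (fun j => chi M (U (b, j) x y) *
          cutN M (cl c1) (cl c2) (b, j) x y (fun j => U j x y))) <= 8 * K * S * wt l x y).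
      { intros b x y Hxy.
        eapply Rle_trans. apply (cutN_energy M (cl c1) (cl c2) K b x y (fun j => U j x y)); auto; lra.
        assert (Ha := HES (true, (x, y)) Hxy). assert (Hb := HES (false, (x, y)) Hxy).
        unfold E in Ha, Hb; simpl in Ha, Hb. nra. }
      intros [b [x y]] [Hx Hy]; unfold E; simpl in *.
      rewrite Rmult_plus_distr_r.
      assert (Hle : C <= C * wt l x y).
      { assert (H1 := wt_ge1 l x y). nra. }
      apply Rle_trans with (sum4 (fun j => hub M (F0 (b, j) x y)) + S / 2 * wt l x y).
      2: { specialize (HE0 b x y). lra. }
      replace (S / 2) with (8 * K * S / l) by (unfold l; field; lra).
      assert (HKS : 0 <= 8 * K * S) by nra.
      destruct b.
      + assert (Hw : forall t, 0 <= t -> wt l x t = exp (l * (pospart x + t))).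
        { intros t Ht. unfold wt. rewrite (pos_id t) by lra. reflexivity. }
        rewrite Hw by lra.
        replace (sum4 (fun j => hub M (F0 (true, j) x y)))
          with (sum4 (fun j => hub M (F0 (true, j) x 0))) by reflexivity.
        apply (energy_1d M (fun j t => U (true, j) x t) (fun j t =>
          cutN M (cl c1) (cl c2) (true, j) x t (fun j => U j x t))
          (fun j => F0 (true, j) x 0)); auto; try lra.
        * intros j t Ht. apply cont2_slice_y, HUc.
        * intros j t Ht. apply (cont2_slice_y (fun x t =>
            cutN M (cl c1) (cl c2) (true, j) x t (fun j => U j x t))), HNc, HUc.
        * intros t Ht. rewrite <- Hw by lra. apply Hall. split; lra.
      + assert (Hw : forall t, 0 <= t -> wt l t y = exp (l * (pospart y + t))).
        { intros t Ht. unfold wt. rewrite (pos_id t) by lra. f_equal; ring. }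
        rewrite Hw by lra.
        replace (sum4 (fun j => hub M (F0 (false, j) x y)))
          with (sum4 (fun j => hub M (F0 (false, j) 0 y))) by reflexivity.
        apply (energy_1d M (fun j t => U (false, j) t y) (fun j t =>
          cutN M (cl c1) (cl c2) (false, j) t y (fun j => U j t y))
          (fun j => F0 (false, j) 0 y)); auto; try lra.
        * intros j t Ht. apply (cont2_slice_x (U (false, j))), HUc.
        * intros j t Ht. apply (cont2_slice_x (fun t y =>
            cutN M (cl c1) (cl c2) (false, j) t y (fun j => U j t y))), HNc, HUc.
        * intros t Ht. rewrite <- Hw by lra. apply Hall. split; lra. }
assert (Hsmall : forall k x y, box X Y x y -> chi M (U k x y) = U k x y).
{ intros [b i] x y Hxy. apply hub_small; auto.
  assert (H1 := HEb b x y Hxy).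
  assert (H2 : wt l x y <= wt l X Y).
  { unfold wt. destruct Hxy as [[Hx1 Hx2] [Hy1 Hy2]].
    rewrite !pos_id by lra.
    assert (H : l * (x + y) <= l * (X + Y)) by nra.
    destruct H as [H|H]. left; apply exp_increasing, H. rewrite H; lra. }
  assert (H3 : forall j, 0 <= hub M (U (b, j) x y)) by (intros; apply hub_ge0, HM).
  assert (H4 : hub M (U (b, i) x y) <= E b x y).
  { unfold E, sum4. assert (Ha := H3 I0). assert (Hb := H3 I1).
    assert (Hc := H3 I2). assert (Hd := H3 I3). destruct i; lra. }
  assert (H5 : 2 * C * wt l x y <= 2 * C * wt l X Y) by (apply Rmult_le_compat_l; lra).
  unfold M in *. nra. }
exists (fun i => U (true, i)), (fun i => U (false, i)).
split. auto. split. auto.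
intros i x y [Hx Hy].
assert (HN : forall k u v, box X Y u v ->
  cutN M (cl c1) (cl c2) k u v (fun j => U j u v) =
  sel (gP c1 c2 (fun i => U (true, i)) (fun i => U (false, i)))
    (gQ c1 c2 (fun i => U (true, i)) (fun i => U (false, i))) k u v).
{ intros k u v Hb. rewrite <- (cutN_id M) by (intros; apply Hsmall, Hb).
  unfold cutN, cl. rewrite !clamp2_id by apply Hb.
  destruct k as [[] j]; unfold sel, Om; simpl; destruct j; reflexivity. }
split; rewrite HUeq;
  [ change (F0 (true, i) x y) with (clamp2 0 X 0 Y (fun x _ => p0 i x) x y)
  | change (F0 (false, i) x y) with (clamp2 0 X 0 Y (fun _ y => q0 i y) x y) ];
  rewrite clamp2_id by assumption; f_equal; unfold intd; simpl fst; cbv iota;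
  apply RInt_ext; intros t Ht; rewrite Rmin_left, Rmax_right in Ht by apply pos_ge0;
  rewrite pos_id in Ht by lra; [apply (HN (true, i) x t) | apply (HN (false, i) t y)]; split; lra.
Qed.

(** * Uniqueness on boxes and the solution on the whole domain *)

Lemma cont2_gP c1 c2 P Q i x y : cont2 c1 x y -> cont2 c2 x y ->
  (forall j, cont2 (P j) x y) -> (forall j, cont2 (Q j) x y) ->
  cont2 (gP c1 c2 P Q i) x y.
Proof.
intros H1 H2 HP HQ. unfold gP. cont2_auto; auto. apply (cont2_Om Q P); auto.
Qed.

Lemma cont2_gQ c1 c2 P Q i x y : cont2 c1 x y -> cont2 c2 x y ->
  (forall j, cont2 (P j) x y) -> (forall j, cont2 (Q j) x y) ->
  cont2 (gQ c1 c2 P Q i) x y.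
Proof.
intros H1 H2 HP HQ. unfold gQ. cont2_auto; auto. apply (cont2_Om P Q); auto.
Qed.

Lemma idx_bounded_2d (f : idx -> R -> R -> R) X Y :
  (forall i x y, box X Y x y -> cont2 (f i) x y) ->
  exists B, 0 <= B /\ forall i x y, box X Y x y -> Rabs (f i x y) <= B.
Proof.
intros Hf.
destruct (idx_bound (R * R) (fun p => box X Y (fst p) (snd p)) (fun i p => f i (fst p) (snd p)))
  as (B & HB & H).
- intros i. destruct (bounded_2d (f i) 0 X 0 Y) as (B & HB & H).
  + intros x y Hx Hy; apply Hf; split; auto.
  + exists B; split; auto. intros p [Hx Hy]; auto.
- exists B; split; auto. intros i x y Hxy; apply (H i (x, y) Hxy).
Qed.

(** With M above the supremum of both solutions on the box, the system coincides along them with its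
    truncation, which is Lipschitz. *)
Lemma goursat_box_unique X Y c1 c2 p0 q0 P Q P' Q' :
  (forall x y, box X Y x y -> cont2 c1 x y) ->
  (forall x y, box X Y x y -> cont2 c2 x y) ->
  (forall i x y, box X Y x y -> cont2 (P i) x y /\ cont2 (Q i) x y) ->
  (forall i x y, box X Y x y -> cont2 (P' i) x y /\ cont2 (Q' i) x y) ->
  gsol (box X Y) c1 c2 p0 q0 P Q -> gsol (box X Y) c1 c2 p0 q0 P' Q' ->
  forall i x y, box X Y x y -> P i x y = P' i x y /\ Q i x y = Q' i x y.
Proof.
intros Hc1 Hc2 HPQ HPQ' HS HS'.
destruct (idx_bounded_2d P X Y) as (B1 & HB1 & Hb1). { intros; apply HPQ; auto. }
destruct (idx_bounded_2d Q X Y) as (B2 & HB2 & Hb2). { intros; apply HPQ; auto. }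
destruct (idx_bounded_2d P' X Y) as (B3 & HB3 & Hb3). { intros; apply HPQ'; auto. }
destruct (idx_bounded_2d Q' X Y) as (B4 & HB4 & Hb4). { intros; apply HPQ'; auto. }
destruct (bounded_2d c1 0 X 0 Y) as (K1 & HK1 & Hk1). { intros; apply Hc1; split; auto. }
destruct (bounded_2d c2 0 X 0 Y) as (K2 & HK2 & Hk2). { intros; apply Hc2; split; auto. }
pose (M := B1 + B2 + B3 + B4 + 1). pose (K := K1 + K2).
assert (HM : 0 < M) by (unfold M; lra).
assert (Hex : forall P Q, (forall i x y, box X Y x y -> cont2 (P i) x y /\ cont2 (Q i) x y) ->
  forall k x y, box X Y x y -> ex_intd (fst k) (sel (gP c1 c2 P Q) (gQ c1 c2 P Q) k) x y).
{ clear - Hc1 Hc2. intros P Q H [[] i] x y [Hx Hy]; apply ex_intd_cont; unfold seg, sel; simpl;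
  intros t Ht; rewrite pos_id in Ht by lra.
  - assert (Hb : box X Y x t) by (split; lra). apply cont2_gP; auto; intros j; apply (H j x t Hb).
  - assert (Hb : box X Y t y) by (split; lra). apply cont2_gQ; auto; intros j; apply (H j t y Hb). }
assert (H : forall k x y, box X Y x y -> sel P Q k x y = sel P' Q' k x y).
{ apply (goursat_unique (bool * idx) fst (box X Y)
    (fun k x y => if fst k then p0 (snd k) x else q0 (snd k) y)
    (sel P Q) (sel P' Q') (sel (gP c1 c2 P Q) (gQ c1 c2 P Q))
    (sel (gP c1 c2 P' Q') (gQ c1 c2 P' Q')) (8 * M + 2 * K) (2 * M)); auto.
  - unfold K; lra.
  - lra.
  - intros [[] i] x y [Hx Hy]; simpl; intros t Ht; rewrite pos_id in Ht by lra;
     split; lra.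
  - intros [[] i] x y Hxy; unfold sel, intd; simpl; apply (HS i x y Hxy).
  - intros [[] i] x y Hxy; unfold sel, intd; simpl; apply (HS' i x y Hxy).
  - intros d x y Hd Hxy Hdiff k.
    rewrite <- !(cutN_id M) by (intros j; specialize (Hb1 j x y Hxy);
      specialize (Hb2 j x y Hxy); specialize (Hb3 j x y Hxy); specialize (Hb4 j x y Hxy);
      apply clamp_id, Rabs_le_between; unfold M; lra).
    apply cutN_lip; auto.
    + specialize (Hk1 x y (proj1 Hxy) (proj2 Hxy)). unfold K; lra.
    + specialize (Hk2 x y (proj1 Hxy) (proj2 Hxy)). unfold K; lra.
  - intros [[] i] x y Hxy; unfold sel; simpl;
    specialize (Hb1 i x y Hxy); specialize (Hb2 i x y Hxy);
      specialize (Hb3 i x y Hxy); specialize (Hb4 i x y Hxy);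
    (eapply Rle_trans; [apply Rabs_triang | rewrite Rabs_Ropp; unfold M; lra]). }
intros i x y Hxy. split. exact (H (true, i) x y Hxy). exact (H (false, i) x y Hxy).
Qed.

Lemma gsol_sub (D D' : R -> R -> Prop) c1 c2 p0 q0 P Q :
  (forall x y, D' x y -> D x y) -> gsol D c1 c2 p0 q0 P Q -> gsol D' c1 c2 p0 q0 P Q.
Proof. intros H HS i x y Hxy; apply HS, H, Hxy. Qed.

Definition swap {A : Type} (u : R -> R -> A) : R -> R -> A := fun x y => u y x.

(** The value at (x, y) is read from a solution chosen on the box whose upper corner is (x, y);
    uniqueness makes all these choices agree on smaller boxes. *)
Lemma goursat_global (W : R -> R -> Prop) c1 c2 (p0 q0 : idx -> R -> R) :
  open2 W -> low W -> low (swap W) ->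
  (forall x y, W x y -> cont2 c1 x y) -> (forall x y, W x y -> cont2 c2 x y) ->
  (forall x y, c1 x y = c1 (pospart x) (pospart y)) ->
  (forall x y, c2 x y = c2 (pospart x) (pospart y)) ->
  (forall i x, W x 0 -> continuous (p0 i) x) ->
  (forall i y, W 0 y -> continuous (q0 i) y) ->
  (forall i x, p0 i x = p0 i (pospart x)) ->
  (forall i x, q0 i x = q0 i (pospart x)) ->
  exists P Q : idx -> R -> R -> R,
    (forall i x y, W x y -> cont2 (P i) x y) /\
    (forall i x y, W x y -> cont2 (Q i) x y) /\
    gsol W c1 c2 p0 q0 P Q.
Proof.
intros Ho Hl Hl' Hc1 Hc2 Hc1p Hc2p Hp0 Hq0 Hp0p Hq0p.
assert (Hbox : forall X Y x y, W X Y -> x <= pospart X -> y <= pospart Y -> W x y).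
{ intros X Y x y HW Hx Hy. apply (Hl' y X x); auto. unfold swap. apply (Hl X Y y); auto. }
pose (good := fun X Y (S : (idx -> R -> R -> R) * (idx -> R -> R -> R)) =>
  (forall i x y, cont2 (fst S i) x y) /\ (forall i x y, cont2 (snd S i) x y) /\
  gsol (box X Y) c1 c2 p0 q0 (fst S) (snd S)).
assert (Hex : forall X Y, exists S, W X Y -> 0 <= X -> 0 <= Y -> good X Y S).
{ intros X Y. destruct (classic (W X Y /\ 0 <= X /\ 0 <= Y)) as [(HW & HX & HY)|Hn].
  - assert (Hb : forall x y, box X Y x y -> W x y).
    { intros x y [Hx Hy]. apply (Hbox X Y); auto; rewrite pos_id; lra. }
    destruct (goursat_box X Y c1 c2 p0 q0) as (P & Q & HP & HQ & HS); auto.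
    + intros i x Hx. apply Hp0, Hb. split; lra.
    + intros i x Hx. apply Hq0, Hb. split; lra.
    + exists (P, Q). intros; split; auto.
  - exists ((fun _ _ _ => 0), (fun _ _ _ => 0)). tauto. }
pose (S := fun X Y => proj1_sig (constructive_indefinite_description _ (Hex X Y))).
assert (HS : forall X Y, W X Y -> 0 <= X -> 0 <= Y -> good X Y (S X Y)).
{ intros X Y; unfold S; destruct constructive_indefinite_description; auto. }
pose (P := fun i x y => fst (S (pospart x) (pospart y)) i (pospart x) (pospart y)).
pose (Q := fun i x y => snd (S (pospart x) (pospart y)) i (pospart x) (pospart y)).
assert (Hagree : forall X Y x y, W X Y -> 0 <= X -> 0 <= Y -> x <= X -> y <= Y ->
  forall i, P i x y = fst (S X Y) i (pospart x) (pospart y) /\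
    Q i x y = snd (S X Y) i (pospart x) (pospart y)).
{ intros X Y x y HW HX HY Hx Hy i. unfold P, Q.
  assert (Hx' : 0 <= pospart x <= X).
  { split. apply pos_ge0. rewrite <- (pos_id X) by lra. apply pos_le, Hx. }
  assert (Hy' : 0 <= pospart y <= Y).
  { split. apply pos_ge0. rewrite <- (pos_id Y) by lra. apply pos_le, Hy. }
  assert (Hb : forall u v, box (pospart x) (pospart y) u v -> W u v).
  { intros u v [Hu Hv]. apply (Hbox X Y); auto; rewrite pos_id; lra. }
  assert (HW' : W (pospart x) (pospart y)) by (apply Hb; split; lra).
  destruct (HS X Y HW HX HY) as (A1 & A2 & A3).
  destruct (HS _ _ HW' (proj1 Hx') (proj1 Hy')) as (B1 & B2 & B3).
  apply (goursat_box_unique (pospart x) (pospart y) c1 c2 p0 q0); auto.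
  - apply (gsol_sub (box X Y)); auto. intros u v [Hu Hv]; split; lra.
  - split; lra. }
(* Continuity at (x, y) needs one box containing a neighbourhood, hence a box with a slightly larger
   corner. *)
assert (Hroom : forall x y, W x y -> exists e, 0 < e /\ W (pospart x + e) (pospart y + e)).
{ intros x y HW. destruct (Ho (pospart x) (pospart y)) as [e He].
  { apply (Hbox x y); auto; lra. }
  exists (e / 2). pose proof (cond_pos e). split. lra. apply He; rewrite Rabs_pos_eq; lra. }
assert (Hcont : forall i x y, W x y -> cont2 (P i) x y /\ cont2 (Q i) x y).
{ intros i x y HW. destruct (Hroom x y HW) as (e & He & HWe).
  assert (Hx := pos_ge0 x). assert (Hy := pos_ge0 y).
  assert (Hx2 := pos_ge x). assert (Hy2 := pos_ge y).
  assert (Hloc : locally_2d (fun u v =>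
     P i u v = fst (S (pospart x + e) (pospart y + e)) i (pospart u) (pospart v) /\
     Q i u v = snd (S (pospart x + e) (pospart y + e)) i (pospart u) (pospart v)) x y).
  { exists (mkposreal e He). simpl. intros u v Hu Hv.
    apply Rabs_lt_between' in Hu; apply Rabs_lt_between' in Hv.
    apply Hagree; auto; lra. }
  destruct (HS _ _ HWe) as (A1 & A2 & A3); try lra.
  destruct Hloc as [d Hd].
  split; eapply continuity_2d_pt_ext_loc.
  1, 3: exists d; intros u v Hu Hv; symmetry; apply (Hd u v Hu Hv).
  - apply (cont2_comp _ (fun u _ => pospart u) (fun _ v => pospart v)).
    apply A1. apply cont2_fst, continuous_pos. apply cont2_snd, continuous_pos.
  - apply (cont2_comp _ (fun u _ => pospart u) (fun _ v => pospart v)).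
    apply A2. apply cont2_fst, continuous_pos. apply cont2_snd, continuous_pos. }
exists P, Q. split. intros; apply Hcont; auto. split. intros; apply Hcont; auto.
intros i x y HW.
assert (HX := pos_ge0 x). assert (HY := pos_ge0 y).
assert (HW' : W (pospart x) (pospart y)) by (apply (Hbox x y); auto; lra).
destruct (HS _ _ HW' HX HY) as (A1 & A2 & A3).
destruct (A3 i (pospart x) (pospart y)) as [E1 E2]. split; lra.
assert (Hag := fun u v Hu Hv => Hagree _ _ u v HW' HX HY Hu Hv).
assert (Hx2 := pos_ge x). assert (Hy2 := pos_ge y).
split.
- transitivity (fst (S (pospart x) (pospart y)) i (pospart x) (pospart y)). reflexivity.
  rewrite E1, <- Hp0p, pos_pos. f_equal. apply RInt_ext. intros t Ht.
  rewrite Rmin_left, Rmax_right in Ht by lra.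
  unfold gP. rewrite (Hc1p x t), (Hc2p x t). rewrite (pos_id t) by lra.
  assert (Ht' := fun j => Hag x t Hx2 (Rlt_le _ _ (proj2 Ht)) j).
  rewrite !(pos_id t) in Ht' by lra.
  unfold Om; destruct i; rewrite ?(fun j => proj1 (Ht' j)), ?(fun j => proj2 (Ht' j));
    reflexivity.
- transitivity (snd (S (pospart x) (pospart y)) i (pospart x) (pospart y)). reflexivity.
  rewrite E2, <- Hq0p, pos_pos. f_equal. apply RInt_ext. intros t Ht.
  rewrite Rmin_left, Rmax_right in Ht by lra.
  unfold gQ. rewrite (Hc1p t y), (Hc2p t y). rewrite (pos_id t) by lra.
  assert (Ht' := fun j => Hag t y (Rlt_le _ _ (proj2 Ht)) Hy2 j).
  rewrite !(pos_id t) in Ht' by lra.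
  unfold Om; destruct i; rewrite ?(fun j => proj1 (Ht' j)), ?(fun j => proj2 (Ht' j));
    reflexivity.
Qed.

(** * Finite differentiability in selected directions *)

Definition pd1 (u : R -> R -> R) (x y : R) : R := Derive (fun t => u t y) x.
Definition pd2 (u : R -> R -> R) (x y : R) : R := Derive (fun t => u x t) y.

(* C^n with respect to the first variable only, the second only, or both,
   according to the flags [a] and [b]; jointly continuous derivatives. *)
Fixpoint Ck (a b : bool) (n : nat) (V : R -> R -> Prop) (u : R -> R -> R) : Prop :=
  (forall x y, V x y -> cont2 u x y) /\
  match n with
  | O => True
  | S k =>
      (a = true ->
         (forall x y, V x y -> ex_derive (fun t => u t y) x) /\ Ck a b k V (pd1 u)) /\
      (b = true ->
         (forall x y, V x y -> ex_derive (fun t => u x t) y) /\ Ck a b k V (pd2 u))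
  end.

Lemma open2_x V x y : open2 V -> V x y -> locally x (fun t => V t y).
Proof.
intros Ho H. destruct (Ho x y H) as [e He]. exists e. intros t Ht. apply He; auto.
rewrite Rminus_eq_0, Rabs_R0; apply cond_pos.
Qed.

Lemma open2_y V x y : open2 V -> V x y -> locally y (fun t => V x t).
Proof.
intros Ho H. destruct (Ho x y H) as [e He]. exists e. intros t Ht. apply He; auto.
rewrite Rminus_eq_0, Rabs_R0; apply cond_pos.
Qed.

Lemma open2_swap V : open2 V -> open2 (swap V).
Proof.
intros Ho x y H. destruct (Ho y x H) as [e He]. exists e. intros u v Hu Hv.
apply He; auto.
Qed.

Lemma cont2_ext_open V u v x y : open2 V -> V x y ->
  (forall x y, V x y -> u x y = v x y) -> cont2 u x y -> cont2 v x y.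
Proof.
intros Ho Hxy H. apply continuity_2d_pt_ext_loc.
destruct (Ho x y Hxy) as [e He]. exists e. intros; apply H, He; auto.
Qed.

Section Ck.

Variables (a b : bool).

Lemma Ck_cont n V u x y : Ck a b n V u -> V x y -> cont2 u x y.
Proof. destruct n; intros [H _]; auto. Qed.

Lemma Ck_ext n V u v : open2 V -> (forall x y, V x y -> u x y = v x y) ->
  Ck a b n V u -> Ck a b n V v.
Proof.
intros Ho. revert u v. induction n as [|n IH]; intros u v He [Hc Hu]; split.
1, 3: intros x y Hxy; eapply cont2_ext_open; eauto.
exact I.
destruct Hu as [H1 H2]. split.
- intros Ha. destruct (H1 Ha) as [H3 H4]. split.
  + intros x y Hxy. apply (ex_derive_ext_loc (fun t => u t y)); auto.
    apply (filter_imp (fun t => V t y)). intros; apply He; auto. apply open2_x; auto.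
  + apply (IH (pd1 u)); auto. intros x y Hxy. apply Derive_ext_loc.
    apply (filter_imp (fun t => V t y)). intros; apply He; auto. apply open2_x; auto.
- intros Ha. destruct (H2 Ha) as [H3 H4]. split.
  + intros x y Hxy. apply (ex_derive_ext_loc (fun t => u x t)); auto.
    apply (filter_imp (fun t => V x t)). intros; apply He; auto. apply open2_y; auto.
  + apply (IH (pd2 u)); auto. intros x y Hxy. apply Derive_ext_loc.
    apply (filter_imp (fun t => V x t)). intros; apply He; auto. apply open2_y; auto.
Qed.

Lemma Ck_S n V u (u1 u2 : R -> R -> R) : open2 V ->
  (forall x y, V x y -> cont2 u x y) ->
  (a = true -> (forall x y, V x y -> is_derive (fun t => u t y) x (u1 x y)) /\
     Ck a b n V u1) ->
  (b = true -> (forall x y, V x y -> is_derive (fun t => u x t) y (u2 x y)) /\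
     Ck a b n V u2) ->
  Ck a b (S n) V u.
Proof.
intros Ho Hc H1 H2. split; auto. split.
- intros Ha. destruct (H1 Ha) as [H3 H4]. split.
  + intros x y Hxy. eexists; apply H3; auto.
  + apply (Ck_ext n V u1); auto. intros x y Hxy. symmetry. apply is_derive_unique; auto.
- intros Ha. destruct (H2 Ha) as [H3 H4]. split.
  + intros x y Hxy. eexists; apply H3; auto.
  + apply (Ck_ext n V u2); auto. intros x y Hxy. symmetry. apply is_derive_unique; auto.
Qed.

Lemma Ck_d1 n V u x y : a = true -> Ck a b (S n) V u -> V x y ->
  is_derive (fun t => u t y) x (pd1 u x y).
Proof. intros Ha (_ & H1 & _) Hxy. apply Derive_correct, (proj1 (H1 Ha)), Hxy. Qed.

Lemma Ck_d2 n V u x y : b = true -> Ck a b (S n) V u -> V x y ->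
  is_derive (fun t => u x t) y (pd2 u x y).
Proof. intros Ha (_ & _ & H1) Hxy. apply Derive_correct, (proj1 (H1 Ha)), Hxy. Qed.

Lemma Ck_S1 n V u : a = true -> Ck a b (S n) V u -> Ck a b n V (pd1 u).
Proof. intros Ha (_ & H1 & _). apply H1, Ha. Qed.

Lemma Ck_S2 n V u : b = true -> Ck a b (S n) V u -> Ck a b n V (pd2 u).
Proof. intros Ha (_ & _ & H1). apply H1, Ha. Qed.

Lemma Ck_pred n V u : Ck a b (S n) V u -> Ck a b n V u.
Proof.
revert u; induction n as [|n IH]; intros u [Hc [H1 H2]]; split; auto.
split; intros Ha; [destruct (H1 Ha) | destruct (H2 Ha)]; split; auto.
Qed.

Lemma Ck_le n m V u : (n <= m)%nat -> Ck a b m V u -> Ck a b n V u.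
Proof. intros H; induction H; auto. intros H'. apply IHle, Ck_pred, H'. Qed.

Lemma Ck_mono n V V' u : (forall x y, V' x y -> V x y) ->
  Ck a b n V u -> Ck a b n V' u.
Proof.
intros HV; revert u; induction n as [|n IH]; intros u [Hc H]; split; auto.
destruct H as [H1 H2]. split; intros Ha; [destruct (H1 Ha) | destruct (H2 Ha)]; split; auto.
Qed.

Lemma Ck_const n V c : open2 V -> Ck a b n V (fun _ _ => c).
Proof.
intros Ho; revert c; induction n as [|n IH]; intros c.
- split; auto. intros; apply continuity_2d_pt_const.
- apply (Ck_S n V _ (fun _ _ => 0) (fun _ _ => 0)); auto.
  + intros; apply continuity_2d_pt_const.
  + intros _; split; auto. intros; apply is_derive_const_R.
  + intros _; split; auto. intros; apply is_derive_const_R.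
Qed.

Lemma Ck_plus n V u v : open2 V -> Ck a b n V u -> Ck a b n V v ->
  Ck a b n V (fun x y => u x y + v x y).
Proof.
intros Ho; revert u v; induction n as [|n IH]; intros u v Hu Hv.
- split; auto. intros; apply continuity_2d_pt_plus; eapply Ck_cont; eauto.
- apply (Ck_S n V _ (fun x y => pd1 u x y + pd1 v x y) (fun x y => pd2 u x y + pd2 v x y)); auto.
  + intros; apply continuity_2d_pt_plus; eapply Ck_cont; eauto.
  + intros Ha; split; [intros x y Hxy; apply is_derive_plus_R; eapply Ck_d1; eauto |].
    apply IH; apply Ck_S1; auto.
  + intros Ha; split; [intros x y Hxy; apply is_derive_plus_R; eapply Ck_d2; eauto |].
    apply IH; apply Ck_S2; auto.
Qed.

Lemma Ck_mult n V u v : open2 V -> Ck a b n V u -> Ck a b n V v ->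
  Ck a b n V (fun x y => u x y * v x y).
Proof.
intros Ho; revert u v; induction n as [|n IH]; intros u v Hu Hv.
- split; auto. intros; apply continuity_2d_pt_mult; eapply Ck_cont; eauto.
- apply (Ck_S n V _ (fun x y => pd1 u x y * v x y + u x y * pd1 v x y)
    (fun x y => pd2 u x y * v x y + u x y * pd2 v x y)); auto.
  + intros; apply continuity_2d_pt_mult; eapply Ck_cont; eauto.
  + intros Ha; split.
    * intros x y Hxy. apply (is_derive_mult_R (fun t => u t y) (fun t => v t y));
        eapply Ck_d1; eauto.
    * apply Ck_plus; auto; apply IH; auto using Ck_S1, Ck_pred.
  + intros Ha; split.
    * intros x y Hxy. apply (is_derive_mult_R (fun t => u x t) (fun t => v x t));
        eapply Ck_d2; eauto.
    * apply Ck_plus; auto; apply IH; auto using Ck_S2, Ck_pred.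
Qed.

Lemma Ck_opp n V u : open2 V -> Ck a b n V u -> Ck a b n V (fun x y => - u x y).
Proof.
intros Ho Hu. apply (Ck_ext n V (fun x y => (-1) * u x y)); auto.
- intros; ring.
- apply Ck_mult; auto. apply Ck_const; auto.
Qed.

Lemma Ck_minus n V u v : open2 V -> Ck a b n V u -> Ck a b n V v ->
  Ck a b n V (fun x y => u x y - v x y).
Proof.
intros Ho Hu Hv. apply (Ck_plus n V u (fun x y => - v x y)); auto. apply Ck_opp; auto.
Qed.

Lemma Ck_inv n V u : open2 V -> (forall x y, V x y -> u x y <> 0) ->
  Ck a b n V u -> Ck a b n V (fun x y => / u x y).
Proof.
intros Ho H0; induction n as [|n IH]; intros Hu.
- split; auto. intros; apply continuity_2d_pt_inv; auto; eapply Ck_cont; eauto.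
- assert (HI := IH (Ck_pred _ _ _ Hu)).
  assert (Hd : forall (f : R -> R) x l, is_derive f x l -> f x <> 0 ->
    is_derive (fun t => / f t) x (- (l * (/ f x * / f x)))).
  { intros f x l Hf Hx. apply (is_derive_eq _ _ (- l / f x ^ 2)).
    apply is_derive_inv; auto. field; auto. }
  apply (Ck_S n V _ (fun x y => - (pd1 u x y * (/ u x y * / u x y)))
    (fun x y => - (pd2 u x y * (/ u x y * / u x y)))); auto.
  + intros; apply continuity_2d_pt_inv; auto; eapply Ck_cont; eauto.
  + intros Ha; split.
    * intros x y Hxy. apply (Hd (fun t => u t y)); auto. eapply Ck_d1; eauto.
    * apply Ck_opp; auto. repeat apply Ck_mult; auto. apply Ck_S1; auto.
  + intros Ha; split.
    * intros x y Hxy. apply (Hd (fun t => u x t)); auto. eapply Ck_d2; eauto.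
    * apply Ck_opp; auto. repeat apply Ck_mult; auto. apply Ck_S2; auto.
Qed.

(** The condition on g is an implication so that it can be an induction hypothesis, as for [exp]
    with g = f, or a known rule, as for [ln] with g = [Rinv]. *)
Lemma Ck_chain n V u (f g : R -> R) : open2 V ->
  (forall x y, V x y -> is_derive f (u x y) (g (u x y))) ->
  (Ck a b n V u -> Ck a b n V (fun x y => g (u x y))) ->
  Ck a b (S n) V u -> Ck a b (S n) V (fun x y => f (u x y)).
Proof.
intros Ho Hf Hg Hu.
assert (Hg' := Hg (Ck_pred _ _ _ Hu)).
apply (Ck_S n V _ (fun x y => pd1 u x y * g (u x y)) (fun x y => pd2 u x y * g (u x y))); auto.
- intros x y Hxy. apply (cont2_comp1 f). 2: eapply Ck_cont; eauto.
  apply (ex_derive_continuous f). eexists; apply Hf, Hxy.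
- intros Ha; split.
  + intros x y Hxy. apply (is_derive_comp f (fun t => u t y)). apply Hf, Hxy.
    eapply Ck_d1; eauto.
  + apply Ck_mult; auto. apply Ck_S1; auto.
- intros Ha; split.
  + intros x y Hxy. apply (is_derive_comp f (fun t => u x t)). apply Hf, Hxy.
    eapply Ck_d2; eauto.
  + apply Ck_mult; auto. apply Ck_S2; auto.
Qed.

Lemma Ck_exp n V u : open2 V -> Ck a b n V u -> Ck a b n V (fun x y => exp (u x y)).
Proof.
intros Ho; induction n as [|n IH]; intros Hu.
- split; auto. intros x y Hxy. apply (cont2_comp1 exp).
  + apply (ex_derive_continuous exp). auto_derive; auto.
  + eapply Ck_cont; eauto.
- apply (Ck_chain n V u exp exp); auto.
  intros. apply is_derive_Reals, derivable_pt_lim_exp.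
Qed.

Lemma Ck_ln n V u : open2 V -> (forall x y, V x y -> 0 < u x y) ->
  Ck a b n V u -> Ck a b n V (fun x y => ln (u x y)).
Proof.
intros Ho H0; destruct n as [|n]; intros Hu.
- split; auto. intros x y Hxy. apply (cont2_comp1 ln).
  + apply (ex_derive_continuous ln). eexists. apply is_derive_Reals, derivable_pt_lim_ln; auto.
  + eapply Ck_cont; eauto.
- apply (Ck_chain n V u ln Rinv); auto.
  + intros. apply is_derive_Reals, derivable_pt_lim_ln; auto.
  + intros. apply Ck_inv; auto. intros x y Hxy. apply Rgt_not_eq, H0, Hxy.
Qed.

Lemma Ck_comp n V V' u (f g f' g' : R -> R) : open2 V ->
  (forall x y, V x y -> V' (f x) (g y)) ->
  (forall x y, V x y -> is_derive f x (f' x)) ->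
  (forall x y, V x y -> is_derive g y (g' y)) ->
  Ck a b n V (fun x _ => f' x) -> Ck a b n V (fun _ y => g' y) ->
  Ck a b n V' u -> Ck a b n V (fun x y => u (f x) (g y)).
Proof.
intros Ho HV Hf Hg Hf' Hg'.
assert (Hcont : forall u, (forall x y, V' x y -> cont2 u x y) ->
  forall x y, V x y -> cont2 (fun x y => u (f x) (g y)) x y).
{ intros w Hw x y Hxy. apply (cont2_comp w (fun x _ => f x) (fun _ y => g y)).
  - apply Hw, HV, Hxy.
  - apply cont2_fst, (ex_derive_continuous f). eexists; apply (Hf x y), Hxy.
  - apply cont2_snd, (ex_derive_continuous g). eexists; apply (Hg x y), Hxy. }
revert u. induction n as [|n IH]; intros u Hu.
- split; auto. apply Hcont, (proj1 Hu).
- apply (Ck_S n V _ (fun x y => f' x * pd1 u (f x) (g y)) (fun x y => g' y * pd2 u (f x) (g y)));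
   auto.
  + apply Hcont, (proj1 Hu).
  + intros Ha; split.
    * intros x y Hxy. apply (is_derive_comp (fun t => u t (g y)) f).
      eapply Ck_d1; eauto. apply (Hf x y), Hxy.
    * apply Ck_mult; auto. apply Ck_pred, Hf'. apply IH; auto using Ck_pred, Ck_S1.
  + intros Ha; split.
    * intros x y Hxy. apply (is_derive_comp (fun t => u (f x) t) g).
      eapply Ck_d2; eauto. apply (Hg x y), Hxy.
    * apply Ck_mult; auto. apply Ck_pred, Hg'. apply IH; auto using Ck_pred, Ck_S2.
Qed.

Lemma Ck_fst_id n V : open2 V -> Ck a b n V (fun x _ => x).
Proof.
intros Ho. destruct n as [|n].
- split; auto. intros; apply continuity_2d_pt_id1.
- apply (Ck_S n V _ (fun _ _ => 1) (fun _ _ => 0)); auto.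
  + intros; apply continuity_2d_pt_id1.
  + intros _; split. intros; apply @is_derive_id. apply Ck_const; auto.
  + intros _; split. intros; apply is_derive_const_R. apply Ck_const; auto.
Qed.

Lemma Ck_pow n V u k : open2 V -> Ck a b n V u -> Ck a b n V (fun x y => u x y ^ k).
Proof.
intros Ho Hu; induction k as [|k IH]; simpl.
- apply Ck_const; auto.
- apply Ck_mult; auto.
Qed.

End Ck.

Lemma Ck_swap a b n V u : Ck a b n V u -> Ck b a n (swap V) (swap u).
Proof.
revert u; induction n as [|n IH]; intros u [Hc H]; split.
1, 3: intros x y Hxy; apply cont2_swap, Hc, Hxy.
exact I.
destruct H as [H1 H2]. split; intros Ha; [destruct (H2 Ha) as [H3 H4] | destruct (H1 Ha) as [H3 H4]];
 (split; [intros x y Hxy; apply H3, Hxy | apply IH in H4; exact H4]).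
Qed.

(** A function of y alone has all derivatives in x, however rough it is in y; this is why regularity
    in the two directions is tracked separately. *)
Lemma Ck_snd n V (f : R -> R) : open2 V -> (forall x y, V x y -> continuous f y) ->
  Ck true false n V (fun _ y => f y).
Proof.
intros Ho Hf. destruct n as [|n].
- split; auto. intros x y Hxy; apply cont2_snd, (Hf x y), Hxy.
- apply (Ck_S true false n V _ (fun _ _ => 0) (fun _ _ => 0)); auto.
  + intros x y Hxy; apply cont2_snd, (Hf x y), Hxy.
  + intros _; split. intros; apply is_derive_const_R. apply Ck_const; auto.
  + discriminate.
Qed.

Ltac Ck_auto :=
  repeat match goal with
    | |- Ck _ _ _ _ (fun x y => @?f x y + @?g x y) => apply (Ck_plus _ _ _ _ f g)
    | |- Ck _ _ _ _ (fun x y => @?f x y - @?g x y) => apply (Ck_minus _ _ _ _ f g)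
    | |- Ck _ _ _ _ (fun x y => @?f x y * @?g x y) => apply (Ck_mult _ _ _ _ f g)
    | |- Ck _ _ _ _ (fun x y => - @?f x y) => apply (Ck_opp _ _ _ _ f)
    | |- Ck _ _ _ _ (fun x y => @?f x y ^ _) => apply (Ck_pow _ _ _ _ f)
    | |- Ck _ _ _ _ (fun _ _ => ?c) => apply Ck_const
    end.

Lemma Ck_Om a b n V (Q P : idx -> R -> R -> R) i : open2 V ->
  (forall j, Ck a b n V (Q j)) -> (forall j, Ck a b n V (P j)) ->
  Ck a b n V (fun x y => Om (fun j => Q j x y) (fun j => P j x y) i).
Proof.
intros Ho HQ HP.
destruct i; unfold Om; Ck_auto; auto.
Qed.

(** * Linear differential equations with a parameter *)

Definition lin1 (m : idx -> idx -> R -> R) (g v : idx -> R -> R) (i : idx) (t : R) : R :=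
  sum4 (fun j => m i j t * v j t) + g i t.

Definition lin (m : idx -> idx -> R -> R -> R) (g v : idx -> R -> R -> R) i x t : R :=
  lin1 (fun i j => m i j x) (fun i => g i x) (fun i => v i x) i t.

Lemma continuous_lin1 m g v i t : (forall i j, continuous (m i j) t) ->
  (forall i, continuous (g i) t) -> (forall i, continuous (v i) t) ->
  continuous (lin1 m g v i) t.
Proof.
intros Hm Hg Hv. unfold lin1. apply (continuous_plus (V:=R_NormedModule)); auto.
apply (continuous_sum4 (fun j t => m i j t * v j t)). intros j.
apply (continuous_mult (K:=R_AbsRing)); auto.
Qed.

Lemma sum4_lip (m : idx -> R) (u v : idx -> R) K d :
  (forall j, Rabs (m j) <= K) -> (forall j, Rabs (u j - v j) <= d) ->
  Rabs (sum4 (fun j => m j * u j) - sum4 (fun j => m j * v j)) <= 4 * K * d.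
Proof.
intros Hm Hd.
assert (H : forall j, - (K * d) <= m j * u j - m j * v j <= K * d).
{ intros j. apply Rabs_le_between. rewrite <- Rmult_minus_distr_l. apply mult_bound; auto. }
unfold sum4. assert (H0 := H I0). assert (H1 := H I1). assert (H2 := H I2).
assert (H3 := H I3). apply Rabs_le. lra.
Qed.

Lemma idx_bounded_1d (f : idx -> R -> R) a b :
  (forall i t, a <= t <= b -> continuous (f i) t) ->
  exists B, 0 <= B /\ forall i t, a <= t <= b -> Rabs (f i t) <= B.
Proof.
intros Hf. apply (idx_bound R (fun t => a <= t <= b) f).
intros i. destruct (bounded_2d (fun t _ => f i t) a b 0 0) as (B & HB & H).
- intros x y Hx _. apply cont2_fst; auto.
- exists B; split; auto. intros t Ht. apply (H t 0); auto; lra.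
Qed.

(** An ordinary differential equation is a Goursat system on the degenerate domain x = 0 in which
    every component is integrated in y. *)
Lemma lin_ode_unique m g (v w : idx -> R -> R) (c : idx -> R) Y :
  0 <= Y ->
  (forall i j t, 0 <= t <= Y -> continuous (m i j) t) ->
  (forall i t, 0 <= t <= Y -> continuous (g i) t) ->
  (forall i t, 0 <= t <= Y -> continuous (v i) t) ->
  (forall i t, 0 <= t <= Y -> continuous (w i) t) ->
  (forall i t, 0 <= t <= Y -> v i t = c i + RInt (lin1 m g v i) 0 t) ->
  (forall i t, 0 <= t <= Y -> w i t = c i + RInt (lin1 m g w i) 0 t) ->
  forall i t, 0 <= t <= Y -> v i t = w i t.
Proof.
intros HY Hm Hg Hv Hw Ev Ew.
destruct (idx_bound (idx * R) (fun p => 0 <= snd p <= Y) (fun i p => m i (fst p) (snd p)))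
  as (K & HK & HKb).
{ intros i. destruct (idx_bounded_1d (m i) 0 Y) as (B & HB & H). intros; apply Hm; auto.
  exists B; split; auto. }
destruct (idx_bounded_1d v 0 Y Hv) as (B1 & HB1 & Hb1).
destruct (idx_bounded_1d w 0 Y Hw) as (B2 & HB2 & Hb2).
pose (D := fun x y : R => x = 0 /\ 0 <= y <= Y).
assert (H : forall i x y, D x y -> v i y = w i y).
{ apply (goursat_unique idx (fun _ => true) D (fun i _ _ => c i)
   (fun i _ y => v i y) (fun i _ y => w i y) (fun i _ y => lin1 m g v i y)
   (fun i _ y => lin1 m g w i y) (4 * K + 1) (B1 + B2)).
  - lra.
  - lra.
  - intros i x y [-> Hy] t Ht. rewrite pos_id in Ht by lra. split; auto; lra.
  - intros i x y [-> Hy]. unfold intd. rewrite pos_id by lra. apply Ev; auto.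
  - intros i x y [-> Hy]. unfold intd. rewrite pos_id by lra. apply Ew; auto.
  - intros i x y [-> Hy]. unfold ex_intd. rewrite pos_id by lra.
    apply ex_RInt_cont; [lra|]. intros t Ht.
    apply continuous_lin1; intros; [apply Hm | apply Hg | apply Hv]; lra.
  - intros i x y [-> Hy]. unfold ex_intd. rewrite pos_id by lra.
    apply ex_RInt_cont; [lra|]. intros t Ht.
    apply continuous_lin1; intros; [apply Hm | apply Hg | apply Hw]; lra.
  - intros d x y Hd [-> Hy] H i. unfold lin1.
    replace (sum4 (fun j => m i j y * v j y) + g i y -
      (sum4 (fun j => m i j y * w j y) + g i y)) with
      (sum4 (fun j => m i j y * v j y) - sum4 (fun j => m i j y * w j y)) by ring.
    eapply Rle_trans. apply (sum4_lip _ _ _ K d); auto. intros j; apply (HKb i (j, y)), Hy. nra.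
  - intros i x y [-> Hy]. eapply Rle_trans. apply Rabs_triang. rewrite Rabs_Ropp.
    specialize (Hb1 i y Hy). specialize (Hb2 i y Hy). lra. }
intros i t Ht. apply (H i 0 t). split; auto.
Qed.

(** A linear right-hand side is globally Lipschitz, so Picard iteration needs no cut-off. Carrying x
    along as a parameter gives a solution jointly continuous in x and t. *)
Lemma lin_ode_exists (m : idx -> idx -> R -> R -> R) (g : idx -> R -> R -> R)
    (w0 : idx -> R -> R) a b Y : a <= b -> 0 <= Y ->
  (forall i j x t, a <= x <= b -> 0 <= t <= Y -> cont2 (m i j) x t) ->
  (forall i x t, a <= x <= b -> 0 <= t <= Y -> cont2 (g i) x t) ->
  (forall i x, a <= x <= b -> continuous (w0 i) x) ->
  exists v : idx -> R -> R -> R, (forall i x t, cont2 (v i) x t) /\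
    forall i x t, a <= x <= b -> 0 <= t <= Y ->
      v i x t = w0 i x + RInt (lin m g v i x) 0 t.
Proof.
intros Hab HY Hm Hg Hw0.
pose (cl := clamp2 a b 0 Y).
assert (Hcl := fun f => clamp2_cont_bound a b 0 Y f Hab HY). fold cl in Hcl.
assert (Hw2 : forall i x y, a <= x <= b -> 0 <= y <= Y -> cont2 (fun x _ => w0 i x) x y).
{ intros; apply cont2_fst; auto. }
destruct (idx_bound (idx * (R * R)) (fun _ => True)
  (fun i p => cl (m i (fst p)) (fst (snd p)) (snd (snd p)))) as (K & HK & HKb).
{ intros i. destruct (idx_bound (R * R) (fun _ => True) (fun j p => cl (m i j) (fst p) (snd p)))
    as (B & HB & H). { intros j. apply (Hcl (m i j)); auto. }
  exists B; split; auto. }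
destruct (idx_bound (R * R) (fun _ => True) (fun i p => cl (g i) (fst p) (snd p)))
  as (G & HG & HGb). { intros i. apply (Hcl (g i)); auto. }
destruct (idx_bound (R * R) (fun _ => True) (fun i p => cl (fun x _ => w0 i x) (fst p) (snd p)))
  as (B & HB & HBb). { intros i. apply (Hcl (fun x _ => w0 i x)); auto. }
assert (HK' : forall i x y j, Rabs (cl (m i j) x y) <= K)
  by (intros i x y j; apply (HKb i (j, (x, y)) I)).
destruct (picard idx (fun _ => true) (fun i => cl (fun x _ => w0 i x))
  (fun i x y u => sum4 (fun j => cl (m i j) x y * u j) + cl (g i) x y)
  (4 * K + 1) (4 * K * B + G)) as (v & Hv & Ev).
- lra.
- assert (0 <= K * B) by (apply Rmult_le_pos; auto). lra.
- intros i x y. apply (Hcl (fun x _ => w0 i x)); auto.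
- intros U HU i x y. apply continuity_2d_pt_plus.
  + apply (cont2_sum4 (fun j x y => cl (m i j) x y * U j x y)). intros j.
    apply continuity_2d_pt_mult; auto. apply Hcl; auto.
  + apply Hcl; auto.
- intros d x y u v Hd Huv i.
  match goal with |- Rabs ?e <= _ => replace e with
   (sum4 (fun j => cl (m i j) x y * u j) - sum4 (fun j => cl (m i j) x y * v j)) by ring end.
  eapply Rle_trans. apply (sum4_lip _ _ _ K d); auto. nra.
- intros i x y. eapply Rle_trans. apply Rabs_triang.
  apply Rplus_le_compat; [| apply (HGb i (x, y) I)].
  replace (sum4 (fun j => cl (m i j) x y * cl (fun x _ => w0 j x) x y)) with
   (sum4 (fun j => cl (m i j) x y * cl (fun x _ => w0 j x) x y) -
    sum4 (fun j => cl (m i j) x y * 0)) by (unfold sum4; ring).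
  apply sum4_lip; auto. intros j; rewrite Rminus_0_r. apply (HBb j (x, y) I).
- exists v. split; auto. intros i x t Hx Ht. rewrite Ev. unfold intd.
  rewrite pos_id by lra. unfold cl at 1. rewrite clamp2_id by assumption. f_equal.
  apply RInt_ext. intros s Hs. rewrite Rmin_left, Rmax_right in Hs by lra.
  unfold lin, lin1, cl. unfold sum4. rewrite !clamp2_id by lra. reflexivity.
Qed.

(* The difference quotient of [f] in the first variable at [x0], extended by the
   derivative at [h = 0]. *)
Definition dq (f : R -> R -> R) (x0 h t : R) : R :=
  if Req_EM_T h 0 then pd1 f x0 t else (f (x0 + h) t - f x0 t) / h.

Lemma dq_eq f x0 h t : h <> 0 -> dq f x0 h t = (f (x0 + h) t - f x0 t) / h.
Proof. intros H; unfold dq; destruct Req_EM_T; tauto. Qed.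

Lemma dq_0 f x0 t : dq f x0 0 t = pd1 f x0 t.
Proof. unfold dq; destruct Req_EM_T; tauto. Qed.

(** At h = 0 the mean value theorem turns a nearby quotient into [pd1 f] at an intermediate point,
    and [pd1 f] is jointly continuous. *)
Lemma cont2_dq V f x0 h t : open2 V -> Ck true false 1 V f ->
  V x0 t -> V (x0 + h) t -> cont2 (dq f x0) h t.
Proof.
intros Ho Hf H0 Hh.
destruct (Req_dec h 0) as [->|Hne].
- intros e. rewrite dq_0.
  destruct (Ck_cont _ _ _ _ _ _ _ (Ck_S1 _ _ _ _ _ eq_refl Hf) H0 e) as [d Hd].
  destruct (Ho x0 t H0) as [d' Hd'].
  assert (Hm : 0 < Rmin d d') by (apply Rmin_pos; apply cond_pos).
  exists (mkposreal _ Hm). simpl. intros k s Hk Hs.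
  rewrite Rminus_0_r in Hk.
  assert (Hk1 := Rlt_le_trans _ _ _ Hk (Rmin_l _ _)).
  assert (Hk2 := Rlt_le_trans _ _ _ Hk (Rmin_r _ _)).
  assert (Hs1 := Rlt_le_trans _ _ _ Hs (Rmin_l _ _)).
  assert (Hs2 := Rlt_le_trans _ _ _ Hs (Rmin_r _ _)).
  unfold dq; destruct Req_EM_T as [|Hk0].
  + apply Hd; auto. rewrite Rminus_eq_0, Rabs_R0; apply cond_pos.
  + assert (Hin : forall c, Rmin x0 (x0 + k) <= c <= Rmax x0 (x0 + k) -> Rabs (c - x0) <= Rabs k).
    { intros c Hc. unfold Rmin, Rmax in Hc. destruct Rle_dec; unfold Rabs;
        repeat destruct Rcase_abs; lra. }
    destruct (MVT_gen (fun u => f u s) x0 (x0 + k) (fun u => pd1 f u s)) as (c & Hc & Ec).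
    * intros c Hc. apply (Ck_d1 true false 0 V f c s); auto.
      apply Hd'; auto. eapply Rle_lt_trans. apply Hin; lra. exact Hk2.
    * intros c Hc. apply continuity_pt_filterlim, (cont2_slice_x f).
      apply (Ck_cont _ _ _ _ _ _ _ Hf). apply Hd'; auto.
      eapply Rle_lt_trans. apply Hin; lra. exact Hk2.
    * cbv beta in Ec. rewrite Ec.
      replace (pd1 f c s * (x0 + k - x0) / k) with (pd1 f c s) by (field; auto).
      apply Hd; auto. eapply Rle_lt_trans. apply Hin, Hc. exact Hk1.
- assert (Hp : 0 < Rabs h) by (apply Rabs_pos_lt, Hne).
  apply (continuity_2d_pt_ext_loc (fun h t => (f (x0 + h) t - f x0 t) * / h)).
  + exists (mkposreal _ Hp). simpl. intros k s Hk _. rewrite dq_eq; auto.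
    intros ->. rewrite Rminus_0_l, Rabs_Ropp in Hk. lra.
  + apply continuity_2d_pt_mult. apply continuity_2d_pt_minus.
    * apply (cont2_comp f (fun h _ => x0 + h) (fun _ t => t)).
      eapply Ck_cont; eauto.
      apply continuity_2d_pt_plus. apply continuity_2d_pt_const. apply continuity_2d_pt_id1.
      apply continuity_2d_pt_id2.
    * apply (cont2_comp f (fun _ _ => x0) (fun _ t => t)).
      eapply Ck_cont; eauto. apply continuity_2d_pt_const. apply continuity_2d_pt_id2.
    * apply (continuity_2d_pt_inv (fun h _ => h)). apply continuity_2d_pt_id1. exact Hne.
Qed.

Definition lin_sol (V : R -> R -> Prop) m g (w0 : idx -> R -> R) w : Prop :=
  (forall i x y, V x y -> cont2 (w i) x y) /\
  forall i x y, V x y -> w i x y = w0 i x + RInt (lin m g w i x) 0 (pospart y).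

(** The inhomogeneous term that appears when the equation for w is differentiated in x. *)
Definition dlin (m : idx -> idx -> R -> R -> R) (g w : idx -> R -> R -> R) i x t : R :=
  sum4 (fun j => pd1 (m i j) x t * w j x t) + pd1 (g i) x t.

Section LinReg.

Variables (V : R -> R -> Prop) (m : idx -> idx -> R -> R -> R)
  (g w : idx -> R -> R -> R) (w0 : idx -> R -> R).
Hypothesis Ho : open2 V.
Hypothesis Hl : low V.
Hypothesis Hm : forall i j, Ck true false 1 V (m i j).
Hypothesis Hg : forall i, Ck true false 1 V (g i).
Hypothesis Hw0 : forall i, Ck true false 1 V (fun x _ => w0 i x).
Hypothesis Hw : lin_sol V m g w0 w.

Let V_pos x y : V x y -> V x (pospart y).
Proof. intros H. apply (Hl x y); auto. apply Rle_refl. Qed.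

Lemma lin_sol_pos i x y : V x y -> w i x y = w i x (pospart y).
Proof.
intros H. rewrite (proj2 Hw i x y H), (proj2 Hw i x _ (V_pos x y H)), pos_pos.
reflexivity.
Qed.

(** For h <> 0 the difference quotient of w solves a linear equation whose coefficients extend
    continuously to h = 0. Solve this family for all small h at once: by uniqueness the solution is
    the quotient when h <> 0, and by continuity in h its value at h = 0 is the derivative. *)
Lemma lin_sol_derive_y x0 y0 : V x0 y0 -> exists z : idx -> R -> R,
  (forall i t, continuous (z i) t) /\
  forall i t, 0 <= t <= pospart y0 ->
    is_derive (fun x => w i x t) x0 (z i t) /\
    z i t = Derive (w0 i) x0 +
      RInt (lin1 (fun i j => m i j x0) (fun i => dlin m g w i x0) z i) 0 t.
Proof.
intros H0.
destruct (open_low_box V x0 y0 Ho Hl H0) as (e & He & Hbox).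
set (Y := pospart y0) in *. assert (HY : 0 <= Y) by apply pos_ge0.
assert (HV : forall h t, - e <= h <= e -> 0 <= t <= Y -> V (x0 + h) t).
{ intros h t Hh Ht. apply Hbox; lra. }
assert (HV0 : forall t, 0 <= t <= Y -> V x0 t).
{ intros t Ht. apply Hbox; lra. }
assert (Hdqc : forall f h t, Ck true false 1 V f -> - e <= h <= e -> 0 <= t <= Y ->
   cont2 (dq f x0) h t).
{ intros f h t Hf Hh Ht. apply (cont2_dq V); auto. }
(* Discrete product rule: the quotient of m w is m at x0 + h times the quotient of w, plus the
   quotient of m times w at x0. *)
pose (m' := fun i j h t => m i j (x0 + h) t).
pose (g' := fun i h t => sum4 (fun j => dq (m i j) x0 h t * w j x0 t) + dq (g i) x0 h t).
pose (c' := fun i h => dq (fun x _ => w0 i x) x0 h 0).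
assert (Hm' : forall i j h t, - e <= h <= e -> 0 <= t <= Y -> cont2 (m' i j) h t).
{ intros i j h t Hh Ht. apply (cont2_comp (m i j) (fun h _ => x0 + h) (fun _ t => t)).
  - eapply Ck_cont. apply Hm. auto.
  - apply continuity_2d_pt_plus. apply continuity_2d_pt_const. apply continuity_2d_pt_id1.
  - apply continuity_2d_pt_id2. }
assert (Hw2 : forall i t, 0 <= t <= Y -> continuous (w i x0) t).
{ intros i t Ht. apply cont2_slice_y, (proj1 Hw); auto. }
assert (Hg' : forall i h t, - e <= h <= e -> 0 <= t <= Y -> cont2 (g' i) h t).
{ intros i h t Hh Ht. apply continuity_2d_pt_plus.
  - apply (cont2_sum4 (fun j h t => dq (m i j) x0 h t * w j x0 t)). intros j.
    apply continuity_2d_pt_mult. apply Hdqc; auto.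
    apply (cont2_snd (w j x0)); auto.
  - apply Hdqc; auto. }
destruct (lin_ode_exists m' g' c' (- e) e Y) as (v & Hv & Ev); auto; try lra.
{ intros i h Hh. apply (cont2_slice_x (dq (fun x _ => w0 i x) x0)). apply Hdqc; auto; lra. }
assert (Hq : forall h, - e <= h <= e -> h <> 0 -> forall i t, 0 <= t <= Y ->
  (w i (x0 + h) t - w i x0 t) / h = v i h t).
{ intros h Hh Hh0.
  assert (Hwh : forall i t, 0 <= t <= Y -> continuous (w i (x0 + h)) t).
  { intros i t Ht. apply cont2_slice_y, (proj1 Hw); auto. }
  assert (Hms : forall i j x t, V x t -> continuous (m i j x) t).
  { intros i j x t HVx. apply cont2_slice_y. eapply Ck_cont. apply Hm. exact HVx. }
  assert (Hgs : forall i x t, V x t -> continuous (g i x) t).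
  { intros i x t HVx. apply cont2_slice_y. eapply Ck_cont. apply Hg. exact HVx. }
  apply (lin_ode_unique (fun i j => m' i j h) (fun i => g' i h)
    (fun i t => (w i (x0 + h) t - w i x0 t) / h) (fun i => v i h) (fun i => c' i h) Y); auto.
  - intros i j t Ht. apply cont2_slice_y, Hm'; auto.
  - intros i t Ht. apply cont2_slice_y, Hg'; auto.
  - intros i t Ht. apply (continuous_mult (K:=R_AbsRing)
      (fun t => w i (x0 + h) t - w i x0 t) (fun _ => / h)).
    apply (continuous_minus (V:=R_NormedModule)); auto. apply continuous_const.
  - intros i t Ht. apply cont2_slice_y, Hv.
  - intros i t Ht.
    rewrite (proj2 Hw i (x0 + h) t), (proj2 Hw i x0 t) by auto.
    rewrite pos_id by lra. unfold c'. rewrite dq_eq by auto.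
    assert (Hi1 : ex_RInt (lin m g w i (x0 + h)) 0 t).
    { apply ex_RInt_cont. lra. intros s Hs. apply continuous_lin1; intros;
      [apply Hms, HV | apply Hgs, HV | apply Hwh]; lra. }
    assert (Hi2 : ex_RInt (lin m g w i x0) 0 t).
    { apply ex_RInt_cont. lra. intros s Hs. apply continuous_lin1; intros;
      [apply Hms, HV0 | apply Hgs, HV0 | apply Hw2]; lra. }
    transitivity ((w0 i (x0 + h) - w0 i x0) / h +
      / h * (RInt (lin m g w i (x0 + h)) 0 t - RInt (lin m g w i x0) 0 t)).
    field; auto. f_equal.
    replace (RInt (lin m g w i (x0 + h)) 0 t - RInt (lin m g w i x0) 0 t)
      with (RInt (fun s => lin m g w i (x0 + h) s - lin m g w i x0 s) 0 t).
    2: apply (RInt_minus (V:=R_CompleteNormedModule)); auto.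
    rewrite <- (RInt_scal (V:=R_CompleteNormedModule)
      (fun s => lin m g w i (x0 + h) s - lin m g w i x0 s)).
    2: apply (ex_RInt_minus (V:=R_NormedModule)); auto.
    apply RInt_ext. intros s Hs.
    unfold lin1, lin, g', m', sum4, scal; simpl; unfold mult; simpl.
    rewrite !dq_eq by auto. unfold lin1, sum4. field; auto. }
exists (fun i => v i 0). split.
- intros i t. apply cont2_slice_y, Hv.
- intros i t Ht. split.
  + apply is_derive_Reals. intros eps Heps.
    destruct (Hv i 0 t (mkposreal _ Heps)) as [d Hd]. simpl in Hd.
    assert (Hmn : 0 < Rmin d e) by (apply Rmin_pos; auto; apply cond_pos).
    exists (mkposreal _ Hmn). simpl. intros h Hh0 Hh.
    assert (Hh2 := Rlt_le_trans _ _ _ Hh (Rmin_r _ _)).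
    apply Rabs_def2 in Hh2.
    rewrite Hq; auto; try lra. apply Hd.
    rewrite Rminus_0_r. apply (Rlt_le_trans _ _ _ Hh (Rmin_l _ _)).
    rewrite Rminus_eq_0, Rabs_R0; apply cond_pos.
  + rewrite (Ev i 0 t) by lra. unfold c'. rewrite dq_0. f_equal.
    apply RInt_ext. intros s Hs. unfold lin, lin1, m', g', dlin, sum4.
    rewrite !dq_0, !Rplus_0_r. reflexivity.
Qed.

Lemma lin_sol_derive :
  (forall i x y, V x y -> is_derive (fun x => w i x y) x (pd1 (w i) x y)) /\
  lin_sol V m (dlin m g w) (fun i => Derive (w0 i)) (fun i => pd1 (w i)).
Proof.
assert (Hd : forall i x y, V x y -> is_derive (fun x => w i x y) x (pd1 (w i) x (pospart y))).
{ intros i x y HV. destruct (lin_sol_derive_y x y HV) as (z & _ & Hz).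
  assert (Hy := pos_ge0 y).
  destruct (Hz i (pospart y)) as [Hz1 _]. lra.
  apply (is_derive_ext_loc (fun x => w i x (pospart y))).
  - apply (filter_imp (fun t => V t y)). intros; symmetry; apply lin_sol_pos; auto.
    apply open2_x; auto.
  - assert (E : pd1 (w i) x (pospart y) = z i (pospart y)) by exact (is_derive_unique _ _ _ Hz1).
    rewrite E. exact Hz1. }
assert (Hp : forall i x y, V x y -> pd1 (w i) x y = pd1 (w i) x (pospart y)).
{ intros i x y HV. apply is_derive_unique, Hd, HV. }
split. { intros i x y HV. rewrite Hp; auto. }
assert (Hz : forall x0 y0, V x0 y0 -> exists z : idx -> R -> R,
  (forall i t, continuous (z i) t) /\ forall i t, 0 <= t <= pospart y0 ->
    pd1 (w i) x0 t = z i t /\ z i t = Derive (w0 i) x0 +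
      RInt (lin1 (fun i j => m i j x0) (fun i => dlin m g w i x0) z i) 0 t).
{ intros x0 y0 HV. destruct (lin_sol_derive_y x0 y0 HV) as (z & Hzc & Hz).
  exists z; split; auto. intros i t Ht. destruct (Hz i t Ht). split; auto.
  apply is_derive_unique; auto. }
assert (Hgc : forall i x y, V x y -> cont2 (dlin m g w i) x y).
{ intros i x y HV. apply continuity_2d_pt_plus.
  - apply (cont2_sum4 (fun j x t => pd1 (m i j) x t * w j x t)). intros j.
    apply continuity_2d_pt_mult. 2: apply (proj1 Hw), HV.
    eapply Ck_cont. apply Ck_S1; auto. exact HV.
  - eapply Ck_cont. apply (Ck_S1 true false); auto. exact HV. }
split.
(* The functions z were found for each x separately. Joint continuity comes from solving the
   differentiated equation on a box and identifying the result with z by uniqueness for each fixed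
   x. *)
- intros i x0 y0 H0.
  destruct (open_low_box V x0 y0 Ho Hl H0) as (e & He & Hbox).
  set (Y := pospart y0 + e). assert (HY0 := pos_ge0 y0).
  assert (HY : 0 <= Y) by (unfold Y; lra).
  destruct (lin_ode_exists m (dlin m g w) (fun i => Derive (w0 i)) (x0 - e) (x0 + e) Y)
    as (v & Hv & Ev); auto; try lra.
  { intros k j x t Hx Ht. eapply Ck_cont. apply Hm. apply Hbox; auto; unfold Y in Ht; lra. }
  { intros k x t Hx Ht. apply Hgc. apply Hbox; auto; unfold Y in Ht; lra. }
  { intros k x Hx.
    apply (cont2_slice_x (pd1 (fun x _ => w0 k x)) x 0).
    eapply Ck_cont. apply (Ck_S1 true false); auto. apply Hbox; auto; lra. }
  apply (continuity_2d_pt_ext_loc (fun x y => v i x (pospart y))).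
  + exists (mkposreal _ He). simpl. intros x y Hx Hy.
    apply Rabs_lt_between' in Hx. apply Rabs_lt_between' in Hy.
    assert (Hyy := pos_ge y0).
    assert (HV : V x y) by (apply Hbox; lra).
    assert (HV' : V x Y) by (apply Hbox; unfold Y; lra).
    rewrite Hp by auto.
    destruct (Hz x Y HV') as (z & Hzc & Hzz). rewrite (pos_id Y HY) in Hzz.
    assert (Hy' : 0 <= pospart y <= Y).
    { split. apply pos_ge0. rewrite <- (pos_id Y HY). apply pos_le. unfold Y; lra. }
    rewrite (proj1 (Hzz i _ Hy')).
    apply (lin_ode_unique (fun i j => m i j x) (fun i => dlin m g w i x)
      (fun i => v i x) z (fun i => Derive (w0 i) x) Y); auto.
    * intros k j t Ht. apply cont2_slice_y. eapply Ck_cont. apply Hm.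
      apply Hbox; auto; unfold Y in Ht; lra.
    * intros k t Ht. apply cont2_slice_y, Hgc. apply Hbox; auto; unfold Y in Ht; lra.
    * intros k t Ht. apply cont2_slice_y, Hv.
    * intros k t Ht. apply Ev; lra.
    * intros k t Ht. apply Hzz; auto.
  + apply (cont2_comp (v i) (fun x _ => x) (fun _ y => pospart y)). apply Hv.
    apply continuity_2d_pt_id1. apply cont2_snd, continuous_pos.
- intros i x y HV. rewrite Hp by auto.
  destruct (Hz x y HV) as (z & Hzc & Hzz). assert (Hy := pos_ge0 y).
  destruct (Hzz i (pospart y)) as [E1 E2]. lra.
  rewrite E1, E2. f_equal. apply RInt_ext. intros t Ht.
  rewrite Rmin_left, Rmax_right in Ht by lra.
  unfold lin, lin1, sum4. rewrite !(fun j => proj1 (Hzz j t ltac:(lra))). reflexivity.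
Qed.

End LinReg.

Lemma lin_sol_regular V n m g w w0 : open2 V -> low V ->
  (forall i j, Ck true false n V (m i j)) -> (forall i, Ck true false n V (g i)) ->
  (forall i, Ck true false n V (fun x _ => w0 i x)) ->
  lin_sol V m g w0 w -> forall i, Ck true false n V (w i).
Proof.
intros Ho Hl. revert g w w0. induction n as [|n IH]; intros g w w0 Hm Hg Hw0 Hw i.
- split; auto. intros; apply (proj1 Hw); auto.
- assert (Hle : (1 <= S n)%nat) by lia.
  destruct (lin_sol_derive V m g w w0) as [Hd Hs]; auto;
    try (intros; eapply Ck_le; eauto).
  assert (Hwn : forall i, Ck true false n V (w i)).
  { apply (IH g w w0); auto; intros; apply Ck_pred; auto. }
  apply (Ck_S true false n V (w i) (pd1 (w i)) (fun _ _ => 0)); auto.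
  + intros; apply (proj1 Hw); auto.
  + intros _; split; auto.
    apply (IH (dlin m g w) (fun i => pd1 (w i)) (fun i => Derive (w0 i))); auto.
    * intros; apply Ck_pred; auto.
    * intros k. unfold dlin, sum4.
      Ck_auto; auto; first [apply Hwn | apply (Ck_S1 true false); auto].
    * intros k. exact (Ck_S1 true false n V (fun x _ => w0 k x) eq_refl (Hw0 k)).
  + discriminate.
Qed.

(** * Regularity for the frame system *)

Lemma Ck_weaken n V u : Ck true true n V u -> Ck true false n V u.
Proof.
revert u; induction n as [|n IH]; intros u [Hc H]; split; auto.
destruct H as [H1 _]. split. 2: discriminate.
intros _. destruct (H1 eq_refl) as [H2 H3]; split; auto.
Qed.

Lemma open2_ball V x y : open2 V -> V x y ->
  exists e, 0 < e /\ forall x' y', Rabs (x' - x) <= e -> Rabs (y' - y) <= e -> V x' y'.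
Proof.
intros Ho H. destruct (Ho x y H) as [e He]. exists (e / 2).
pose proof (cond_pos e). split. lra. intros; apply He; lra.
Qed.

(** No y-derivative of [pd1 u] is assumed. Write u(x', y') as u(x', y) plus the integral of G(x',
    .), differentiate under the integral in x', then apply the fundamental theorem in y'. *)
Lemma derive_swap V (u G : R -> R -> R) : open2 V -> Ck true false 1 V u ->
  (forall x y, V x y -> is_derive (fun t => u x t) y (G x y)) ->
  Ck true false 1 V G ->
  forall x y, V x y -> is_derive (fun t => pd1 u x t) y (pd1 G x y).
Proof.
intros Ho Hu Hd HG x y Hxy.
destruct (open2_ball V x y Ho Hxy) as (e & He & HV).
assert (HV' : forall x' y' t, Rabs (x' - x) <= e -> Rabs (y' - y) <= e ->
  Rmin y y' <= t <= Rmax y y' -> V x' t).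
{ intros x' y' t Hx Hy Ht. apply HV; auto.
  apply Rabs_le_between' in Hy. apply Rabs_le_between'.
  unfold Rmin, Rmax in Ht. destruct Rle_dec; lra. }
assert (Hi : forall x' y', Rabs (x' - x) <= e -> Rabs (y' - y) <= e ->
  is_RInt (G x') y y' (u x' y' - u x' y)).
{ intros x' y' Hx Hy. apply (is_RInt_derive (u x') (G x')).
  - intros t Ht. apply Hd. eapply HV'; eauto.
  - intros t Ht. apply cont2_slice_y. eapply Ck_cont. exact HG. eapply HV'; eauto. }
assert (Hgc : forall t, Rabs (t - y) <= e -> continuous (pd1 G x) t).
{ intros t Ht. apply cont2_slice_y. apply (Ck_cont true false 0 V (pd1 G)).
  apply (Ck_S1 true false); auto.
  apply HV; auto. rewrite Rminus_eq_0, Rabs_R0; lra. }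
assert (Hpd : forall y', Rabs (y' - y) <= e ->
  pd1 u x y' = pd1 u x y + RInt (pd1 G x) y y').
{ intros y' Hy. apply is_derive_unique.
  apply (is_derive_ext_loc (fun x' => u x' y + RInt (G x') y y')).
  - exists (mkposreal e He). intros x' Hx. change (Rabs (x' - x) < e) in Hx.
    rewrite (is_RInt_unique _ _ _ _ (Hi x' y' (Rlt_le _ _ Hx) Hy)). apply Rplus_minus.
  - apply is_derive_plus_R.
    + apply (Ck_d1 true false 0 V u); auto.
    + apply (is_derive_RInt_param (fun x' t => G x' t)).
      * exists (mkposreal e He). intros x' Hx t Ht. change (Rabs (x' - x) < e) in Hx.
        eexists. apply (Ck_d1 true false 0 V G); auto. apply (HV' x' y' t); auto; lra.
      * intros t Ht. apply (Ck_cont true false 0 V (pd1 G)).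
        apply (Ck_S1 true false); auto. apply (HV' x y' t); auto.
        rewrite Rminus_eq_0, Rabs_R0; lra.
      * exists (mkposreal e He). intros x' Hx. change (Rabs (x' - x) < e) in Hx.
        eexists. apply Hi; auto; lra. }
apply (is_derive_ext_loc (fun y' => pd1 u x y + RInt (pd1 G x) y y')).
- exists (mkposreal e He). intros y' Hy. symmetry. apply Hpd.
  change (Rabs (y' - y) < e) in Hy. lra.
- apply (is_derive_eq _ _ (0 + pd1 G x y)). 2: ring.
  apply is_derive_plus_R. apply is_derive_const_R.
  apply (is_derive_RInt (pd1 G x) (RInt (pd1 G x) y) y).
  + exists (mkposreal e He). intros y' Hy. change (Rabs (y' - y) < e) in Hy.
    apply (RInt_correct (V:=R_CompleteNormedModule)).
    apply (ex_RInt_continuous (V:=R_CompleteNormedModule)).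
    intros t Ht. apply Hgc. apply Rabs_lt_between' in Hy. apply Rabs_le_between'.
    unfold Rmin, Rmax in Ht. destruct Rle_dec; lra.
  + apply Hgc. rewrite Rminus_eq_0, Rabs_R0; lra.
Qed.

(** Only pure x-derivatives of u are known, but u_y = G is known in both directions. Since (u_x)_y =
    G_x, the same situation recurs for u_x one order lower. *)
Lemma Ck_mixed V n (u G : R -> R -> R) : open2 V -> Ck true false (S n) V u ->
  (forall x y, V x y -> is_derive (fun t => u x t) y (G x y)) ->
  Ck true true n V G -> Ck true true (S n) V u.
Proof.
intros Ho; revert u G; induction n as [|n IH]; intros u G Hu Hd HG.
- apply (Ck_S true true 0 V u (pd1 u) G); auto.
  + intros; eapply Ck_cont; eauto.
  + intros _; split.
    * intros x y Hxy. eapply Ck_d1; eauto.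
    * split; auto. intros x y Hxy. apply (Ck_cont true false 0 V (pd1 u)); auto.
      apply (Ck_S1 true false); auto.
- apply (Ck_S true true (S n) V u (pd1 u) G); auto.
  + intros; eapply Ck_cont; eauto.
  + intros _; split.
    * intros x y Hxy. eapply Ck_d1; eauto.
    * apply (IH (pd1 u) (pd1 G)); auto.
      -- apply (Ck_S1 true false); auto.
      -- apply derive_swap; auto. apply (Ck_le _ _ 1 (S (S n))); auto; lia.
         apply Ck_weaken. apply (Ck_le _ _ 1 (S n)); auto; lia.
      -- apply Ck_S1; auto.
Qed.

Definition OmM (q : idx -> R) (i j : idx) : R :=
  match i, j with
  | I0, I1 => - 2 * q I1 | I0, I2 => - q I2 | I0, I3 => - q I3
  | I1, I0 => 2 * q I1   | I1, I2 => q I3   | I1, I3 => - q I2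
  | I2, I0 => q I2       | I2, I1 => - q I3 | I2, I3 => - q I1
  | I3, I0 => q I3       | I3, I1 => q I2   | I3, I2 => q I1
  | _, _ => 0
  end.

Lemma Om_OmM q p i : Om q p i = sum4 (fun j => OmM q i j * p j).
Proof. destruct i; unfold Om, sum4; simpl; ring. Qed.

Definition idx_eqb (i j : idx) : bool :=
  match i, j with I0, I0 | I1, I1 | I2, I2 | I3, I3 => true | _, _ => false end.

Definition halfx (W : R -> R -> Prop) (x y : R) : Prop := 0 < x /\ W x y.
Definition halfy (W : R -> R -> Prop) (x y : R) : Prop := 0 < y /\ W x y.
Definition quadrant (W : R -> R -> Prop) (x y : R) : Prop := 0 < x /\ 0 < y /\ W x y.

Lemma open2_halfx W : open2 W -> open2 (halfx W).
Proof.
intros Ho x y [Hx H]. destruct (Ho x y H) as [e He].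
assert (Hm : 0 < Rmin x e) by (apply Rmin_pos; auto; apply cond_pos).
exists (mkposreal _ Hm). simpl. intros u v Hu Hv.
assert (H1 := Rmin_l x e). assert (H2 := Rmin_r x e). split.
- apply Rabs_lt_between' in Hu. lra.
- apply He; lra.
Qed.

Lemma open2_halfy W : open2 W -> open2 (halfy W).
Proof. intros Ho. apply (open2_swap (halfx (swap W))), open2_halfx, open2_swap, Ho. Qed.

Lemma open2_quadrant W : open2 W -> open2 (quadrant W).
Proof. intros Ho. apply (open2_halfx (halfy W)), open2_halfy, Ho. Qed.

Lemma low_halfx W : low W -> low (halfx W).
Proof. intros Hl x y t [Hx H] Ht. split; auto. apply (Hl x y); auto. Qed.

Section Goursat.

Variables (W : R -> R -> Prop) (c1 c2 : R -> R -> R) (p0 q0 : idx -> R -> R)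
  (P Q : idx -> R -> R -> R).
Hypothesis Ho : open2 W.
Hypothesis Hl : low W.
Hypothesis Hl' : low (swap W).
Hypothesis Hc1 : forall x y, W x y -> cont2 c1 x y.
Hypothesis Hc2 : forall x y, W x y -> cont2 c2 x y.
Hypothesis HP : forall i x y, W x y -> cont2 (P i) x y.
Hypothesis HQ : forall i x y, W x y -> cont2 (Q i) x y.
Hypothesis HS : gsol W c1 c2 p0 q0 P Q.

Lemma gsol_derive_y i x y : W x y -> 0 < y ->
  is_derive (fun t => P i x t) y (gP c1 c2 P Q i x y).
Proof.
intros HW Hy. destruct (open_low_box W x y Ho Hl HW) as (e & He & Hb).
rewrite pos_id in Hb by lra.
apply (is_derive_ext_loc (fun y => p0 i x + RInt (gP c1 c2 P Q i x) 0 (pospart y))).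
- apply (filter_imp (fun t => W x t)). intros t Ht. symmetry. apply (HS i x t Ht).
  apply open2_y; auto.
- apply (is_derive_eq _ _ (0 + gP c1 c2 P Q i x y)). 2: ring.
  apply is_derive_plus_R. apply is_derive_const_R.
  apply (is_derive_intd_y (gP c1 c2 P Q i x) y e); auto.
  intros u Hu. assert (Hxu : W x u) by (apply Hb; lra).
  apply cont2_slice_y, cont2_gP; auto.
Qed.

Lemma gsol_derive_x i x y : W x y -> 0 < x ->
  is_derive (fun t => Q i t y) x (gQ c1 c2 P Q i x y).
Proof.
intros HW Hx.
destruct (open_low_box (swap W) y x (open2_swap W Ho) Hl' HW) as (e & He & Hb).
rewrite pos_id in Hb by lra.
apply (is_derive_ext_loc (fun x => q0 i y + RInt (fun t => gQ c1 c2 P Q i t y) 0 (pospart x))).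
- apply (filter_imp (fun t => W t y)). intros t Ht. symmetry. apply (HS i t y Ht).
  apply open2_x; auto.
- apply (is_derive_eq _ _ (0 + gQ c1 c2 P Q i x y)). 2: ring.
  apply is_derive_plus_R. apply is_derive_const_R.
  apply (is_derive_intd_y (fun t => gQ c1 c2 P Q i t y) x e); auto.
  intros u Hu. assert (Hxu : W u y) by (apply (Hb y u); lra).
  apply (cont2_slice_x (gQ c1 c2 P Q i)), cont2_gQ; auto.
Qed.

Lemma Ck_gP a b k V i : open2 V -> Ck a b k V c1 -> Ck a b k V c2 ->
  (forall j, Ck a b k V (P j)) -> (forall j, Ck a b k V (Q j)) ->
  Ck a b k V (gP c1 c2 P Q i).
Proof.
intros HV H1 H2 H3 H4. unfold gP. Ck_auto; auto. apply Ck_Om; auto.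
Qed.

Lemma Ck_gQ a b k V i : open2 V -> Ck a b k V c1 -> Ck a b k V c2 ->
  (forall j, Ck a b k V (P j)) -> (forall j, Ck a b k V (Q j)) ->
  Ck a b k V (gQ c1 c2 P Q i).
Proof.
intros HV H1 H2 H3 H4. unfold gQ. Ck_auto; auto. apply Ck_Om; auto.
Qed.

(** Orders in x are gained alternately: Q_x is given by the equation, so Q is one order ahead of P;
    and P solves a linear equation in y whose matrix and source involve only Q and the coefficients,
    so it catches up by [lin_sol_regular]. *)
Lemma gsol_regular_x n :
  Ck true false n (halfx W) c1 -> Ck true false n (halfx W) c2 ->
  (forall i, Ck true false n (halfx W) (fun x _ => p0 i x)) ->
  forall k, (k <= n)%nat -> (forall i, Ck true false k (halfx W) (P i)) /\
    (forall i, Ck true false k (halfx W) (Q i)).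
Proof.
intros Kc1 Kc2 Kp0. assert (HV := open2_halfx W Ho).
induction k as [|k IH]; intros Hk.
- split; intros i; (split; [intros x y [_ Hxy]; auto | exact I]).
- destruct IH as [IP IQ]. lia.
  assert (IQ' : forall i, Ck true false (S k) (halfx W) (Q i)).
  { intros i. apply (Ck_S true false k _ (Q i) (gQ c1 c2 P Q i) (fun _ _ => 0)); auto.
    - intros x y [_ Hxy]; auto.
    - intros _. split. intros x y [Hx Hxy]. apply gsol_derive_x; auto.
      apply Ck_gQ; auto; apply (Ck_le _ _ k n); auto; lia.
    - discriminate. }
  split; auto.
  apply (lin_sol_regular (halfx W) (S k)
    (fun i j x y => OmM (fun l => Q l x y) i j + (if idx_eqb i j then c1 x y else 0))
    (fun i x y => c2 x y * Q i x y) P p0); auto.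
  + apply low_halfx, Hl.
  + assert (Kc1' : Ck true false (S k) (halfx W) c1) by (apply (Ck_le _ _ _ n); auto; lia).
    intros i j. apply Ck_plus; auto.
    * destruct i, j; unfold OmM; Ck_auto; auto; exact (IQ' _).
    * destruct i, j; unfold idx_eqb; auto; apply Ck_const; auto.
  + intros i. apply Ck_mult; auto. apply (Ck_le _ _ _ n); auto; lia.
  + intros i. apply (Ck_le _ _ _ n); auto; lia.
  + split. intros i x y [_ Hxy]; auto.
    intros i x y [_ Hxy]. rewrite (proj1 (HS i x y Hxy)) at 1. f_equal.
    apply RInt_ext. intros t _. unfold gP, lin, lin1. rewrite Om_OmM.
    unfold sum4. destruct i; simpl; ring.
Qed.

(** P_y equals [gP], of class k in both directions by induction; with the x-regularity of P,
    [Ck_mixed] gives order k + 1. For Q the same is done after exchanging the variables. *)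
Lemma gsol_regular n :
  Ck true true n (quadrant W) c1 -> Ck true true n (quadrant W) c2 ->
  (forall i, Ck true false n (halfx W) (P i)) ->
  (forall i, Ck false true n (halfy W) (Q i)) ->
  forall k, (k <= n)%nat -> (forall i, Ck true true k (quadrant W) (P i)) /\
    (forall i, Ck true true k (quadrant W) (Q i)).
Proof.
intros Kc1 Kc2 KP KQ. assert (HV := open2_quadrant W Ho).
induction k as [|k IH]; intros Hk.
- split; intros i; (split; [intros x y (_ & _ & Hxy); auto | exact I]).
- destruct IH as [IP IQ]. lia.
  assert (Hk1 : Ck true true k (quadrant W) c1) by (apply (Ck_le _ _ k n); auto; lia).
  assert (Hk2 : Ck true true k (quadrant W) c2) by (apply (Ck_le _ _ k n); auto; lia).
  split; intros i.
  + apply (Ck_mixed (quadrant W) k (P i) (gP c1 c2 P Q i)); auto.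
    * apply (Ck_le _ _ (S k) n); auto.
      apply (Ck_mono _ _ _ (halfx W)); auto. intros x y (Hx & Hy & H); split; auto.
    * intros x y (Hx & Hy & H). apply gsol_derive_y; auto.
    * apply Ck_gP; auto.
  + assert (HV' := open2_swap _ HV).
    apply (Ck_swap true true (S k) (swap (quadrant W)) (swap (Q i))).
    apply (Ck_mixed (swap (quadrant W)) k (swap (Q i)) (swap (gQ c1 c2 P Q i))); auto.
    * apply (Ck_le _ _ (S k) n); auto.
      apply (Ck_swap false true n (quadrant W)).
      apply (Ck_mono _ _ _ (halfy W)); auto. intros x y (Hx & Hy & H); split; auto.
    * intros x y (Hx & Hy & H). apply gsol_derive_x; auto.
    * apply (Ck_swap true true). apply Ck_gQ; auto.
Qed.

End Goursat.

Lemma gsol_swap W c1 c2 p0 q0 P Q : gsol W c1 c2 p0 q0 P Q ->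
  gsol (swap W) (swap c2) (swap c1) q0 p0 (fun i => swap (Q i)) (fun i => swap (P i)).
Proof.
intros HS i x y Hxy. destruct (HS i y x Hxy) as [H1 H2]. unfold swap in *. split.
- rewrite H2. f_equal. apply RInt_ext. intros t _. unfold gP, gQ.
  match goal with |- ?a = ?b => change (@eq R a b) end. ring.
- rewrite H1. f_equal. apply RInt_ext. intros t _. unfold gP, gQ.
  match goal with |- ?a = ?b => change (@eq R a b) end. ring.
Qed.

(** * Recovering E and H *)

Lemma is_derive_minus_R (f g : R -> R) x l m : is_derive f x l -> is_derive g x m ->
  is_derive (fun t => f t - g t) x (l - m).
Proof. intros; apply (is_derive_minus (V:=R_NormedModule)); assumption. Qed.

Lemma is_derive_sqr_R (f : R -> R) x l : is_derive f x l ->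
  is_derive (fun t => f t ^ 2) x (2 * f x * l).
Proof.
intros H. apply (is_derive_ext (fun t => f t * f t)). intros; simpl; ring.
apply (is_derive_eq _ _ (l * f x + f x * l)). apply is_derive_mult_R; auto. ring.
Qed.

Ltac der :=
  repeat match goal with
    | |- is_derive (fun t => @?f t + @?g t) _ _ => apply (is_derive_plus_R f g)
    | |- is_derive (fun t => @?f t - @?g t) _ _ => apply (is_derive_minus_R f g)
    | |- is_derive (fun t => @?f t * @?g t) _ _ => apply (is_derive_mult_R f g)
    | |- is_derive (fun t => @?f t ^ 2) _ _ => apply (is_derive_sqr_R f)
    | |- is_derive (fun _ => ?c) _ _ => apply is_derive_const_R
    end.

Definition prim (u0 : R -> R) (k : R -> R -> R) (x y : R) : R :=
  u0 x + RInt (k x) 0 (pospart y).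

Lemma prim_pos u0 k x y : prim u0 k x y = prim u0 k x (pospart y).
Proof. unfold prim. rewrite pos_pos. reflexivity. Qed.

Lemma prim_0 u0 k x : prim u0 k x 0 = u0 x.
Proof.
unfold prim. rewrite pos_id, RInt_point by lra. apply Rplus_0_r.
Qed.

Section Prim.

Variables (W : R -> R -> Prop) (u0 : R -> R) (k : R -> R -> R).
Hypothesis Ho : open2 W.
Hypothesis Hl : low W.
Hypothesis Hk : forall x y, W x y -> cont2 k x y.

Lemma low_0 x y : W x y -> W x 0.
Proof. intros H; apply (Hl x y); auto. apply pos_ge0. Qed.

Lemma prim_cont : (forall x, W x 0 -> continuous u0 x) ->
  forall x y, W x y -> cont2 (prim u0 k) x y.
Proof.
intros Hu x y H. apply continuity_2d_pt_plus.
- apply cont2_fst, Hu. apply (low_0 x y H).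
- apply (cont2_RInt W); auto.
Qed.

Lemma prim_dy x y : W x y -> 0 < y -> is_derive (fun t => prim u0 k x t) y (k x y).
Proof.
intros HW Hy. destruct (open_low_box W x y Ho Hl HW) as (e & He & Hb).
rewrite pos_id in Hb by lra.
apply (is_derive_eq _ _ (0 + k x y)). 2: ring.
apply is_derive_plus_R. apply is_derive_const_R.
apply (is_derive_intd_y (k x) y e); auto.
intros u Hu. apply cont2_slice_y, Hk, Hb; lra.
Qed.

(* Differentiation under the integral sign, the integral of [k1] being known to
   be an increment of [v]. *)
Lemma prim_dx (k1 v : R -> R -> R) :
  (forall x y, halfx W x y -> is_derive (fun t => k t y) x (k1 x y)) ->
  (forall x y, halfx W x y -> cont2 k1 x y) ->
  (forall x y, halfx W x y -> cont2 v x y) ->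
  (forall x, 0 < x -> W x 0 -> is_derive u0 x (v x 0)) ->
  (forall x y, quadrant W x y -> is_derive (fun t => v x t) y (k1 x y)) ->
  forall x y, halfx W x y -> is_derive (fun t => prim u0 k t y) x (v x (pospart y)).
Proof.
intros Hk1 Hk1c Hv Hu Hvd x y [Hx HW].
assert (HV := open2_halfx W Ho).
destruct (open_low_box (halfx W) x y HV (low_halfx W Hl) (conj Hx HW)) as (e & He & Hb).
unfold prim. assert (HY := pos_ge0 y). set (Y := pospart y) in *.
assert (HD : forall u t, Rabs (u - x) <= e -> t <= Y + e ->
  halfx W u t).
{ intros u t Hu' Ht. apply Hb; auto. apply Rabs_le_between' in Hu'; lra. }
assert (Hxx : Rabs (x - x) <= e) by (rewrite Rminus_eq_0, Rabs_R0; lra).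
(* Both k_x and v_y equal k1, so the integral produced by differentiating under the sign is the
   increment of v. *)
assert (Hval : v x Y = v x 0 + RInt (fun t => Derive (fun u => k u t) x) 0 Y).
{ rewrite (ftc_open (v x) (k1 x) Y); try lra.
  - f_equal. apply RInt_ext. intros t Ht. rewrite Rmin_left, Rmax_right in Ht by lra.
    symmetry. apply is_derive_unique, Hk1, HD; auto; lra.
  - intros t Ht. apply cont2_slice_y, Hv, HD; auto; lra.
  - intros t Ht. apply cont2_slice_y, Hk1c, HD; auto; lra.
  - intros t Ht. apply Hvd. destruct (HD x t Hxx) as [_ HWt]. lra. repeat split; auto; lra. }
rewrite Hval. apply is_derive_plus_R.
- apply Hu; auto. apply (low_0 x y HW).
- apply (is_derive_RInt_param (fun u t => k u t)).
  + exists (mkposreal e He). intros u Hu' t Ht. change (Rabs (u - x) < e) in Hu'.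
    rewrite Rmin_left, Rmax_right in Ht by lra.
    eexists. apply Hk1, HD; lra.
  + intros t Ht. rewrite Rmin_left, Rmax_right in Ht by lra.
    assert (Hxt : halfx W x t) by (apply HD; auto; lra).
    apply (cont2_ext_open (halfx W) k1); auto.
    intros u t' Hut. symmetry. apply is_derive_unique, Hk1, Hut.
  + exists (mkposreal e He). intros u Hu'. change (Rabs (u - x) < e) in Hu'.
    apply ex_RInt_cont. lra. intros t Ht. apply cont2_slice_y, Hk.
    destruct (HD u t); auto; lra.
Qed.

End Prim.

(* With A, h the components of [p]: E_x = 2 s^2 A + 2 s conj(H) h, H_x = s h,
   for the components (Re E, Im E, Re H, Im H). *)
Definition FU (s g1 g2 : R) (p : idx -> R) (i : idx) : R :=
  match i with
  | I0 => 2 * s ^ 2 * p I0 + 2 * s * (g1 * p I2 + g2 * p I3)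
  | I1 => 2 * s ^ 2 * p I1 + 2 * s * (g1 * p I3 - g2 * p I2)
  | i => s * p i
  end.

Definition dFU (s g1 g2 : R) (p : idx -> R) (s' g1' g2' : R) (p' : idx -> R) (i : idx) : R :=
  match i with
  | I0 => 4 * s * s' * p I0 + 2 * s ^ 2 * p' I0 + 2 * s' * (g1 * p I2 + g2 * p I3)
      + 2 * s * (g1' * p I2 + g1 * p' I2 + g2' * p I3 + g2 * p' I3)
  | I1 => 4 * s * s' * p I1 + 2 * s ^ 2 * p' I1 + 2 * s' * (g1 * p I3 - g2 * p I2)
      + 2 * s * (g1' * p I3 + g1 * p' I3 - g2' * p I2 - g2 * p' I2)
  | i => s' * p i + s * p' i
  end.

Lemma is_derive_FU (s g1 g2 : R -> R) (p : idx -> R -> R) x s' g1' g2' p' i :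
  is_derive s x s' -> is_derive g1 x g1' -> is_derive g2 x g2' ->
  (forall j, is_derive (p j) x (p' j)) ->
  is_derive (fun t => FU (s t) (g1 t) (g2 t) (fun j => p j t) i) x
    (dFU (s x) (g1 x) (g2 x) (fun j => p j x) s' g1' g2' p' i).
Proof.
intros Hs H1 H2 Hp. unfold FU.
destruct i; (eapply is_derive_eq;
  [ der; first [exact Hs | exact H1 | exact H2 | exact (Hp _)] | unfold dFU; ring ]).
Qed.

(* The two candidates for the mixed derivative agree. *)
Lemma dFU_sym s g1 g2 (p q p' q' : idx -> R) i :
  (forall j, p' j - Om q p j = q' j - Om p q j) ->
  dFU s g1 g2 p (s * q I0) (s * q I2) (s * q I3) p' i =
  dFU s g1 g2 q (s * p I0) (s * p I2) (s * p I3) q' i.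
Proof.
intros H.
assert (Hj : forall j, p' j = q' j + Om q p j - Om p q j) by (intros j; specialize (H j); lra).
destruct i; unfold dFU; rewrite !Hj; unfold Om; ring.
Qed.

Lemma cont2_FU_gen (s g1 g2 : R -> R -> R) (p : idx -> R -> R -> R) i x y :
  cont2 s x y -> cont2 g1 x y -> cont2 g2 x y -> (forall j, cont2 (p j) x y) ->
  cont2 (fun x y => FU (s x y) (g1 x y) (g2 x y) (fun j => p j x y) i) x y.
Proof.
intros Hs H1 H2 Hp. destruct i; unfold FU; simpl pow; cont2_auto; auto.
Qed.

Definition fof (u : idx -> R -> R) (x : R) : R := u I0 x - u I2 x ^ 2 - u I3 x ^ 2.

(* Data (Re E, Im E, Re H, Im H) on an axis, with their frame components [p]. *)
Record axis_data (D : R -> Prop) (u p : idx -> R -> R) : Prop := {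
  ax_u : forall i x, D x -> continuous (u i) x;
  ax_p : forall i x, D x -> continuous (p i) x;
  ax_f : forall x, D x -> 0 < fof u x;
  ax_d : forall i x, D x -> 0 < x -> is_derive (u i) x
    (FU (sqrt (fof u x)) (u I2 x) (u I3 x) (fun j => p j x) i);
  ax_0 : forall i, u i 0 = match i with I0 => 1 | _ => 0 end
}.

Arguments ax_u {D u p}.
Arguments ax_p {D u p}.
Arguments ax_f {D u p}.
Arguments ax_d {D u p}.
Arguments ax_0 {D u p}.

Lemma exp_half_ln f : 0 < f -> exp (ln f / 2) = sqrt f.
Proof.
intros Hf. apply Rsqr_inj. left; apply exp_pos. apply sqrt_pos.
rewrite Rsqr_sqrt by lra. unfold Rsqr. rewrite <- exp_plus.
replace (ln f / 2 + ln f / 2) with (ln f) by field. apply exp_ln, Hf.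
Qed.

Section Axis.

Variables (D : R -> Prop) (u p : idx -> R -> R) (x : R).
Hypothesis Hax : axis_data D u p.
Hypothesis HD : D x.

(** The H-terms of E_x cancel those of |H|^2, leaving f_x = 2 f Re A. Hence ln f is recoverable from
    the single component I0. *)
Lemma axis_ln : 0 < x -> is_derive (fun t => ln (fof u t)) x (2 * p I0 x).
Proof.
intros Hx. assert (Hf := ax_f Hax x HD).
assert (He := ax_d Hax I0 x HD Hx). assert (Hg1 := ax_d Hax I2 x HD Hx).
assert (Hg2 := ax_d Hax I3 x HD Hx).
assert (Hs : sqrt (fof u x) ^ 2 = fof u x) by (apply pow2_sqrt; lra).
assert (Hd : is_derive (fof u) x (2 * fof u x * p I0 x)).
{ unfold fof at 1. eapply is_derive_eq. der; first [exact He | exact Hg1 | exact Hg2].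
  unfold FU. transitivity (2 * sqrt (fof u x) ^ 2 * p I0 x). ring. rewrite Hs. reflexivity. }
apply (is_derive_eq _ _ (2 * fof u x * p I0 x * / fof u x)). 2: field; lra.
apply (is_derive_comp ln (fof u)); auto.
apply is_derive_Reals, derivable_pt_lim_ln, Hf.
Qed.

Lemma axis_f_cont : continuous (fof u) x.
Proof.
apply (cont2_slice_x (fun x _ => fof u x) x 0). unfold fof; simpl pow.
cont2_auto; apply (cont2_fst (u _)), (ax_u Hax), HD.
Qed.

Lemma axis_ln_cont : continuous (fun t => ln (fof u t)) x.
Proof.
apply (continuous_comp (fof u) ln). apply axis_f_cont.
apply (ex_derive_continuous ln). eexists.
apply is_derive_Reals, derivable_pt_lim_ln, (ax_f Hax), HD.
Qed.

Lemma axis_sqrt_cont : continuous (fun t => sqrt (fof u t)) x.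
Proof.
apply (continuous_comp (fof u) sqrt). apply axis_f_cont.
apply continuity_pt_filterlim, continuity_pt_sqrt. left; apply (ax_f Hax), HD.
Qed.

End Axis.

Section Recover.

Variables (W : R -> R -> Prop) (c1 c2 : R -> R -> R) (p0 q0 : idx -> R -> R)
  (P Q : idx -> R -> R -> R) (u u' : idx -> R -> R).
Hypothesis Ho : open2 W.
Hypothesis Hl : low W.
Hypothesis Hl' : low (swap W).
Hypothesis Hc1 : forall x y, W x y -> cont2 c1 x y.
Hypothesis Hc2 : forall x y, W x y -> cont2 c2 x y.
Hypothesis HP : forall i x y, W x y -> cont2 (P i) x y.
Hypothesis HQ : forall i x y, W x y -> cont2 (Q i) x y.
Hypothesis HS : gsol W c1 c2 p0 q0 P Q.
Hypothesis Hx : axis_data (fun x => W x 0) u p0.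
Hypothesis Hy : axis_data (fun y => W 0 y) u' q0.

(** The recovery is triangular: [rL] is ln f, [rs] is sqrt f, [rG] gives H (only at I2 and I3), [rU]
    all four unknowns. Passing through the logarithm makes f positive by construction. *)
Definition rL : R -> R -> R := prim (fun x => ln (fof u x)) (fun x t => 2 * Q I0 x t).
Definition rs (x y : R) : R := exp (rL x y / 2).
Definition rG (i : idx) : R -> R -> R := prim (u i) (fun x t => rs x t * Q i x t).
Definition rF (Z : idx -> R -> R -> R) (i : idx) (x t : R) : R :=
  FU (rs x t) (rG I2 x t) (rG I3 x t) (fun j => Z j x t) i.
Definition rU (i : idx) : R -> R -> R := prim (u i) (rF Q i).

Lemma cont2_rL x y : W x y -> cont2 rL x y.
Proof.
apply prim_cont; auto.
- intros; cont2_auto; auto.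
- intros t Ht; apply (axis_ln_cont _ _ _ _ Hx Ht).
Qed.

Lemma cont2_rs x y : W x y -> cont2 rs x y.
Proof.
intros H. apply (cont2_comp1 exp (fun x y => rL x y / 2)).
- apply (ex_derive_continuous exp). auto_derive; auto.
- unfold Rdiv. cont2_auto. apply cont2_rL, H.
Qed.

Lemma cont2_rG i x y : W x y -> cont2 (rG i) x y.
Proof.
apply prim_cont; auto.
- intros; cont2_auto; auto using cont2_rs.
- intros t Ht; apply (ax_u Hx), Ht.
Qed.

Lemma cont2_rF Z i x y : W x y -> (forall j, cont2 (Z j) x y) -> cont2 (rF Z i) x y.
Proof.
intros H HZ. apply (cont2_FU_gen rs (rG I2) (rG I3) Z); auto using cont2_rs, cont2_rG.
Qed.

Lemma cont2_rU i x y : W x y -> cont2 (rU i) x y.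
Proof.
apply prim_cont; auto.
- intros; apply cont2_rF; auto.
- intros t Ht; apply (ax_u Hx), Ht.
Qed.

Lemma rs_axis x : W x 0 -> rs x 0 = sqrt (fof u x).
Proof. intros H. unfold rs, rL. rewrite prim_0. apply exp_half_ln, (ax_f Hx), H. Qed.

Lemma is_derive_exp_half (f : R -> R) x l : is_derive f x (2 * l) ->
  is_derive (fun t => exp (f t / 2)) x (exp (f x / 2) * l).
Proof.
intros H. apply (is_derive_eq _ _ ((2 * l) * / 2 * exp (f x / 2))). 2: field.
apply (is_derive_comp exp (fun t => f t / 2)).
apply is_derive_Reals, derivable_pt_lim_exp.
apply (is_derive_eq _ _ (2 * l * / 2 + f x * 0)). 2: field.
apply (is_derive_mult_R f (fun _ => / 2)); auto. apply is_derive_const_R.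
Qed.

Lemma rs_dy x y : W x y -> 0 < y -> is_derive (fun t => rs x t) y (rs x y * Q I0 x y).
Proof.
intros H H0. apply (is_derive_exp_half (fun t => rL x t)).
apply (prim_dy W (fun x => ln (fof u x)) (fun x t => 2 * Q I0 x t)); auto.
intros; cont2_auto; auto.
Qed.

Lemma rG_dy i x y : W x y -> 0 < y -> is_derive (fun t => rG i x t) y (rs x y * Q i x y).
Proof.
intros H H0. apply (prim_dy W (u i) (fun x t => rs x t * Q i x t)); auto.
intros; cont2_auto; auto using cont2_rs.
Qed.

Lemma rU_dy i x y : W x y -> 0 < y -> is_derive (fun t => rU i x t) y (rF Q i x y).
Proof.
intros H H0. apply (prim_dy W (u i) (rF Q i)); auto. intros; apply cont2_rF; auto.
Qed.

Lemma P_pos i x y : W x y -> P i x (pospart y) = P i x y.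
Proof.
intros H. assert (H' : W x (pospart y)) by (apply (Hl x y); auto; lra).
rewrite (proj1 (HS i x y H)), (proj1 (HS i x _ H')), pos_pos. reflexivity.
Qed.

Lemma P_axis i x : W x 0 -> P i x 0 = p0 i x.
Proof.
intros H. rewrite (proj1 (HS i x 0 H)), pos_id, RInt_point by lra. apply Rplus_0_r.
Qed.

Lemma rs_pos x y : rs x (pospart y) = rs x y.
Proof. unfold rs, rL. rewrite <- prim_pos. reflexivity. Qed.

Lemma rG_pos i x y : rG i x (pospart y) = rG i x y.
Proof. unfold rG. rewrite <- prim_pos. reflexivity. Qed.

Let Qx i x y : halfx W x y -> is_derive (fun t => Q i t y) x (gQ c1 c2 P Q i x y).
Proof. intros [H H']. apply (gsol_derive_x W c1 c2 p0 q0 P Q); auto. Qed.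

Let Py i x y : quadrant W x y -> is_derive (fun t => P i x t) y (gP c1 c2 P Q i x y).
Proof. intros (H1 & H2 & H3). apply (gsol_derive_y W c1 c2 p0 q0 P Q); auto. Qed.

Let gQc i x y : W x y -> cont2 (gQ c1 c2 P Q i) x y.
Proof. intros H; apply cont2_gQ; auto. Qed.

(** The component I0 of [Om] is symmetric in its two arguments, so the x-derivative of Q I0 equals
    the y-derivative of P I0. *)
Lemma rs_dx x y : halfx W x y -> is_derive (fun t => rs t y) x (rs x y * P I0 x y).
Proof.
intros H. apply (is_derive_exp_half (fun t => rL t y)).
rewrite <- (P_pos I0 x y (proj2 H)).
apply (prim_dx W (fun x => ln (fof u x)) (fun x t => 2 * Q I0 x t)
  Ho Hl) with (k1 := fun x y => 2 * gQ c1 c2 P Q I0 x y) (v := fun x y => 2 * P I0 x y); auto.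
- intros; cont2_auto; auto.
- intros v t Hv. eapply is_derive_eq.
  apply (is_derive_mult_R (fun _ => 2) (fun v => Q I0 v t)). apply is_derive_const_R.
  apply Qx, Hv. ring.
- intros v t [Hv Ht]. cont2_auto. apply gQc, Ht.
- intros v t [Hv Ht]. cont2_auto; auto.
- intros v Hv Hv0. rewrite P_axis by auto. apply (axis_ln _ _ _ _ Hx Hv0 Hv).
- intros v t Hv. eapply is_derive_eq.
  apply (is_derive_mult_R (fun _ => 2) (P I0 v)). apply is_derive_const_R.
  apply Py, Hv. unfold gP, gQ, Om; ring.
Qed.

(** Closedness for H: the antisymmetric part of [Om] at I2 and I3 is exactly compensated by the
    derivatives s P I0 and s Q I0 of the factor s. *)
Lemma rG_dx i x y : i = I2 \/ i = I3 -> halfx W x y ->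
  is_derive (fun t => rG i t y) x (rs x y * P i x y).
Proof.
intros Hi H. rewrite <- (P_pos i x y (proj2 H)), <- rs_pos.
apply (prim_dx W (u i) (fun x t => rs x t * Q i x t) Ho Hl) with
  (k1 := fun x y => rs x y * P I0 x y * Q i x y + rs x y * gQ c1 c2 P Q i x y)
  (v := fun x y => rs x y * P i x y); auto.
- intros; cont2_auto; auto using cont2_rs.
- intros v t Hv. apply (is_derive_mult_R (fun v => rs v t) (fun v => Q i v t)); auto.
  apply rs_dx; auto.
- intros v t [Hv Ht]. cont2_auto; auto using cont2_rs.
- intros v t [Hv Ht]. cont2_auto; auto using cont2_rs.
- intros v Hv Hv0. rewrite P_axis, rs_axis by auto.
  destruct Hi as [-> | ->]; [apply (ax_d Hx I2) | apply (ax_d Hx I3)]; assumption.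
- intros v t Hv. eapply is_derive_eq.
  apply (is_derive_mult_R (rs v) (P i v)). apply rs_dy; apply Hv.
  apply Py, Hv. destruct Hi as [-> | ->]; unfold gP, gQ, Om; ring.
Qed.

Lemma rF_dx i x y : halfx W x y -> is_derive (fun t => rF Q i t y) x
  (dFU (rs x y) (rG I2 x y) (rG I3 x y) (fun j => Q j x y) (rs x y * P I0 x y)
    (rs x y * P I2 x y) (rs x y * P I3 x y) (fun j => gQ c1 c2 P Q j x y) i).
Proof.
intros H. apply (is_derive_FU (fun t => rs t y) (fun t => rG I2 t y) (fun t => rG I3 t y)
  (fun j t => Q j t y)); auto using rs_dx, rG_dx.
Qed.

Lemma rF_dy i x y : quadrant W x y -> is_derive (fun t => rF P i x t) y
  (dFU (rs x y) (rG I2 x y) (rG I3 x y) (fun j => P j x y) (rs x y * Q I0 x y)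
    (rs x y * Q I2 x y) (rs x y * Q I3 x y) (fun j => gP c1 c2 P Q j x y) i).
Proof.
intros H. assert (H' := H). destruct H' as (H1 & H2 & H3).
apply (is_derive_FU (rs x) (rG I2 x) (rG I3 x) (fun j => P j x)); intros;
  first [apply Py; exact H | apply rs_dy; assumption | apply rG_dy; assumption].
Qed.

(** Closedness for E: [dFU_sym] identifies the x-derivative of [rF Q] with the y-derivative of
    [rF P]. *)
Lemma rU_dx i x y : halfx W x y -> is_derive (fun t => rU i t y) x (rF P i x y).
Proof.
intros H. assert (HW := proj2 H).
replace (rF P i x y) with (rF P i x (pospart y)).
2: { unfold rF. rewrite rs_pos, !rG_pos. destruct i; unfold FU; rewrite !P_pos by exact HW;
     reflexivity. }
apply (prim_dx W (u i) (rF Q i) Ho Hl) with (k1 := fun x y =>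
    dFU (rs x y) (rG I2 x y) (rG I3 x y) (fun j => Q j x y) (rs x y * P I0 x y)
    (rs x y * P I2 x y) (rs x y * P I3 x y) (fun j => gQ c1 c2 P Q j x y) i) (v := rF P i);
  auto using rF_dx.
- intros; apply cont2_rF; auto.
- intros v t [Hv Ht]. assert (Cs := cont2_rs v t Ht).
  assert (CG := fun j => cont2_rG j v t Ht). assert (CP := fun j => HP j v t Ht).
  assert (CQ := fun j => HQ j v t Ht). assert (Cg := fun j => gQc j v t Ht).
  destruct i; unfold dFU; simpl pow; cont2_auto;
    first [exact Cs | exact (CG _) | exact (CP _) | exact (CQ _) | exact (Cg _)].
- intros v t [Hv Ht]. apply cont2_rF; auto.
- intros v Hv Hv0.
  replace (rF P i v 0) with (FU (sqrt (fof u v)) (u I2 v) (u I3 v) (fun j => p0 j v) i).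
  apply (ax_d Hx); auto.
  unfold rF, rG. rewrite rs_axis, !prim_0 by exact Hv0.
  destruct i; unfold FU; rewrite !P_axis by exact Hv0; reflexivity.
- intros v t Hv. eapply is_derive_eq. apply rF_dy, Hv.
  apply (dFU_sym _ _ _ (fun j => P j v t) (fun j => Q j v t)). intros j; unfold gP, gQ; ring.
Qed.

(** The f used in the recovery is Re E - |H|^2 of the result: the difference vanishes on y = 0 and
    has zero y-derivative. Positivity follows, [rs] being an exponential. *)
Lemma rU_rs x y : W x y -> rU I0 x y - rU I2 x y ^ 2 - rU I3 x y ^ 2 = rs x y ^ 2.
Proof.
intros H. assert (HY := pos_ge0 y).
assert (HW : forall t, 0 <= t <= pospart y -> W x t).
{ intros t Ht. apply (Hl x y); auto; lra. }
assert (HW0 : W x 0) by (apply HW; lra).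
pose (D := fun t => rU I0 x t - rU I2 x t ^ 2 - rU I3 x t ^ 2 - rs x t ^ 2).
assert (HD : D (pospart y) = D 0 + RInt (fun _ => 0) 0 (pospart y)).
{ apply (ftc_open D (fun _ => 0)); auto.
  - intros t Ht. assert (HWt := HW t Ht). apply (cont2_slice_y (fun x t =>
      rU I0 x t - rU I2 x t ^ 2 - rU I3 x t ^ 2 - rs x t ^ 2)). simpl pow.
    assert (Cs := cont2_rs x t HWt). assert (CU := fun i => cont2_rU i x t HWt).
    cont2_auto; first [exact Cs | exact (CU _)].
  - intros; apply continuous_const.
  - intros t [Ht0 Ht]. assert (HWt : W x t) by (apply HW; lra). unfold D.
    assert (Ds := rs_dy x t HWt Ht0). assert (DU := fun i => rU_dy i x t HWt Ht0).
    eapply is_derive_eq. der; first [exact Ds | exact (DU _)].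
    unfold rF, FU. change (rU I2 x t) with (rG I2 x t). change (rU I3 x t) with (rG I3 x t).
    ring. }
assert (Hz : RInt (fun _ => 0) 0 (pospart y) = 0).
{ rewrite RInt_const. apply Rmult_0_r. }
assert (HU0 : forall i, rU i x 0 = u i x) by (intros; apply prim_0).
assert (HUp : forall i, rU i x (pospart y) = rU i x y) by (intros; symmetry; apply prim_pos).
rewrite Hz in HD. unfold D in HD.
rewrite rs_axis, pow2_sqrt, !HU0, !HUp, rs_pos in HD; auto.
unfold fof in HD. lra. left; apply (ax_f Hx), HW0.
Qed.

Section AxisY.

Variable y : R.
Hypothesis Hy0 : 0 <= y.
Hypothesis HWy : W 0 y.

Let HWt t : 0 <= t <= y -> W 0 t.
Proof. intros Ht. apply (Hl 0 y); auto. rewrite pos_id; lra. Qed.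

Let Q_axis i t : 0 <= t <= y -> Q i 0 t = q0 i t.
Proof.
intros Ht. rewrite (proj2 (HS i 0 t (HWt t Ht))), (pos_id 0), RInt_point by lra.
apply Rplus_0_r.
Qed.

Let prim_axis (e d : R -> R) (k : R -> R -> R) (v : R -> R) t : 0 <= t <= y ->
  (forall t, 0 <= t <= y -> continuous e t) -> (forall t, 0 <= t <= y -> continuous d t) ->
  (forall t, 0 <= t <= y -> 0 < t -> is_derive e t (d t)) ->
  (forall t, 0 <= t <= y -> k 0 t = d t) -> v 0 = e 0 -> prim v k 0 t = e t.
Proof.
intros Ht He Hd Hed Hk Hv. unfold prim. rewrite pos_id, Hv by lra.
rewrite (ftc_open e d t); try lra.
- f_equal. apply RInt_ext. intros r Hr. rewrite Rmin_left, Rmax_right in Hr by lra.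
  apply Hk; lra.
- intros; apply He; lra.
- intros; apply Hd; lra.
- intros; apply Hed; lra.
Qed.

Let ax_same i : u i 0 = u' i 0.
Proof. rewrite (ax_0 Hx), (ax_0 Hy). reflexivity. Qed.

Let rs_axis_y t : 0 <= t <= y -> rs 0 t = sqrt (fof u' t).
Proof.
intros Ht. unfold rs. rewrite <- exp_half_ln by (apply (ax_f Hy), HWt, Ht).
f_equal. f_equal.
apply (prim_axis (fun t => ln (fof u' t)) (fun t => 2 * q0 I0 t)); auto.
- intros r Hr. apply (axis_ln_cont _ _ _ _ Hy (HWt r Hr)).
- intros r Hr. apply (continuous_mult (K:=R_AbsRing)). apply continuous_const.
  apply (ax_p Hy), HWt, Hr.
- intros r Hr. apply (axis_ln _ _ _ _ Hy (HWt r Hr)).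
- intros r Hr. rewrite Q_axis; auto.
- unfold fof. rewrite !ax_same. reflexivity.
Qed.

Let FU_axis_cont i t : 0 <= t <= y ->
  continuous (fun t => FU (sqrt (fof u' t)) (u' I2 t) (u' I3 t) (fun j => q0 j t) i) t.
Proof.
intros Ht. assert (H := HWt t Ht). apply (cont2_slice_x (fun t _ =>
  FU (sqrt (fof u' t)) (u' I2 t) (u' I3 t) (fun j => q0 j t) i) t 0).
apply (cont2_FU_gen (fun t _ => sqrt (fof u' t)) (fun t _ => u' I2 t) (fun t _ => u' I3 t)
  (fun j t _ => q0 j t)); intros; apply cont2_fst.
- apply (axis_sqrt_cont _ _ _ _ Hy H).
- apply (ax_u Hy), H.
- apply (ax_u Hy), H.
- apply (ax_p Hy), H.
Qed.

Let rG_axis_y i t : i = I2 \/ i = I3 -> 0 <= t <= y -> rG i 0 t = u' i t.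
Proof.
intros Hi Ht.
apply (prim_axis (u' i) (fun t => FU (sqrt (fof u' t)) (u' I2 t) (u' I3 t)
  (fun j => q0 j t) i)); auto.
- intros r Hr. apply (ax_u Hy), HWt, Hr.
- intros r Hr H0. apply (ax_d Hy); auto.
- intros r Hr. rewrite rs_axis_y, Q_axis by auto. destruct Hi as [-> | ->]; reflexivity.
Qed.

(** On x = 0 the recovery integrals run along the axis, where Q is the data q0, so they reproduce ln
    f, H and E in turn. Both sets of data start from E = 1, H = 0 at the corner. *)
Lemma rU_axis_y i : rU i 0 y = u' i y.
Proof.
apply (prim_axis (u' i) (fun t => FU (sqrt (fof u' t)) (u' I2 t) (u' I3 t)
  (fun j => q0 j t) i)); auto.
- lra.
- intros r Hr. apply (ax_u Hy), HWt, Hr.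
- intros r Hr H0. apply (ax_d Hy); auto.
- intros r Hr. unfold rF. rewrite rs_axis_y, !rG_axis_y by auto.
  destruct i; unfold FU; rewrite !Q_axis by auto; reflexivity.
Qed.

End AxisY.

(** Both first derivatives of [rU] are expressions in P, Q and earlier recovered functions of class
    n, whence the gain of one order. *)
Lemma rU_regular n :
  (forall i, Ck true true n (quadrant W) (P i)) ->
  (forall i, Ck true true n (quadrant W) (Q i)) ->
  forall i, Ck true true (S n) (quadrant W) (rU i).
Proof.
intros KP KQ. assert (HV := open2_quadrant W Ho).
assert (Hq : forall x y, quadrant W x y -> halfx W x y /\ W x y /\ 0 < y).
{ intros x y (H1 & H2 & H3); repeat split; auto. }
assert (Ks : Ck true true n (quadrant W) rs).
{ revert KP KQ. induction n as [|k IH]; intros KP KQ.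
  - split; auto. intros x y H; apply cont2_rs, Hq, H.
  - assert (Ks := IH (fun i => Ck_pred _ _ _ _ _ (KP i)) (fun i => Ck_pred _ _ _ _ _ (KQ i))).
    apply (Ck_S true true k _ rs (fun x y => rs x y * P I0 x y)
      (fun x y => rs x y * Q I0 x y)); auto.
    + intros x y H; apply cont2_rs, Hq, H.
    + intros _. split. intros; apply rs_dx, Hq; auto. Ck_auto; auto using Ck_pred.
    + intros _. split. intros x y H; apply rs_dy; apply (Hq x y H).
      Ck_auto; auto using Ck_pred. }
assert (KG : forall i, i = I2 \/ i = I3 -> Ck true true n (quadrant W) (rG i)).
{ intros i Hi. apply Ck_pred.
  apply (Ck_S true true n _ (rG i) (fun x y => rs x y * P i x y)
    (fun x y => rs x y * Q i x y)); auto.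
  - intros x y H; apply cont2_rG, Hq, H.
  - intros _. split. intros x y H; apply rG_dx; auto; apply Hq, H. Ck_auto; auto.
  - intros _. split. intros x y H; apply rG_dy; apply (Hq x y H). Ck_auto; auto. }
assert (KF : forall Z, (forall i, Ck true true n (quadrant W) (Z i)) ->
  forall i, Ck true true n (quadrant W) (rF Z i)).
{ intros Z KZ i. unfold rF. assert (G2 := KG I2 (or_introl eq_refl)).
  assert (G3 := KG I3 (or_intror eq_refl)). destruct i; unfold FU; Ck_auto; auto. }
intros i. apply (Ck_S true true n _ (rU i) (rF P i) (rF Q i)); auto.
- intros x y H; apply cont2_rU, Hq, H.
- intros _. split; auto. intros x y H; apply rU_dx, Hq, H.
- intros _. split; auto. intros x y H; apply rU_dy; apply (Hq x y H).
Qed.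

End Recover.

(** * The coefficients and the boundary data *)

Lemma RCdiff_comp (u : R -> C) x : RCdiff u x ->
  ex_derive (fun t => Re (u t)) x /\ ex_derive (fun t => Im (u t)) x.
Proof.
intros [l Hl]. split.
- exists (fst l).
  apply (filterdiff_comp (U := R_NormedModule) (V := C_R_NormedModule) (W := R_NormedModule)
    u fst (fun y => scal y l) fst); auto.
  apply (filterdiff_linear (U := C_R_NormedModule)), is_linear_fst.
- exists (snd l).
  apply (filterdiff_comp (U := R_NormedModule) (V := C_R_NormedModule) (W := R_NormedModule)
    u snd (fun y => scal y l) snd); auto.
  apply (filterdiff_linear (U := C_R_NormedModule)), is_linear_snd.
Qed.

Lemma RCdiff_pair (u v : R -> R) x : ex_derive u x -> ex_derive v x ->
  RCdiff (fun t => (u t, v t)) x.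
Proof.
intros [l Hl] [m Hm]. exists (l, m).
apply (filterdiff_comp'_2 (T := R_NormedModule) (U := R_NormedModule) (V := R_NormedModule)
  (W := C_R_NormedModule) u v (fun a b => (a, b)) x (fun y => scal y l) (fun y => scal y m)
  (fun a b => (a, b)) Hl Hm).
apply (filterdiff_ext_lin _ (fun t : R * R => t)). 2: intros []; reflexivity.
apply (filterdiff_ext (fun t : R * R => t)). intros []; reflexivity.
apply (filterdiff_id (V := prod_NormedModule R_AbsRing R_NormedModule R_NormedModule)).
Qed.

Lemma continuous_pair (T : UniformSpace) (u v : T -> R) x :
  continuous u x -> continuous v x ->
  @continuous T C_UniformSpace (fun t => (u t, v t)) x.
Proof.
intros Hu Hv.
apply (filterlim_filter_le_2 (F := locally x) (G := filter_prod (locally (u x)) (locally (v x)))).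
- intros P [e He]. exists (fun a => ball (u x) e a) (fun b => ball (v x) e b).
  + apply locally_ball.
  + apply locally_ball.
  + intros a b Ha Hb. apply He. split; auto.
- apply filterlim_pair; auto.
Qed.

Lemma continuous_Re_Im (z : C) :
  @continuous C_UniformSpace R_UniformSpace Re z /\
  @continuous C_UniformSpace R_UniformSpace Im z.
Proof. split; intros P [e He]; exists e; intros y [H1 H2]; apply He; assumption. Qed.

Lemma cont_on1_comp (I : R -> Prop) (u : R -> C) (f : R -> R) x :
  cont_on1 I u -> continuous f x -> locally x (fun t => I (f t)) ->
  continuous (fun t => Re (u (f t))) x /\ continuous (fun t => Im (u (f t))) x.
Proof.
intros Hu Hf HI.
assert (H : @filterlim R C (fun t => u (f t)) (locally x) (@locally C_UniformSpace (u (f x)))).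
{ apply (filterlim_comp _ _ _ f u (locally x) (within I (locally (f x)))).
  - intros P HP. unfold within in HP. apply Hf in HP. unfold filtermap in *.
    apply (filter_imp (fun t => (I (f t) -> P (f t)) /\ I (f t))). tauto.
    apply filter_and; assumption.
  - apply Hu. apply (locally_singleton x (fun t => I (f t))), HI. }
split; (eapply filterlim_comp; [exact H | apply continuous_Re_Im]).
Qed.

(** One-variable data are read as functions of (x, y) independent of y, so that the calculus of [Ck]
    covers them. *)
Definition strip (x y : R) : Prop := 0 < x < 1.

Lemma open2_strip : open2 strip.
Proof.
intros x y Hx. unfold strip in Hx.
assert (Hm : 0 < Rmin x (1 - x)) by (apply Rmin_pos; lra).
exists (mkposreal _ Hm). simpl. intros u v Hu _.
assert (H1 := Rmin_l x (1 - x)). assert (H2 := Rmin_r x (1 - x)).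
apply Rabs_lt_between' in Hu. unfold strip; lra.
Qed.

Lemma Cn1_cont n u (pr : C -> R) : pr = Re \/ pr = Im -> Cn1 n (Ioo 1) u ->
  forall x, 0 < x < 1 -> continuous (fun t => pr (u t)) x.
Proof.
intros Hpr Hu x Hx.
destruct (cont_on1_comp (Ioo 1) u (fun t => t) x) as [H1 H2].
- destruct n; apply Hu.
- apply continuous_id.
- apply (open2_x strip x 0 open2_strip Hx).
- destruct Hpr as [-> | ->]; assumption.
Qed.

Lemma Cn1_Ck n u (pr : C -> R) : pr = Re \/ pr = Im -> Cn1 n (Ioo 1) u ->
  Ck true false n strip (fun x _ => pr (u x)).
Proof.
intros Hpr. revert u; induction n as [|n IH]; intros u Hu.
- split; [|exact I]. intros x y Hx. apply (cont2_fst (fun x => pr (u x))).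
  apply (Cn1_cont 0 u pr Hpr Hu x Hx).
- apply (Ck_S true false n strip _ (fun x _ => pr (RCderive u x)) (fun _ _ => 0)).
  + apply open2_strip.
  + intros x y Hx. apply (cont2_fst (fun x => pr (u x))), (Cn1_cont _ _ pr Hpr Hu x Hx).
  + intros _; split; [|apply IH, Hu]. intros x y Hx.
    destruct (RCdiff_comp u x (proj1 (proj2 Hu) x Hx)) as [H1 H2].
    apply Derive_correct in H1, H2. destruct Hpr as [-> | ->]; assumption.
  + discriminate.
Qed.

(** * Domain and coefficients in the variables X, Y *)

Section Coef.

Variable m : nat.
Hypothesis Hm : (2 <= m)%nat.

Definition Wm (x y : R) : Prop := pospart x ^ m + pospart y ^ m < 1.
(** P and Q absorb dx/dX and dy/dY. So in P_Y and Q_X the factor 1 / (2 (1 - x - y)) is multiplied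
    by dy/dY in front of P and by dx/dX in front of Q. *)
Definition cf1 (x y : R) : R :=
  INR m * pospart y ^ (m - 1) * / (2 * (1 - pospart x ^ m - pospart y ^ m)).
Definition cf2 (x y : R) : R :=
  INR m * pospart x ^ (m - 1) * / (2 * (1 - pospart x ^ m - pospart y ^ m)).

Lemma continuous_pos_pow k x : continuous (fun t => pospart t ^ k) x.
Proof.
apply (continuous_comp pospart (fun t => t ^ k)). apply continuous_pos.
apply (ex_derive_continuous (fun t => t ^ k)). auto_derive; auto.
Qed.

Lemma cont2_pow_x k x y : cont2 (fun x _ => pospart x ^ k) x y.
Proof. apply (cont2_fst (fun t => pospart t ^ k)), continuous_pos_pow. Qed.

Lemma cont2_pow_y k x y : cont2 (fun _ y => pospart y ^ k) x y.
Proof. apply (cont2_snd (fun t => pospart t ^ k)), continuous_pos_pow. Qed.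

Lemma open2_Wm : open2 Wm.
Proof.
intros x y H. unfold Wm in H.
assert (He : 0 < 1 - (pospart x ^ m + pospart y ^ m)) by lra.
assert (Hc : cont2 (fun x y => pospart x ^ m + pospart y ^ m) x y).
{ apply continuity_2d_pt_plus. apply cont2_pow_x. apply cont2_pow_y. }
destruct (Hc (mkposreal _ He)) as [d Hd]. exists d. intros u v Hu Hv.
specialize (Hd u v Hu Hv). simpl in Hd. apply Rabs_def2 in Hd. unfold Wm. lra.
Qed.

Lemma low_Wm : low Wm.
Proof.
intros x y t H Ht. unfold Wm in *.
assert (H1 : pospart t ^ m <= pospart y ^ m).
{ apply pow_incr. split. apply pos_ge0. rewrite <- (pos_pos y). apply pos_le, Ht. }
lra.
Qed.

Lemma Wm_swap x y : swap Wm x y <-> Wm x y.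
Proof. unfold swap, Wm. lra. Qed.

Lemma low_swap_Wm : low (swap Wm).
Proof. intros x y t H Ht. apply Wm_swap in H. apply Wm_swap. apply (low_Wm x y); auto. Qed.

Lemma cont2_cf1 x y : Wm x y -> cont2 cf1 x y.
Proof.
intros H. unfold Wm in H. unfold cf1. apply continuity_2d_pt_mult.
- cont2_auto. apply cont2_pow_y.
- apply continuity_2d_pt_inv. 2: lra.
  apply continuity_2d_pt_mult. apply continuity_2d_pt_const.
  apply continuity_2d_pt_minus. apply continuity_2d_pt_minus.
  apply continuity_2d_pt_const. apply cont2_pow_x. apply cont2_pow_y.
Qed.

Lemma cf_swap x y : swap cf2 x y = cf1 x y.
Proof. unfold swap, cf1, cf2. f_equal. f_equal. ring. Qed.

Lemma cf_swap' x y : swap cf1 x y = cf2 x y.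
Proof. symmetry; apply (cf_swap y x). Qed.

Lemma cont2_cf2 x y : Wm x y -> cont2 cf2 x y.
Proof.
intros H. apply (continuity_2d_pt_ext (swap cf1)).
- intros u v. apply cf_swap'.
- apply cont2_swap, cont2_cf1. apply Wm_swap, H.
Qed.

Lemma cf1_pos x y : cf1 x y = cf1 (pospart x) (pospart y).
Proof. unfold cf1; rewrite !pos_pos; reflexivity. Qed.

Lemma cf2_pos x y : cf2 x y = cf2 (pospart x) (pospart y).
Proof. unfold cf2; rewrite !pos_pos; reflexivity. Qed.

Lemma Ck_cf_gen b n V : open2 V -> (forall x y, V x y -> Wm x y) ->
  (forall k, Ck true b n V (fun x _ => pospart x ^ k)) ->
  (forall k, Ck true b n V (fun _ y => pospart y ^ k)) ->
  Ck true b n V cf1 /\ Ck true b n V cf2.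
Proof.
intros HV HW Kx Ky.
assert (Ki : Ck true b n V (fun x y => / (2 * (1 - pospart x ^ m - pospart y ^ m)))).
{ apply Ck_inv; auto.
  - intros x y H. apply HW in H. unfold Wm in H. lra.
  - apply Ck_mult; auto. apply Ck_const; auto. apply Ck_minus; auto.
    apply Ck_minus; auto. apply Ck_const; auto. }
split; unfold cf1, cf2; (apply Ck_mult; auto); (apply Ck_mult; auto); apply Ck_const; auto.
Qed.

Lemma Ck_pos_pow b n V k : open2 V -> (forall x y, V x y -> 0 < x) ->
  Ck true b n V (fun x _ => pospart x ^ k).
Proof.
intros HV Hx. apply (Ck_ext true b n V (fun x _ => x ^ k)); auto.
- intros x y H. rewrite pos_id; auto. left; apply (Hx x y H).
- apply (Ck_pow true b n _ (fun x _ => x)); auto. apply Ck_fst_id; auto.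
Qed.

Lemma Ck_cf_x n : Ck true false n (halfx Wm) cf1 /\ Ck true false n (halfx Wm) cf2.
Proof.
assert (HV := open2_halfx _ open2_Wm).
apply Ck_cf_gen; auto.
- intros x y [_ H]; exact H.
- intros k. apply Ck_pos_pow; auto. intros x y [H _]; exact H.
- intros k. apply (Ck_snd n _ (fun y => pospart y ^ k)); auto.
  intros; apply continuous_pos_pow.
Qed.

Lemma Ck_cf n : Ck true true n (quadrant Wm) cf1 /\ Ck true true n (quadrant Wm) cf2.
Proof.
assert (HV := open2_quadrant _ open2_Wm).
apply Ck_cf_gen; auto.
- intros x y (_ & _ & H); exact H.
- intros k. apply Ck_pos_pow; auto. intros x y (H & _); exact H.
- intros k. apply (Ck_swap true true n (swap (quadrant Wm)) (fun x _ => pospart x ^ k)).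
  apply Ck_pos_pow. apply open2_swap, HV. intros x y (_ & H & _); exact H.
Qed.

Lemma Wm_axis x : Wm x 0 <-> pospart x ^ m < 1.
Proof.
unfold Wm. rewrite (pos_id 0), pow_i by (lra || lia). lra.
Qed.

Lemma Wm_axis_y y : Wm 0 y <-> pospart y ^ m < 1.
Proof. rewrite <- Wm_axis. apply Wm_swap. Qed.

Lemma goursat_Wm n (p0 q0 : idx -> R -> R) :
  (forall i x, Wm x 0 -> continuous (p0 i) x) ->
  (forall i x, Wm x 0 -> continuous (q0 i) x) ->
  (forall i x, p0 i x = p0 i (pospart x)) -> (forall i x, q0 i x = q0 i (pospart x)) ->
  (forall i, Ck true false n (halfx Wm) (fun x _ => p0 i x)) ->
  (forall i, Ck true false n (halfx Wm) (fun x _ => q0 i x)) ->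
  exists P Q : idx -> R -> R -> R,
    (forall i x y, Wm x y -> cont2 (P i) x y) /\
    (forall i x y, Wm x y -> cont2 (Q i) x y) /\
    gsol Wm cf1 cf2 p0 q0 P Q /\
    (forall i, Ck true true n (quadrant Wm) (P i)) /\
    (forall i, Ck true true n (quadrant Wm) (Q i)).
Proof.
intros Hp Hq Hpp Hqp Kp Kq.
assert (Ho := open2_Wm). assert (Hl := low_Wm). assert (Hl' := low_swap_Wm).
destruct (goursat_global Wm cf1 cf2 p0 q0) as (P & Q & HP & HQ & HS);
  auto using cont2_cf1, cont2_cf2, cf1_pos, cf2_pos.
{ intros i y Hy. apply Hq. apply Wm_axis, Wm_axis_y, Hy. }
exists P, Q. split; auto. split; auto. split; auto.
destruct (Ck_cf_x n) as [K1 K2]. destruct (Ck_cf n) as [K3 K4].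
destruct (gsol_regular_x Wm cf1 cf2 p0 q0 P Q Ho Hl Hl' cont2_cf1 cont2_cf2 HP HQ HS n
  K1 K2 Kp n (le_n n)) as [KP _].
(* Regularity of Q in y is regularity in x for the swapped system, which has the same form because
   the swap exchanges [cf1] and [cf2]. *)
assert (HS' := gsol_swap _ _ _ _ _ _ _ HS).
destruct (gsol_regular_x Wm cf1 cf2 q0 p0 (fun i => swap (Q i)) (fun i => swap (P i))
  Ho Hl Hl' cont2_cf1 cont2_cf2) with (n := n) (k := n) as [KQ _]; auto.
{ intros i x y H. apply cont2_swap, HQ, Wm_swap, H. }
{ intros i x y H. apply cont2_swap, HP, Wm_swap, H. }
{ intros i x y H. apply Wm_swap in H. destruct (HS' i x y H) as [E1 E2]. split.
  - rewrite E1. f_equal. apply RInt_ext. intros t _. unfold gP.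
    rewrite <- cf_swap, <- cf_swap'. reflexivity.
  - rewrite E2. f_equal. apply RInt_ext. intros t _. unfold gQ.
    rewrite <- cf_swap, <- cf_swap'. reflexivity. }
apply (gsol_regular Wm cf1 cf2 p0 q0 P Q Ho Hl Hl' cont2_cf1 cont2_cf2 HP HQ HS n K3 K4)
  with (k := n); auto.
intros i. apply (Ck_mono _ _ _ (swap (halfx Wm))).
- intros x y [Hy H]. split; auto. apply Wm_swap, H.
- apply (Ck_swap true false n (halfx Wm) (swap (Q i))). apply KQ.
Qed.

End Coef.

(** * Boundary data in the variable X *)

Section Data.

Variables (m n : nat) (alpha : R) (E H : R -> C).
Hypothesis Hm : (2 <= m)%nat.
(* The change of variable x = X^m turns the singularity x^(-alpha) of the
   derivative of the data into a derivative vanishing at X = 0. *)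
Hypothesis Hma : 2 <= INR m * (1 - alpha).
Hypothesis Hadm : admissible_half (S n) alpha E H.

Definition dX (u : R -> R) (X : R) : R :=
  if Rlt_dec 0 X then Derive u (X ^ m) * (INR m * X ^ (m - 1)) else 0.

Lemma dX_eq u X : 0 < X -> dX u X = Derive u (X ^ m) * (INR m * X ^ (m - 1)).
Proof. intros HX; unfold dX; destruct Rlt_dec; tauto. Qed.

Lemma dX_0 u X : X <= 0 -> dX u X = 0.
Proof. intros HX; unfold dX; destruct Rlt_dec; auto; lra. Qed.

Lemma dX_pos u X : dX u X = dX u (pospart X).
Proof.
destruct (Rle_dec X 0) as [HX|HX].
- rewrite pos_neg, !dX_0 by lra. reflexivity.
- rewrite pos_id by lra. reflexivity.
Qed.

Lemma is_derive_pow_m X : is_derive (fun t => t ^ m) X (INR m * X ^ (m - 1)).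
Proof.
replace (m - 1)%nat with (pred m) by lia. apply is_derive_Reals, derivable_pt_lim_pow.
Qed.

Lemma pow_m_range X : 0 < X -> pospart X ^ m < 1 -> 0 < X ^ m < 1.
Proof.
intros HX H1. rewrite pos_id in H1 by lra. split; auto. apply pow_lt, HX.
Qed.

Lemma Rpower_le_self X a : 0 < X -> X <= 1 -> 1 <= a -> Rpower X a <= X.
Proof.
intros HX HX1 Ha. rewrite <- (Rpower_1 X HX) at 2. unfold Rpower.
assert (Hln : ln X <= 0).
{ destruct HX1 as [Hl|Hl]. rewrite <- ln_1. left; apply ln_increasing; auto.
  rewrite Hl, ln_1; lra. }
assert (Hle : a * ln X <= 1 * ln X) by nra.
destruct Hle as [Hle|Hle]. left; apply exp_increasing, Hle. rewrite Hle; lra.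
Qed.

(** The weighted bound gives at most B X^(- m alpha) for |u'(X^m)|; times m X^(m - 1) this is B m
    X^(m (1 - alpha) - 1), and the exponent is at least 1. *)
Lemma dX_small u B d : 0 < d ->
  (forall x, 0 < x < d -> Rabs (Rpower x alpha * Derive u x) <= B) ->
  forall X, 0 < X -> X < d -> X <= 1 -> Rabs (dX u X) <= B * INR m * X.
Proof.
intros Hd HB X HX HXd HX1. rewrite dX_eq by auto.
assert (Hxm : 0 < X ^ m) by (apply pow_lt, HX).
assert (Hxd : X ^ m < d).
{ apply Rle_lt_trans with X; auto. rewrite <- (pow_1 X) at 2.
  replace m with (1 + (m - 1))%nat by lia. rewrite pow_add.
  rewrite <- (Rmult_1_r (X ^ 1)) at 2. apply Rmult_le_compat_l. simpl; lra.
  rewrite <- (pow1 (m - 1)). apply pow_incr; lra. }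
specialize (HB _ (conj Hxm Hxd)).
assert (Hr : 0 < Rpower (X ^ m) alpha) by apply exp_pos.
rewrite Rabs_mult, (Rabs_pos_eq _ (Rlt_le _ _ Hr)) in HB.
assert (Hmp : 0 < INR m) by (apply lt_0_INR; lia).
assert (Hpp : 0 < INR m * X ^ (m - 1)) by (apply Rmult_lt_0_compat; auto; apply pow_lt, HX).
rewrite Rabs_mult, (Rabs_pos_eq (INR m * _)) by lra.
assert (Hw : X ^ (m - 1) <= Rpower (X ^ m) alpha * X).
{ rewrite <- !Rpower_pow by auto. rewrite Rpower_mult.
  replace (Rpower X (INR (m - 1))) with
   (Rpower X (INR m * alpha) * Rpower X (INR (m - 1) - INR m * alpha)).
  - apply Rmult_le_compat_l. left; apply exp_pos.
    apply Rpower_le_self; auto. rewrite minus_INR by lia. simpl. lra.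
  - rewrite <- Rpower_plus. f_equal. ring. }
apply Rle_trans with (Rabs (Derive u (X ^ m)) * (INR m * (Rpower (X ^ m) alpha * X))).
- apply Rmult_le_compat_l. apply Rabs_pos. apply Rmult_le_compat_l; lra.
- replace (Rabs (Derive u (X ^ m)) * (INR m * (Rpower (X ^ m) alpha * X))) with
   (Rpower (X ^ m) alpha * Rabs (Derive u (X ^ m)) * (INR m * X)) by ring.
  rewrite (Rmult_assoc B). apply Rmult_le_compat_r; auto. nra.
Qed.

Lemma dX_cont u B d : 0 < d ->
  (forall x, 0 < x < d -> Rabs (Rpower x alpha * Derive u x) <= B) ->
  (forall x, 0 < x < 1 -> continuous (Derive u) x) ->
  forall X, pospart X ^ m < 1 -> continuous (dX u) X.
Proof.
intros Hd HB Hc X HX1.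
destruct (Rtotal_order X 0) as [HX|[->|HX]].
- apply (continuous_ext_loc _ (fun _ => 0)).
  + assert (Hp : 0 < - X) by lra. exists (mkposreal _ Hp). intros y Hy.
    apply Rabs_lt_between' in Hy; simpl in Hy. symmetry; apply dX_0; lra.
  + apply continuous_const.
- apply continuity_pt_filterlim. intros eps Heps.
  set (K := Rabs B * INR m + 1).
  assert (Hmp : 0 < INR m) by (apply lt_0_INR; lia).
  assert (HK : 0 < K).
  { unfold K. assert (0 <= Rabs B * INR m). apply Rmult_le_pos. apply Rabs_pos. lra. lra. }
  exists (Rmin (Rmin d 1) (eps / K)). split.
  { apply Rmin_pos. apply Rmin_pos; lra. apply Rdiv_lt_0_compat; lra. }
  intros y [_ Hy]. simpl in *. unfold R_dist in *. rewrite (dX_0 u 0) by lra.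
  rewrite Rminus_0_r in *.
  assert (Hy1 := Rlt_le_trans _ _ _ Hy (Rmin_l _ _)).
  assert (Hy2 := Rlt_le_trans _ _ _ Hy (Rmin_r _ _)).
  assert (Hy3 := Rlt_le_trans _ _ _ Hy1 (Rmin_l _ _)).
  assert (Hy4 := Rlt_le_trans _ _ _ Hy1 (Rmin_r _ _)).
  destruct (Rle_dec y 0) as [Hy0|Hy0].
  + rewrite dX_0, Rabs_R0 by lra. exact Heps.
  + rewrite (Rabs_pos_eq y) in * by lra.
    eapply Rle_lt_trans. apply (dX_small u B d); auto; lra.
    apply Rle_lt_trans with (K * y).
    * apply Rmult_le_compat_r. lra. unfold K.
      assert (B * INR m <= Rabs B * INR m) by (apply Rmult_le_compat_r; [lra | apply Rle_abs]).
      lra.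
    * apply (Rmult_lt_compat_l K) in Hy2; auto.
      replace (K * (eps / K)) with eps in Hy2 by (field; lra). exact Hy2.
- apply (continuous_ext_loc _ (fun X => Derive u (X ^ m) * (INR m * X ^ (m - 1)))).
  + exists (mkposreal _ HX). intros y Hy. apply Rabs_lt_between' in Hy; simpl in Hy.
    symmetry; apply dX_eq; lra.
  + apply (continuous_mult (K:=R_AbsRing) (fun X => Derive u (X ^ m))
      (fun X => INR m * X ^ (m - 1))).
    * apply (continuous_comp (fun X => X ^ m) (Derive u)).
      apply (ex_derive_continuous (fun t => t ^ m)). eexists; apply is_derive_pow_m.
      apply Hc, pow_m_range; auto.
    * apply (ex_derive_continuous (fun X => INR m * X ^ (m - 1))). auto_derive; auto.
Qed.

Lemma weighted_bound u : weighted_ext1 alpha u ->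
  exists B d, 0 < d /\ forall x, 0 < x < d ->
    Rabs (Rpower x alpha * Derive (fun t => Re (u t)) x) <= B /\
    Rabs (Rpower x alpha * Derive (fun t => Im (u t)) x) <= B.
Proof.
intros (g & Hg & Heq).
assert (H0 : Ico 1 0) by (unfold Ico; lra).
destruct (Hg 0 H0 (ball (g 0) 1)) as [d Hd]. apply (locally_ball (g 0) (mkposreal 1 Rlt_0_1)).
exists (Rabs (Re (g 0)) + Rabs (Im (g 0)) + 1), (Rmin d 1).
split. apply Rmin_pos. apply cond_pos. lra.
intros x Hx. assert (Hx1 := Rmin_l d 1). assert (Hx2 := Rmin_r d 1).
assert (HI : Ico 1 x) by (unfold Ico; lra).
assert (Hb : ball 0 d x).
{ change (Rabs (x - 0) < d). rewrite Rminus_0_r, Rabs_pos_eq; lra. }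
destruct (Hd x Hb HI) as [B1 B2].
change (Rabs (fst (g x) - fst (g 0)) < 1) in B1.
change (Rabs (snd (g x) - snd (g 0)) < 1) in B2.
rewrite Heq in B1, B2 by (unfold Ioo; lra).
unfold RCderive in B1, B2; simpl in B1, B2.
unfold Re, Im. assert (P1 := Rabs_pos (fst (g 0))). assert (P2 := Rabs_pos (snd (g 0))).
set (a := Rpower x alpha) in *.
set (u1 := Derive (fun t => fst (u t)) x) in *. set (u2 := Derive (fun t => snd (u t)) x) in *.
change (Derive (fun t => Re (u t)) x) with u1 in B1, B2.
change (Derive (fun t => Im (u t)) x) with u2 in B1, B2.
split.
- replace (a * u1) with ((a * u1 - 0 * u2 - fst (g 0)) + fst (g 0)) by ring.
  eapply Rle_trans. apply Rabs_triang. lra.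
- replace (a * u2) with ((a * u2 + 0 * u1 - snd (g 0)) + snd (g 0)) by ring.
  eapply Rle_trans. apply Rabs_triang. lra.
Qed.

(* The components (Re E, Im E, Re H, Im H) and, below, their frame components. *)
Definition comp (i : idx) (x : R) : R :=
  match i with
  | I0 => Re (E x) | I1 => Im (E x) | I2 => Re (H x) | I3 => Im (H x)
  end.

Definition aU (i : idx) (X : R) : R := comp i (pospart X ^ m).

Definition aP (i : idx) (X : R) : R :=
  match i with
  | I0 => (dX (comp I0) X - 2 * (aU I2 X * dX (comp I2) X + aU I3 X * dX (comp I3) X))
      * / (2 * fof aU X)
  | I1 => (dX (comp I1) X - 2 * (aU I2 X * dX (comp I3) X - aU I3 X * dX (comp I2) X))
      * / (2 * fof aU X)
  | i => dX (comp i) X * / sqrt (fof aU X)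
  end.

Lemma aP_pos i X : aP i X = aP i (pospart X).
Proof.
destruct i; unfold aP, fof, aU; rewrite pos_pos, <- !(dX_pos _ X); reflexivity.
Qed.

Lemma pow_m_Ico X : pospart X ^ m < 1 -> Ico 1 (pospart X ^ m).
Proof. intros HX; split; auto. apply pow_le, pos_ge0. Qed.

Lemma fof_aU_gt0 X : pospart X ^ m < 1 -> 0 < fof aU X.
Proof.
intros HX. destruct Hadm as (_ & _ & _ & _ & _ & _ & _ & _ & Hf).
specialize (Hf _ (pow_m_Ico X HX)). unfold bdry_f in Hf.
unfold fof, aU, comp. unfold Cmod in Hf. rewrite pow2_sqrt in Hf.
- unfold Re, Im in *. lra.
- assert (A1 := pow2_ge_0 (fst (H (pospart X ^ m)))).
  assert (A2 := pow2_ge_0 (snd (H (pospart X ^ m)))). lra.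
Qed.

Lemma aU_cont i X : pospart X ^ m < 1 -> continuous (aU i) X.
Proof.
intros HX.
assert (HI : locally X (fun t => Ico 1 (pospart t ^ m))).
{ assert (HV : Wm m X 0) by (apply Wm_axis; auto).
  generalize (open2_x (Wm m) X 0 (open2_Wm m) HV). apply filter_imp.
  intros t Ht. apply pow_m_Ico, Wm_axis; auto. }
destruct Hadm as (HE & HH & _).
assert (Hp := continuous_pos_pow m X).
destruct (cont_on1_comp (Ico 1) E _ X HE Hp HI), (cont_on1_comp (Ico 1) H _ X HH Hp HI).
destruct i; assumption.
Qed.

Lemma comp_regular i : Ck true false (S n) strip (fun x _ => comp i x) /\
  Ck true false n strip (fun x _ => Derive (comp i) x).
Proof.
destruct Hadm as (_ & _ & KE & KH & _).
assert (KE' := proj2 (proj2 KE)). assert (KH' := proj2 (proj2 KH)).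
assert (HR := or_introl (eq_refl : Re = Re) : Re = Re \/ Re = Im).
assert (HI := or_intror (eq_refl : Im = Im) : Im = Re \/ Im = Im).
destruct i; split;
  first [ exact (Cn1_Ck _ _ _ HR KE) | exact (Cn1_Ck _ _ _ HI KE)
    | exact (Cn1_Ck _ _ _ HR KH) | exact (Cn1_Ck _ _ _ HI KH)
    | exact (Cn1_Ck _ _ _ HR KE') | exact (Cn1_Ck _ _ _ HI KE')
    | exact (Cn1_Ck _ _ _ HR KH') | exact (Cn1_Ck _ _ _ HI KH') ].
Qed.

Lemma dX_comp_cont i X : pospart X ^ m < 1 -> continuous (dX (comp i)) X.
Proof.
intros HX. destruct Hadm as (_ & _ & _ & _ & WE & WH & _).
destruct (weighted_bound E WE) as (B & d & Hd & HB).
destruct (weighted_bound H WH) as (B' & d' & Hd' & HB').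
assert (Hc : forall x, 0 < x < 1 -> continuous (Derive (comp i)) x).
{ intros x Hx. apply (cont2_slice_x (fun x _ => Derive (comp i) x) x 0).
  apply (Ck_cont _ _ _ _ _ _ _ (proj2 (comp_regular i)) Hx). }
destruct i; [apply (dX_cont _ B d) | apply (dX_cont _ B d) | apply (dX_cont _ B' d')
  | apply (dX_cont _ B' d')]; auto; intros x Hx; first [apply (HB x Hx) | apply (HB' x Hx)].
Qed.

Lemma aU_derive i X : 0 < X -> pospart X ^ m < 1 -> is_derive (aU i) X (dX (comp i) X).
Proof.
intros HX HX1. rewrite dX_eq by auto.
apply (is_derive_ext_loc (fun X => comp i (X ^ m))).
- exists (mkposreal _ HX). intros y Hy. apply Rabs_lt_between' in Hy; simpl in Hy.
  unfold aU. rewrite pos_id; auto; lra.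
- apply (is_derive_eq _ _ (INR m * X ^ (m - 1) * Derive (comp i) (X ^ m))). 2: ring.
  apply (is_derive_comp (comp i) (fun X => X ^ m)). 2: apply is_derive_pow_m.
  apply (Ck_d1 true false n strip _ _ 0 eq_refl (proj1 (comp_regular i))).
  apply pow_m_range; auto.
Qed.

Lemma data_axis : axis_data (fun X => pospart X ^ m < 1) aU aP.
Proof.
constructor.
- exact aU_cont.
- intros i X HX.
  assert (HF := fof_aU_gt0 X HX). assert (Hs := sqrt_lt_R0 _ HF).
  assert (KU := fun i => cont2_fst _ X 0 (aU_cont i X HX)).
  assert (KD := fun i => cont2_fst _ X 0 (dX_comp_cont i X HX)).
  assert (KF : cont2 (fun X _ => fof aU X) X 0).
  { unfold fof; cbn [pow]. cont2_auto; apply KU. }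
  assert (C1 : cont2 (fun X _ => / (2 * fof aU X)) X 0).
  { apply (continuity_2d_pt_inv (fun X _ => 2 * fof aU X)). 2: lra. cont2_auto. exact KF. }
  assert (C2 : cont2 (fun X _ => / sqrt (fof aU X)) X 0).
  { apply (continuity_2d_pt_inv (fun X _ => sqrt (fof aU X))). 2: lra.
    apply (cont2_comp1 sqrt (fun X _ => fof aU X)); auto.
    apply continuity_pt_filterlim, continuity_pt_sqrt; lra. }
  apply (cont2_slice_x (fun X _ => aP i X) X 0).
  destruct i; unfold aP; cont2_auto; first [assumption | apply KU | apply KD].
- exact fof_aU_gt0.
- intros i X HX HX0. apply (is_derive_eq _ _ _ _ (aU_derive i X HX0 HX)).
  assert (HF := fof_aU_gt0 X HX). assert (Hs := sqrt_lt_R0 _ HF).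
  assert (Hs2 : fof aU X = sqrt (fof aU X) ^ 2) by (symmetry; apply pow2_sqrt; lra).
  unfold FU, aP. set (r := sqrt (fof aU X)) in *. rewrite Hs2.
  destruct i; field; lra.
- intros i. destruct Hadm as (_ & _ & _ & _ & _ & _ & E0 & H0 & _).
  unfold aU. rewrite pos_id, pow_i by (lra || lia).
  destruct i; unfold comp; rewrite ?E0, ?H0; reflexivity.
Qed.

Lemma data_regular i : Ck true false n (halfx (Wm m)) (fun x _ => aP i x).
Proof.
assert (HV := open2_halfx _ (open2_Wm m)).
assert (Hrange : forall x y, halfx (Wm m) x y -> 0 < x /\ pospart x ^ m < 1).
{ intros x y [Hx H']. split; auto. unfold Wm in H'.
  assert (0 <= pospart y ^ m) by (apply pow_le, pos_ge0). lra. }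
assert (Kpow : forall k, Ck true false n (halfx (Wm m)) (fun x _ => INR m * x ^ k)).
{ intros k. apply Ck_mult; auto. apply Ck_const; auto.
  apply (Ck_pow true false n _ (fun x _ => x)); auto. apply Ck_fst_id; auto. }
assert (Hcomp : forall u, Ck true false n strip (fun x _ => u x) ->
  Ck true false n (halfx (Wm m)) (fun x _ => u (x ^ m))).
{ intros u Hu.
  apply (Ck_comp true false n (halfx (Wm m)) strip (fun x _ => u x) (fun x => x ^ m)
    (fun y => y) (fun x => INR m * x ^ (m - 1)) (fun _ => 1)); auto.
  - intros x y Hxy. destruct (Hrange x y Hxy). apply pow_m_range; auto.
  - intros; apply is_derive_pow_m.
  - intros; apply @is_derive_id.
  - apply Ck_const; auto. }
assert (HD : forall i, Ck true false n (halfx (Wm m)) (fun x _ => dX (comp i) x)).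
{ intros j.
  apply (Ck_ext true false n _ (fun x _ => Derive (comp j) (x ^ m) * (INR m * x ^ (m - 1)))); auto.
  - intros x y Hxy. symmetry; apply dX_eq. apply (Hrange x y Hxy).
  - apply Ck_mult; auto. apply (Hcomp (Derive (comp j))), comp_regular. }
assert (HU : forall i, Ck true false n (halfx (Wm m)) (fun x _ => aU i x)).
{ intros j. apply (Ck_ext true false n _ (fun x _ => comp j (x ^ m))); auto.
  - intros x y Hxy. destruct (Hrange x y Hxy). unfold aU. rewrite pos_id; lra.
  - apply (Hcomp (comp j)), Ck_pred, comp_regular. }
assert (HF : Ck true false n (halfx (Wm m)) (fun x _ => fof aU x)).
{ unfold fof. Ck_auto; auto. }
assert (HFp : forall x y, halfx (Wm m) x y -> 0 < fof aU x).
{ intros x y Hxy. apply fof_aU_gt0, (Hrange x y Hxy). }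
assert (HI : Ck true false n (halfx (Wm m)) (fun x _ => / (2 * fof aU x))).
{ apply Ck_inv; auto. intros x y Hxy. specialize (HFp x y Hxy). lra.
  Ck_auto; auto. }
(* The inverse square root is written as exp(- ln f / 2), to which the rules for [exp] and [ln]
   apply. *)
assert (HR : Ck true false n (halfx (Wm m)) (fun x _ => / sqrt (fof aU x))).
{ apply (Ck_ext true false n _ (fun x _ => exp ((- / 2) * ln (fof aU x)))); auto.
  - intros x y Hxy. specialize (HFp x y Hxy).
    rewrite <- exp_half_ln by auto. rewrite <- exp_Ropp. f_equal. field.
  - apply (Ck_exp true false n _ (fun x _ => - / 2 * ln (fof aU x))); auto.
    apply (Ck_mult true false n _ (fun _ _ => - / 2) (fun x _ => ln (fof aU x))); auto.
    apply Ck_const; auto. apply (Ck_ln true false n _ (fun x _ => fof aU x)); auto. }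
destruct i; unfold aP; Ck_auto; auto.
Qed.

End Data.

(** * Back to the original coordinates *)

Lemma Cdiv_RtoC (z : C) (t : R) : t <> 0 -> (z / RtoC t)%C = (Re z / t, Im z / t).
Proof.
intros Ht. destruct z as [u v]. unfold Cdiv, Cinv, RtoC, Cmult; simpl.
apply injective_projections; simpl; field; auto.
Qed.

(* The Ernst-Maxwell equations in terms of the frame: [a], [b] are the factors
   dX/dx, dY/dy of the change of variables, and [r] is 1 - x - y. *)
Lemma ernst_algebra (s g1 g2 e2 a b r x y : R) (p q k : idx -> R) :
  a <> 0 -> b <> 0 -> r <> 0 -> r = 1 - x - y ->
  (forall i, k i = Om q p i + / (2 * r * b) * p i + / (2 * r * a) * q i) ->
  let Up i := FU s g1 g2 p i * a in
  let Uq i := FU s g1 g2 q i * b in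
  let Uk i := dFU s g1 g2 p (s * q I0) (s * q I2) (s * q I3) k i * a * b in
  let E := (s ^ 2 + g1 ^ 2 + g2 ^ 2, e2) in
  let H := (g1, g2) in
  let Ex := (Up I0, Up I1) in let Ey := (Uq I0, Uq I1) in
  let Hx := (Up I2, Up I3) in let Hy := (Uq I2, Uq I3) in
  (let f := RtoC (Re E) - H * Cconj H in
  f * ((Uk I0, Uk I1) - (Ex + Ey) / (2 * (1 - x - y)))
    = Ex * Ey - Cconj H * (Ex * Hy + Ey * Hx) /\
  f * ((Uk I2, Uk I3) - (Hx + Hy) / (2 * (1 - x - y)))
    = / 2 * (Ex * Hy + Ey * Hx) - 2 * Cconj H * Hx * Hy)%C.
Proof.
intros Ha Hb Hr Hrxy Hk Up Uq Uk E H Ex Ey Hx Hy f.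
assert (Hf : f = RtoC (s ^ 2)).
{ unfold f, E, H. apply injective_projections; simpl; ring. }
assert (Hden : (2 * (1 - x - y))%C = RtoC (2 * r)).
{ rewrite Hrxy. apply injective_projections; simpl; ring. }
assert (Hhalf : (/ 2)%C = RtoC (/ 2)) by (rewrite RtoC_inv; auto; lra).
rewrite Hf, Hden, Hhalf, !Cdiv_RtoC by lra.
unfold Uk, dFU. rewrite !Hk. unfold Ex, Ey, Hx, Hy, H, Up, Uq, FU, Om.
split; apply injective_projections; simpl; field; auto.
Qed.

Section Change.

Variable m : nat.
Hypothesis Hm : (2 <= m)%nat.

Let m_pos : 0 < INR m.
Proof. apply lt_0_INR; lia. Qed.

(** The m-th root, inverse to X |-> X^m. [Rpower] never vanishes, so the value at 0 is set by
    hand. *)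
Definition phi (x : R) : R := if Rlt_dec 0 x then Rpower x (/ INR m) else 0.
Definition dphi (x : R) : R := / INR m * Rpower x (/ INR m - 1).

Lemma phi_eq x : 0 < x -> phi x = Rpower x (/ INR m).
Proof. intros; unfold phi; destruct Rlt_dec; tauto. Qed.

Lemma phi_neg x : x <= 0 -> phi x = 0.
Proof. intros; unfold phi; destruct Rlt_dec; auto; lra. Qed.

Lemma phi_gt0 x : 0 < x -> 0 < phi x.
Proof. intros; rewrite phi_eq by auto; apply exp_pos. Qed.

Lemma phi_ge0 x : 0 <= phi x.
Proof. unfold phi; destruct Rlt_dec. left; apply exp_pos. lra. Qed.

Lemma phi_pow x : 0 <= x -> phi x ^ m = x.
Proof.
intros [Hx|<-].
- rewrite phi_eq by auto. rewrite <- Rpower_pow by apply exp_pos.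
  rewrite Rpower_mult, Rinv_l, Rpower_1; auto; lra.
- rewrite phi_neg by lra. apply pow_i; lia.
Qed.

Lemma is_derive_phi x : 0 < x -> is_derive phi x (dphi x).
Proof.
intros Hx. apply (is_derive_ext_loc (fun x => Rpower x (/ INR m))).
- exists (mkposreal _ Hx). intros y Hy. apply Rabs_lt_between' in Hy; simpl in Hy.
  symmetry; apply phi_eq; lra.
- apply is_derive_Reals, derivable_pt_lim_power, Hx.
Qed.

Lemma continuous_phi x : continuous phi x.
Proof.
destruct (Rle_dec x 0) as [Hx|Hx].
- apply continuity_pt_filterlim. intros eps Heps.
  exists (eps ^ m). split. apply pow_lt, Heps.
  intros y [_ Hy]. simpl in *. unfold R_dist in *. rewrite (phi_neg x) by auto.
  rewrite Rminus_0_r, Rabs_pos_eq by apply phi_ge0.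
  destruct (Rle_dec y 0) as [Hy0|Hy0].
  + rewrite phi_neg; auto.
  + destruct (Rlt_dec (phi y) eps) as [|Hn]; auto. exfalso.
    assert (H1 : eps ^ m <= phi y ^ m) by (apply pow_incr; lra).
    rewrite phi_pow in H1 by lra. apply Rabs_def2 in Hy. lra.
- apply (ex_derive_continuous phi). eexists; apply is_derive_phi; lra.
Qed.

Lemma dphi_gt0 x : 0 < dphi x.
Proof. apply Rmult_lt_0_compat. apply Rinv_0_lt_compat; auto. apply exp_pos. Qed.

(** The left side is dx/dX at X = [phi] x, the factor contained in [cf1] and [cf2]. *)
Lemma dphi_inv x : 0 < x -> INR m * phi x ^ (m - 1) = / dphi x.
Proof.
intros Hx. assert (H := dphi_gt0 x).
apply (Rmult_eq_reg_r (dphi x)); [|lra]. rewrite Rinv_l by lra.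
unfold dphi. rewrite phi_eq by auto. rewrite <- Rpower_pow by apply exp_pos.
rewrite Rpower_mult, minus_INR by lia. simpl INR.
transitivity (Rpower x (/ INR m * (INR m - 1)) * Rpower x (/ INR m - 1)).
field; lra.
rewrite <- Rpower_plus. replace (/ INR m * (INR m - 1) + (/ INR m - 1)) with 0 by (field; lra).
apply Rpower_O, Hx.
Qed.

(** The weight x^(1 - 1/m) cancels the singularity of dX/dx exactly, so a weighted derivative is a
    constant times a function continuous in X and Y. *)
Lemma dphi_weight x : Rpower x (1 - / INR m) * dphi x = / INR m.
Proof.
unfold dphi. transitivity (/ INR m * (Rpower x (1 - / INR m) * Rpower x (/ INR m - 1))).
ring. rewrite <- Rpower_plus. replace (1 - / INR m + (/ INR m - 1)) with 0 by ring.
unfold Rpower. rewrite Rmult_0_l, exp_0. ring.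
Qed.

Lemma phi_Wm x y : tri 1 x y -> Wm m (phi x) (phi y).
Proof.
intros (Hx & Hy & H). unfold Wm. rewrite !pos_id by apply phi_ge0.
rewrite !phi_pow; auto.
Qed.

Lemma phi_quadrant x y : tri_int 1 x y -> quadrant (Wm m) (phi x) (phi y).
Proof.
intros (Hx & Hy & H). repeat split; try (apply phi_gt0; auto).
apply phi_Wm. repeat split; lra.
Qed.

Lemma open2_tri : open2 (tri_int 1).
Proof.
intros x y (Hx & Hy & H).
assert (Hd : 0 < Rmin (Rmin x y) ((1 - x - y) / 2)) by (repeat apply Rmin_pos; lra).
exists (mkposreal _ Hd). simpl. intros u v Hu Hv.
assert (H1 := Rmin_l (Rmin x y) ((1 - x - y) / 2)).
assert (H2 := Rmin_r (Rmin x y) ((1 - x - y) / 2)).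
assert (H3 := Rmin_l x y). assert (H4 := Rmin_r x y).
apply Rabs_lt_between' in Hu. apply Rabs_lt_between' in Hv.
repeat split; lra.
Qed.

Lemma Ck_Rpower n c e : Ck true true n (tri_int 1) (fun x _ => c * Rpower x e).
Proof.
assert (Hd : forall c e x, 0 < x -> is_derive (fun x => c * Rpower x e) x
  (c * e * Rpower x (e - 1))).
{ intros d f x Hx. apply (is_derive_eq _ _ (0 * Rpower x f + d * (f * Rpower x (f - 1)))).
  2: ring. apply (is_derive_mult_R (fun _ => d) (fun x => Rpower x f)).
  apply is_derive_const_R. apply is_derive_Reals, derivable_pt_lim_power, Hx. }
assert (Hc : forall c e x y, tri_int 1 x y -> cont2 (fun x _ => c * Rpower x e) x y).
{ intros d f x y [Hx _]. apply (cont2_fst (fun x => d * Rpower x f)).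
  apply (ex_derive_continuous (fun x => d * Rpower x f)). eexists; apply Hd, Hx. }
revert c e; induction n as [|n IH]; intros c e.
- split; auto.
- apply (Ck_S true true n _ _ (fun x _ => c * e * Rpower x (e - 1)) (fun _ _ => 0));
    auto using open2_tri.
  + intros _; split; auto. intros x y [Hx _]. apply Hd, Hx.
  + intros _; split. intros; apply is_derive_const_R. apply Ck_const, open2_tri.
Qed.

Lemma Ck_phi n u : Ck true true n (quadrant (Wm m)) u ->
  Ck true true n (tri_int 1) (fun x y => u (phi x) (phi y)).
Proof.
apply (Ck_comp true true n (tri_int 1) (quadrant (Wm m)) u phi phi dphi dphi).
- apply open2_tri.
- apply phi_quadrant.
- intros x y (Hx & _). apply is_derive_phi, Hx.
- intros x y (_ & Hy & _). apply is_derive_phi, Hy.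
- apply Ck_Rpower.
- apply (Ck_mono _ _ _ (swap (tri_int 1))).
  intros x y (H1 & H2 & H3); repeat split; lra.
  apply (Ck_swap true true n (tri_int 1) (fun x _ => dphi x)), Ck_Rpower.
Qed.

Lemma cont2_phi u : (forall x y, Wm m x y -> cont2 u x y) ->
  forall x y, tri 1 x y -> cont2 (fun x y => u (phi x) (phi y)) x y.
Proof.
intros Hu x y Hxy. apply (cont2_comp u (fun x _ => phi x) (fun _ y => phi y)).
- apply Hu, phi_Wm, Hxy.
- apply cont2_fst, continuous_phi.
- apply cont2_snd, continuous_phi.
Qed.

End Change.

Lemma cont_on2_pair (W : R -> R -> Prop) (u v : R -> R -> R) :
  (forall x y, W x y -> cont2 u x y) -> (forall x y, W x y -> cont2 v x y) ->
  cont_on2 W (fun x y => (u x y, v x y)).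
Proof.
intros Hu Hv. apply continuous_on_forall. intros [x y] Hxy.
apply (continuous_pair _ (fun p => u (fst p) (snd p)) (fun p => v (fst p) (snd p))).
- apply continuity_2d_pt_filterlim, Hu, Hxy.
- apply continuity_2d_pt_filterlim, Hv, Hxy.
Qed.

Lemma Cn2_Ck n W u v : Ck true true n W u -> Ck true true n W v ->
  Cn2 n W (fun x y => (u x y, v x y)).
Proof.
revert u v; induction n as [|n IH]; intros u v Hu Hv.
- split; auto. apply cont_on2_pair; intros; eapply Ck_cont; eauto.
- split; [|split; [|split]].
  + apply cont_on2_pair; intros; eapply Ck_cont; eauto.
  + intros x y Hxy. split; apply RCdiff_pair.
    * eexists; eapply Ck_d1; eauto.
    * eexists; eapply Ck_d1; eauto.
    * eexists; eapply Ck_d2; eauto.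
    * eexists; eapply Ck_d2; eauto.
  + apply (IH (pd1 u) (pd1 v)); apply Ck_S1; auto.
  + apply (IH (pd2 u) (pd2 v)); apply Ck_S2; auto.
Qed.

Lemma Cn2_mono n (W W' : R -> R -> Prop) u : (forall x y, W' x y -> W x y) ->
  Cn2 n W u -> Cn2 n W' u.
Proof.
intros HW; revert u; induction n as [|n IH]; intros u [Hc Hu];
 (split; [apply (continuous_on_subset (fun p => W (fst p) (snd p)));
   [intros p; apply HW | exact Hc] |]); auto.
destruct Hu as (H1 & H2 & H3). split; auto.
Qed.

Lemma weighted_ext2_mono a a' w u : a' <= a -> weighted_ext2 a w u -> weighted_ext2 a' w u.
Proof.
intros Ha (g & Hg & He). exists g. split.
- apply (continuous_on_subset (fun p => tri a (fst p) (snd p))); auto.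
  intros p (H1 & H2 & H3). repeat split; lra.
- intros x y (H1 & H2 & H3). apply He. repeat split; lra.
Qed.

Lemma Cn_solution_mono n a a' E0 H0 E1 H1 E H : a' <= a ->
  Cn_solution n a E0 H0 E1 H1 E H -> Cn_solution n a' E0 H0 E1 H1 E H.
Proof.
intros Ha (S1 & S2 & S3 & S4 & S5 & (beta & Hb & W1 & W2 & W3 & W4 & W5 & W6) & S7 & S8 & S9).
assert (Ht : forall x y, tri a' x y -> tri a x y).
{ intros x y (A1 & A2 & A3). repeat split; lra. }
assert (Hti : forall x y, tri_int a' x y -> tri_int a x y).
{ intros x y (A1 & A2 & A3). repeat split; lra. }
assert (HI : forall x, Ico a' x -> Ico a x).
{ intros x [A1 A2]. split; lra. }
assert (Hsub : forall u, cont_on2 (tri a) u -> cont_on2 (tri a') u).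
{ intros u. apply continuous_on_subset. intros p; apply Ht. }
split; auto. split; auto.
split. apply (Cn2_mono n (tri_int a)); auto. split. apply (Cn2_mono n (tri_int a)); auto.
split; auto. split.
{ exists beta. split; auto.
  split; [|split; [|split; [|split; [|split]]]]; apply (weighted_ext2_mono a); assumption. }
split; auto.
Qed.

(** * The solution in the original coordinates *)

Section Solution.

Variables (m n : nat) (p0 q0 : idx -> R -> R) (P Q : idx -> R -> R -> R)
  (u u' : idx -> R -> R).
Hypothesis Hm : (2 <= m)%nat.
Hypothesis HP : forall i x y, Wm m x y -> cont2 (P i) x y.
Hypothesis HQ : forall i x y, Wm m x y -> cont2 (Q i) x y.
Hypothesis HS : gsol (Wm m) (cf1 m) (cf2 m) p0 q0 P Q.
Hypothesis KP : forall i, Ck true true n (quadrant (Wm m)) (P i).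
Hypothesis KQ : forall i, Ck true true n (quadrant (Wm m)) (Q i).
Hypothesis Hx : axis_data (fun x => Wm m x 0) u p0.
Hypothesis Hy : axis_data (fun y => Wm m 0 y) u' q0.

Let s := rs Q u.
Let G := rG Q u.
Let F := rF Q u.
Let U := rU Q u.
Let ph := phi m.
Let dph := dphi m.
Let k := gP (cf1 m) (cf2 m) P Q.

Let Ho := open2_Wm m.
Let Hl := low_Wm m.
Let Hl' := low_swap_Wm m.
Let Hc1 := cont2_cf1 m.
Let Hc2 := cont2_cf2 m.
Let cs := cont2_rs (Wm m) p0 Q u Ho Hl HQ Hx.
Let cG := cont2_rG (Wm m) p0 Q u Ho Hl HQ Hx.
Let cF := cont2_rF (Wm m) p0 Q u Ho Hl HQ Hx.
Let cU := cont2_rU (Wm m) p0 Q u Ho Hl HQ Hx.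

Definition solE (x y : R) : C := (U I0 (ph x) (ph y), U I1 (ph x) (ph y)).
Definition solH (x y : R) : C := (U I2 (ph x) (ph y), U I3 (ph x) (ph y)).

(** The mixed derivative of the recovered unknowns in X and Y, in the form of the Y-derivative of
    [rF P]. *)
Let T (i : idx) (x y : R) : R :=
  dFU (s x y) (G I2 x y) (G I3 x y) (fun j => P j x y) (s x y * Q I0 x y)
    (s x y * Q I2 x y) (s x y * Q I3 x y) (fun j => k j x y) i.

Let T_cont i x y : Wm m x y -> cont2 (T i) x y.
Proof.
intros H.
assert (Cs : cont2 s x y) by exact (cs x y H).
assert (CG : forall j, cont2 (G j) x y) by exact (fun j => cG j x y H).
assert (CP := fun j => HP j x y H). assert (CQ := fun j => HQ j x y H).
assert (Ck' : forall j, cont2 (k j) x y) by (intros; apply cont2_gP; auto).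
destruct i; unfold T, dFU; simpl pow; cont2_auto;
  first [exact Cs | exact (CG _) | exact (CP _) | exact (CQ _) | exact (Ck' _)].
Qed.

Lemma sol_dx i x y : tri_int 1 x y ->
  Derive (fun t => U i (ph t) (ph y)) x = F P i (ph x) (ph y) * dph x.
Proof.
intros Hxy. apply is_derive_unique. rewrite Rmult_comm.
apply (is_derive_comp (fun t => U i t (ph y)) ph).
- apply (rU_dx (Wm m) (cf1 m) (cf2 m) p0 q0 P Q u); auto.
  destruct (phi_quadrant m Hm x y Hxy) as (A1 & A2 & A3). split; auto.
- apply is_derive_phi, Hxy.
Qed.

Lemma sol_dy i x y : tri_int 1 x y ->
  Derive (fun t => U i (ph x) (ph t)) y = F Q i (ph x) (ph y) * dph y.
Proof.
intros Hxy. apply is_derive_unique. rewrite Rmult_comm.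
apply (is_derive_comp (fun t => U i (ph x) t) ph).
- destruct (phi_quadrant m Hm x y Hxy) as (A1 & A2 & A3).
  apply (rU_dy (Wm m) p0 Q u); auto.
- apply is_derive_phi, Hxy.
Qed.

Lemma sol_dxy i x y : tri_int 1 x y ->
  Derive (fun t => Derive (fun r => U i (ph r) (ph t)) x) y =
  T i (ph x) (ph y) * (dph x * dph y).
Proof.
intros Hxy. apply is_derive_unique.
apply (is_derive_ext_loc (fun t => F P i (ph x) (ph t) * dph x)).
- generalize (open2_y (tri_int 1) x y open2_tri Hxy). apply filter_imp.
  intros t Ht. symmetry; apply sol_dx, Ht.
- apply (is_derive_eq _ _ (dph y * T i (ph x) (ph y) * dph x + F P i (ph x) (ph y) * 0)).
  2: ring. apply (is_derive_mult_R (fun t => F P i (ph x) (ph t)) (fun _ => dph x)).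
  2: apply is_derive_const_R. apply (is_derive_comp (F P i (ph x)) ph).
  + apply (rF_dy (Wm m) (cf1 m) (cf2 m) p0 q0 P Q u); auto. apply phi_quadrant; auto.
  + apply is_derive_phi, Hxy.
Qed.

Lemma sol_ernst x y : tri_int 1 x y -> ernst_maxwell_at solE solH x y.
Proof.
intros Hxy.
destruct (phi_quadrant m Hm x y Hxy) as (A1 & A2 & A3).
assert (Hr : 1 - pospart (ph x) ^ m - pospart (ph y) ^ m = 1 - x - y).
{ destruct Hxy as (Bx & By & _). rewrite !pos_id by apply phi_ge0.
  unfold ph. rewrite !phi_pow; auto; lra. }
assert (Hdx := dphi_gt0 m Hm x). assert (Hdy := dphi_gt0 m Hm y). fold dph in Hdx, Hdy.
(* Replacing Re E by s^2 + |H|^2 brings the equations to the form of [ernst_algebra], an identity in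
   the frame variables. *)
assert (HE : solE x y = (s (ph x) (ph y) ^ 2 + G I2 (ph x) (ph y) ^ 2
  + G I3 (ph x) (ph y) ^ 2, U I1 (ph x) (ph y))).
{ assert (HF : U I0 (ph x) (ph y) - G I2 (ph x) (ph y) ^ 2 - G I3 (ph x) (ph y) ^ 2
    = s (ph x) (ph y) ^ 2) by exact (rU_rs (Wm m) p0 Q u Ho Hl HQ Hx _ _ A3).
  unfold solE. f_equal. lra. }
assert (D : forall i, Derive (fun t => U i (ph t) (ph y)) x = F P i (ph x) (ph y) * dph x)
  by (intros; apply sol_dx, Hxy).
assert (D' : forall i, Derive (fun t => U i (ph x) (ph t)) y = F Q i (ph x) (ph y) * dph y)
  by (intros; apply sol_dy, Hxy).
assert (D'' : forall i, Derive (fun t => Derive (fun r => U i (ph r) (ph t)) x) y =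
  T i (ph x) (ph y) * dph x * dph y) by (intros; rewrite Rmult_assoc; apply sol_dxy, Hxy).
unfold ernst_maxwell_at. rewrite HE.
unfold pdxy, pdx, pdy, RCderive, solE, solH. cbv beta iota zeta delta [Re Im fst snd].
rewrite !D, !D', !D''.
apply (ernst_algebra (s (ph x) (ph y)) (G I2 (ph x) (ph y)) (G I3 (ph x) (ph y))
  (U I1 (ph x) (ph y)) (dph x) (dph y) (1 - x - y) x y
  (fun j => P j (ph x) (ph y)) (fun j => Q j (ph x) (ph y)) (fun j => k j (ph x) (ph y)));
  try lra.
- destruct Hxy; lra.
- intros i. unfold k, gP, cf1, cf2. rewrite Hr, !pos_id by apply phi_ge0.
  unfold ph. rewrite !dphi_inv by (auto; apply Hxy). fold dph. fold ph.
  rewrite !Rinv_mult. f_equal; [f_equal; f_equal |]; ring.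
Qed.

Lemma weighted_sol (w d : R -> R -> R) (c : R) (D : R -> R -> C) (v1 v2 : R -> R -> R) :
  (forall x y, Wm m x y -> cont2 v1 x y) -> (forall x y, Wm m x y -> cont2 v2 x y) ->
  (forall x y, tri_int 1 x y ->
     D x y = (v1 (ph x) (ph y) * d x y, v2 (ph x) (ph y) * d x y)) ->
  (forall x y, w x y * d x y = c) ->
  weighted_ext2 1 w D.
Proof.
intros H1 H2 HD Hw.
exists (fun x y => (c * v1 (ph x) (ph y), c * v2 (ph x) (ph y))). split.
- apply cont_on2_pair; intros x y Hxy; cont2_auto; apply (cont2_phi m Hm); auto.
- intros x y Hxy. rewrite HD by auto. rewrite <- (Hw x y).
  apply injective_projections; simpl; ring.
Qed.

Lemma solution : Cn_solution (S n) 1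
  (fun x => (u I0 (ph x), u I1 (ph x))) (fun x => (u I2 (ph x), u I3 (ph x)))
  (fun y => (u' I0 (ph y), u' I1 (ph y))) (fun y => (u' I2 (ph y), u' I3 (ph y)))
  solE solH.
Proof.
assert (KU : forall i, Ck true true (S n) (quadrant (Wm m)) (U i))
  by exact (rU_regular (Wm m) (cf1 m) (cf2 m) p0 q0 P Q u Ho Hl Hl' Hc1 Hc2 HP HQ HS Hx n KP KQ).
assert (H0 : ph 0 = 0) by (apply phi_neg; lra).
split; [|split; [|split; [|split; [|split; [|split; [|split; [|split]]]]]]].
- apply cont_on2_pair; apply (cont2_phi m Hm), cU.
- apply cont_on2_pair; apply (cont2_phi m Hm), cU.
- apply Cn2_Ck; apply (Ck_phi m Hm), KU.
- apply Cn2_Ck; apply (Ck_phi m Hm), KU.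
- apply sol_ernst.
(* The exponent beta is dictated by the substitution; it exceeds alpha when m (1 - alpha) >= 2. *)
- exists (1 - / INR m).
  assert (Hmi : 0 < / INR m <= 1).
  { assert (H2 : 2 <= INR m) by (apply (le_INR 2); exact Hm). split.
    apply Rinv_0_lt_compat; lra. rewrite <- Rinv_1. apply Rinv_le_contravar; lra. }
  split. lra.
  assert (Wt : forall x : R, Rpower x (1 - / INR m) * dph x = / INR m)
    by (intros; apply dphi_weight).
  assert (Wxy : forall x y : R, (Rpower x (1 - / INR m) * Rpower y (1 - / INR m)) *
    (dph x * dph y) = / INR m * / INR m).
  { intros x y.
    transitivity ((Rpower x (1 - / INR m) * dph x) * (Rpower y (1 - / INR m) * dph y)).
    ring. rewrite (Wt x), (Wt y). reflexivity. }
  assert (FP : forall i x y, Wm m x y -> cont2 (F P i) x y) by (intros; apply cF; auto).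
  assert (FQ : forall i x y, Wm m x y -> cont2 (F Q i) x y) by (intros; apply cF; auto).
  assert (Hpair : forall a b c d : R, a = b -> c = d -> (a, c) = (b, d)) by congruence.
  split; [|split; [|split; [|split; [|split]]]].
  + apply (weighted_sol _ (fun x _ => dph x) (/ INR m) _ (F P I0) (F P I1)); auto.
    intros; apply Hpair; apply sol_dx; auto.
  + apply (weighted_sol _ (fun x _ => dph x) (/ INR m) _ (F P I2) (F P I3)); auto.
    intros; apply Hpair; apply sol_dx; auto.
  + apply (weighted_sol _ (fun _ y => dph y) (/ INR m) _ (F Q I0) (F Q I1)); auto.
    intros; apply Hpair; apply sol_dy; auto.
  + apply (weighted_sol _ (fun _ y => dph y) (/ INR m) _ (F Q I2) (F Q I3)); auto.
    intros; apply Hpair; apply sol_dy; auto.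
  + apply (weighted_sol _ (fun x y => dph x * dph y) (/ INR m * / INR m) _ (T I0) (T I1)); auto.
    intros; apply Hpair; apply sol_dxy; auto.
  + apply (weighted_sol _ (fun x y => dph x * dph y) (/ INR m * / INR m) _ (T I2) (T I3)); auto.
    intros; apply Hpair; apply sol_dxy; auto.
- intros x Hx0. unfold solE, solH, U, rU. rewrite H0, !prim_0. auto.
- intros y [Hy0 Hy1]. unfold solE, solH. rewrite H0.
  assert (HU : forall i, U i 0 (ph y) = u' i (ph y)).
  { intros i. apply (rU_axis_y (Wm m) (cf1 m) (cf2 m) p0 q0 P); auto. apply phi_ge0.
    rewrite <- H0. apply phi_Wm; auto. repeat split; lra. }
  rewrite !HU. auto.
- intros x y Hxy. assert (HW := phi_Wm m Hm x y Hxy).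
  assert (HF : U I0 (ph x) (ph y) - U I2 (ph x) (ph y) ^ 2 - U I3 (ph x) (ph y) ^ 2
    = s (ph x) (ph y) ^ 2) by exact (rU_rs (Wm m) p0 Q u Ho Hl HQ Hx _ _ HW).
  assert (Hs : 0 < s (ph x) (ph y)) by apply exp_pos.
  unfold solE, solH, Cmod. rewrite pow2_sqrt by (simpl; nra).
  unfold Re, fst, snd. nra.
Qed.

End Solution.

Lemma Cn_solution_ext n a E0 H0 E1 H1 E0' H0' E1' H1' E H :
  (forall x, Ico a x -> E0 x = E0' x /\ H0 x = H0' x) ->
  (forall x, Ico a x -> E1 x = E1' x /\ H1 x = H1' x) ->
  Cn_solution n a E0 H0 E1 H1 E H -> Cn_solution n a E0' H0' E1' H1' E H.
Proof.
intros X0 X1 (S1 & S2 & S3 & S4 & S5 & S6 & S7 & S8 & S9).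
assert (S7' : forall x, Ico a x -> E x 0 = E0' x /\ H x 0 = H0' x).
{ intros x Hx. destruct (X0 x Hx) as [<- <-]. auto. }
assert (S8' : forall y, Ico a y -> E 0 y = E1' y /\ H 0 y = H1' y).
{ intros x Hx. destruct (X1 x Hx) as [<- <-]. auto. }
exact (conj S1 (conj S2 (conj S3 (conj S4 (conj S5 (conj S6 (conj S7' (conj S8' S9)))))))).
Qed.

Lemma axis_data_sub (D D' : R -> Prop) u p : (forall x, D' x -> D x) ->
  axis_data D u p -> axis_data D' u p.
Proof. intros HD []. constructor; auto. Qed.

Theorem goursat_exists (n : nat) (alpha : R) (E0 H0 E1 H1 : R -> C) :
  (1 <= n)%nat -> 0 <= alpha < 1 -> admissible_data n alpha E0 H0 E1 H1 ->
  exists E H : R -> R -> C, Cn_solution n 1 E0 H0 E1 H1 E H.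
Proof.
intros Hn Ha [A0 A1]. destruct n as [|n]. lia.
(* An integer m >= 2 with m (1 - alpha) >= 2 is wanted; two more than the integer part of 2 / (1 -
   alpha) is enough. *)
destruct (nfloor_ex (2 / (1 - alpha))) as [k [_ Hk]].
{ apply Rdiv_le_0_compat; lra. }
pose (m := (k + 2)%nat).
assert (Hm : (2 <= m)%nat) by (unfold m; lia).
assert (Hma : 2 <= INR m * (1 - alpha)).
{ assert (H : 2 / (1 - alpha) <= INR m) by (unfold m; rewrite plus_INR; simpl; lra).
  apply (Rmult_le_compat_r (1 - alpha)) in H; [|lra].
  replace (2 / (1 - alpha) * (1 - alpha)) with 2 in H by (field; lra). exact H. }
assert (D0 := data_axis m n alpha E0 H0 Hm Hma A0).
assert (D1 := data_axis m n alpha E1 H1 Hm Hma A1).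
destruct (goursat_Wm m Hm n (aP m E0 H0) (aP m E1 H1)) as (P & Q & HP & HQ & HS & KP & KQ).
- intros i x Hx. apply (ax_p D0), Wm_axis; auto.
- intros i x Hx. apply (ax_p D1), Wm_axis; auto.
- apply aP_pos.
- apply aP_pos.
- apply (data_regular m n alpha E0 H0); auto.
- apply (data_regular m n alpha E1 H1); auto.
- assert (D0' : axis_data (fun x => Wm m x 0) (aU m E0 H0) (aP m E0 H0)).
  { apply (axis_data_sub (fun x => pospart x ^ m < 1)); auto. intros x; apply Wm_axis; auto. }
  assert (D1' : axis_data (fun y => Wm m 0 y) (aU m E1 H1) (aP m E1 H1)).
  { apply (axis_data_sub (fun x => pospart x ^ m < 1)); auto. intros x; apply Wm_axis_y; auto. }
  assert (HSol := solution m n _ _ P Q _ _ Hm HP HQ HS KP KQ D0' D1').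
  eexists; eexists. eapply Cn_solution_ext; [| | exact HSol];
    (intros x [Hx _]; unfold aU, comp; rewrite pos_id by apply phi_ge0;
     rewrite phi_pow by auto; split; symmetry; apply surjective_pairing).
Qed.

Theorem theorem2 :
  (forall (n : nat) (alpha : R) (E0 H0 E1 H1 : R -> C),
     (2 <= n)%nat -> 0 <= alpha < 1 ->
     admissible_data n alpha E0 H0 E1 H1 ->
     (forall x y : R, tri 1 x y -> RH_solvable E0 H0 E1 H1 x y) ->
     exists E H : R -> R -> C, Cn_solution n 1 E0 H0 E1 H1 E H)
  /\
  (forall delta : R, 0 < delta < 1 ->
     exists c : R, 0 < c /\
       forall (n : nat) (alpha : R) (E0 H0 E1 H1 : R -> C),
         (2 <= n)%nat -> 0 <= alpha < 1 ->
         admissible_data n alpha E0 H0 E1 H1 ->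
         L1_norm_lt (1 - delta) c (Acoef E0 H0) ->
         L1_norm_lt (1 - delta) c (Acoef E1 H1) ->
         L1_norm_lt (1 - delta) c (Hcoef E0 H0) ->
         L1_norm_lt (1 - delta) c (Hcoef E1 H1) ->
         exists E H : R -> R -> C,
           Cn_solution n (1 - delta) E0 H0 E1 H1 E H).
Proof.
split.
- intros n alpha E0 H0 E1 H1 Hn Ha Hadm _.
  apply (goursat_exists n alpha); auto. lia.
- intros delta Hd. exists 1. split. lra.
  intros n alpha E0 H0 E1 H1 Hn Ha Hadm _ _ _ _.
  destruct (goursat_exists n alpha E0 H0 E1 H1) as (E & H & HS); auto. lia.
  (* The solution on the whole triangle restricts to the smaller one. *)
  exists E, H. apply (Cn_solution_mono n 1); auto. lra.
Qed.
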